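(* Let $\alpha>-1/2$. There exists $\varepsilon_0>0$ such that for every $0<\varepsilon<\varepsilon_0$ there is a constant $C$, depending only on $\varepsilon$ and $\alpha$, such that whenever $S$ and $\Sigma$ are $(\varepsilon,\alpha)$-thin subsets of $\mathbb{R}^+$, every $f\in L^2_\alpha(\mathbb{R}^+)$ satisfies $$\|f\|_{L^2_\alpha}\le C\Big(\|f\|_{L^2_\alpha(\mathbb{R}^+\setminus S)}+\|\mathcal{F}_\alpha(f)\|_{L^2_\alpha(\mathbb{R}^+\setminus\Sigma)}\Big).$$
   Context: Fix $\alpha>-1/2$. Let $d\mu_\alpha(x)=(2\pi)^{\alpha+1}x^{2\alpha+1}\,dx$ on $\mathbb{R}^+=[0,\infty)$, and $L^2_\alpha(\mathbb{R}^+)=L^2(\mathbb{R}^+,\mu_\alpha)$; for $A\subset\mathbb{R}^+$, $\|g\|_{L^2_\alpha(A)}=(\int_A|g|^2d\mu_\alpha)^{1/2}$. The normalized Bessel function is $j_\alpha(x)=J_\alpha(x)/x^\alpha=2^{-\alpha}\sum_{n\ge0}\frac{(-1)^n}{n!\Gamma(n+\alpha+1)}(x/2)^{2n}$. For $f\in L^1_\alpha(\mathbb{R}^+)$ the Fourier-Bessel transform is $\mathcal{F}_\alpha(f)(y)=\int_0^\infty f(x)j_\alpha(2\pi xy)\,d\mu_\alpha(x)$; it extends to a unitary operator on $L^2_\alpha(\mathbb{R}^+)$. For $\varepsilon\in(0,1)$, a measurable set $S\subset\mathbb{R}^+$ is $(\varepsilon,\alpha)$-thin if $\mu_\alpha(S\cap[x,x+1])\le\varepsilon\,\mu_\alpha([x,x+1])$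 for all $0\le x\le1$, and $\mu_\alpha(S\cap[x,x+\frac1x])\le\varepsilon\,\mu_\alpha([x,x+\frac1x])$ for all $x>1$. *)

(* Defs.v *)
From HB Require Import structures.
From mathcomp Require Import all_boot all_order all_algebra.
From mathcomp Require Import all_classical all_reals all_analysis.
Set Implicit Arguments. Unset Strict Implicit. Unset Printing Implicit Defensive.
Import Order.TTheory GRing.Theory Num.Theory.
Import numFieldNormedType.Exports.
Local Open Scope classical_set_scope.
Local Open Scope ring_scope.

Section FB.
Variable R : realType.

Definition Rplus : set R := `[0, +oo[%classic.

Definition Gamma (s : R) : R :=
  fine (\int[lebesgue_measure]_(t in `]0, +oo[%classic) ((t `^ (s - 1)) * expR (- t))%:E).

(* normalized Bessel function j_alpha(x) = J_alpha(x)/x^alpha, via its power series *)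
Definition jbessel (alpha x : R) : R :=
  2 `^ (- alpha) *
  limn (fun N : nat => \sum_(0 <= n < N)
           ((-1) ^+ n / ((n`!)%:R * Gamma (n%:R + alpha + 1)) * (x / 2) ^+ (2 * n))).

Definition wdens (alpha x : R) : R := (2 * pi) `^ (alpha + 1) * x `^ (2 * alpha + 1).

Definition mu_a (alpha : R) (A : set R) : \bar R :=
  \int[lebesgue_measure]_(x in A `&` Rplus) (wdens alpha x)%:E.

Definition sqnorm (alpha : R) (A : set R) (h : R -> R) : \bar R :=
  \int[lebesgue_measure]_(x in A `&` Rplus) (wdens alpha x * h x ^+ 2)%:E.

Definition inL2 (alpha : R) (h : R -> R) : Prop :=
  measurable_fun Rplus h /\ (sqnorm alpha setT h < +oo)%E.

(* L^2_alpha(A) norm of a complex-valued function given by its real and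
   imaginary parts (u, v) : ||u + i v||_{L^2_alpha(A)} *)
Definition cnorm (alpha : R) (A : set R) (u v : R -> R) : R :=
  Num.sqrt (fine (sqnorm alpha A u + sqnorm alpha A v)%E).

Definition FB1 (alpha : R) (f : R -> R) (y : R) : R :=
  fine (\int[lebesgue_measure]_(x in Rplus)
          (f x * jbessel alpha (2 * pi * x * y) * wdens alpha x)%:E).

(* truncation f 1_[0,n] (in L^1_alpha cap L^2_alpha when f in L^2_alpha) *)
Definition trunc (f : R -> R) (n : nat) (x : R) : R :=
  if (x <= n%:R) then f x else 0.

(* g is (a representative of) the unitary L^2 extension of the Fourier-Bessel
   transform applied to f:  F_alpha(f 1_[0,n]) -> g in L^2_alpha. *)
Definition isFB (alpha : R) (f g : R -> R) : Prop :=
  inL2 alpha g /\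
  (fun n : nat => sqnorm alpha setT (fun y => FB1 alpha (trunc f n) y - g y))
     @ \oo --> (0 : \bar R)%E.

Definition Icc (a b : R) : set R := `[a, b]%classic.

Definition thin (alpha eps : R) (S : set R) : Prop :=
  measurable S /\ S `<=` Rplus /\
  (forall x : R, 0 <= x <= 1 ->
     (mu_a alpha (S `&` Icc x (x + 1)) <= eps%:E * mu_a alpha (Icc x (x + 1)))%E) /\
  (forall x : R, 1 < x ->
     (mu_a alpha (S `&` Icc x (x + x^-1)) <= eps%:E * mu_a alpha (Icc x (x + x^-1)))%E).

End FB.

(* Main.v *)
(* Let T_s be the semigroup with the Bessel heat kernel p_s(x,y) and e_s(x) =
   exp(-pi s x^2). By Weber's integral F_alpha exchanges T_s with
   multiplication by e_s, so the form Phi_f(s,t) = \int e_s f T_t f satisfies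
   Phi_f(s,t) = Phi_g(t,s) with g = F_alpha f. Phi_f(s,s) tends to 0 as s grows
   and controls |f|^2 as s tends to 0 (T_s is an approximate identity), so |f|^2
   is bounded by the sum over the scales 16^j s of Phi_f(u,u) - Phi_f(16u,16u).
   Changing s and t one at a time and using the symmetry, each difference is
   dominated by the quadratic forms of the positive kernel
   (e_u - e_{16u})(x) p_{16u}(x,y) in |f| and in |g|. A Harnack inequality for
   p_u on the cells [x, x + 1/x] shows that a thin set carries only a small part
   of the x-mass of this kernel, uniformly in u and y; the mass also decays
   geometrically away from one scale, so it sums to something small. Schur's
   test then bounds |f|^2 by a small multiple of itself plus the masses of f
   off S and of g off Sigma. *)

Require Import Defs.
From HB Require Import structures.
From mathcomp Require Import all_boot all_order all_algebra.
From mathcomp Require Import all_classical all_reals all_analysis.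
From mathcomp Require Import measurable_realfun.
From mathcomp Require Import ring lra.
Set Implicit Arguments. Unset Strict Implicit. Unset Printing Implicit Defensive.
Import Order.TTheory GRing.Theory Num.Theory.
Import numFieldNormedType.Exports.
Local Open Scope classical_set_scope.
Local Open Scope ring_scope.

(** Swapping the two scales swaps f and g, so the hypotheses on S and on Sigma can both be used at
    every scale. No inversion theorem enters: g is only known to be bounded and square integrable,
    but it is always met by a Gaussian or a heat kernel, and Fubini for integrable functions
    suffices. The obstacle is that the number of scales is unbounded, so a small bound at each of
    them does not add up. At a given y the mass over S is bounded by a small delta and also by a
    quantity decaying on both sides of the scale 1 / max(1, y)^2. The geometric mean of the two
    bounds is small and summable, uniformly in y. In the other variable no smallness is asked: the
    Gaussian differences telescope to at most 1. Cells of length 1/x have the right size. Where 16 s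
    x^2 is small, the Gaussian difference itself is small; elsewhere 1/x is at most comparable with
    the heat length, and the kernel varies by a bounded factor on a cell. The ratio 16 is a fourth
    power because the decay is measured in the fourth root of the scale, which then has ratio 2. *)

Lemma measurable_Rplus (R : realType) : measurable (@Rplus R).
Proof. exact: measurable_itv. Qed.

(** * The measure mu_a and integration against it *)

Section weighted_measure.
Variables (R : realType) (alpha : R).
Local Notation leb := (@lebesgue_measure R).
Local Notation Rp := (@Rplus R).
Local Notation w := (wdens alpha).

Lemma measurable_wdens (D : set R) : measurable_fun D w.
Proof.
apply: measurable_funM => //; apply: measurable_funTS; exact: measurable_powR.
Qed.

Lemma wdens_ge0 x : 0 <= w x.
Proof. by rewrite mulr_ge0 ?powR_ge0. Qed.

Let mu0 : mu_a alpha set0 = 0%E.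
Proof. by rewrite /mu_a set0I integral_set0. Qed.

Let mu_ge0 A : (0 <= mu_a alpha A)%E.
Proof. by apply: integral_ge0 => x _; rewrite lee_fin wdens_ge0. Qed.

Let mu_sigma : semi_sigma_additive (mu_a alpha).
Proof.
move=> F mF tF mUF; rewrite /mu_a setI_bigcupl.
rewrite ge0_integral_bigcup//=.
- have := @is_cvg_ereal_nneg_natsum R (fun n => mu_a alpha (F n)) 0%N; apply => n _; exact: mu_ge0.
- move=> k; apply: measurableI; [exact: mF|exact: measurable_Rplus].
- apply/measurable_EFinP; exact: measurable_wdens.
- by move=> x _; rewrite lee_fin wdens_ge0.
- exact: trivIset_setIr.
Qed.

HB.instance Definition _ := isMeasure.Build _ _ _ (mu_a alpha) mu0 mu_ge0 mu_sigma.

Lemma mu_a_sigma_finite : sigma_finite setT (mu_a alpha).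
Proof.
(* The weight is capped together with the interval because for alpha below -1/2 the density is
   unbounded near 0. *)
pose F (n : nat) := (`[(- n%:R)%R, n%:R]%classic `&` (w @^-1` `]-oo, n%:R]%classic)) : set R.
have mF n : measurable (F n).
  apply: measurableI => //; rewrite -[X in measurable X]setTI.
  exact: measurable_wdens.
exists F; last first.
  move=> n; split => //.
  apply: (@le_lt_trans _ _ (\int[leb]_(x in `[(- n%:R)%R, n%:R]) (n%:R%:E))%E).
    apply: (@le_trans _ _ (\int[leb]_(x in F n `&` Rp) (n%:R%:E))%E).
      apply: ge0_le_integral => //.
      + by apply: measurableI; [exact: mF|exact: measurable_Rplus].
      + by move=> x _; rewrite lee_fin wdens_ge0.
      + by apply/measurable_EFinP; exact: measurable_wdens.
      + by move=> x [[_ /=]]; rewrite in_itv/= lee_fin.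
    apply: ge0_subset_integral => //.
    + by apply: measurableI; [exact: mF|exact: measurable_Rplus].
    + by move=> x [[]].
  rewrite integral_cst//= lebesgue_measure_itv/=; case: ifP => _ //.
    by rewrite -EFinB -EFinM ltry.
  by rewrite mule0.
rewrite predeqE => x; split => // _.
have [n /= nx] : exists n : nat, Num.max `|x| (w x) <= n%:R.
  exists (Num.truncn (Num.max `|x| (w x))).+1; exact/ltW/truncnS_gt.
exists n => //; move: nx; rewrite ge_max ler_norml => /andP[nx wx].
by split; rewrite /= in_itv.
Qed.

HB.instance Definition _ := @Measure_isSigmaFinite.Build _ _ _ (mu_a alpha) mu_a_sigma_finite.

Import HBNNSimple.

(** Simple functions reduce the change of density to indicators, where it is the definition of
    [mu_a]. The measure lives on the whole line but charges only the half-line. *)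
Lemma ge0_integral_mu_a (f : R -> \bar R) :
  measurable_fun setT f -> (forall x, 0 <= f x)%E ->
  (\int[mu_a alpha]_x f x = \int[leb]_(x in Rp) (f x * (w x)%:E))%E.
Proof.
move=> mf f0.
pose h := nnsfun_approx (@measurableT _ _) mf.
have mRp := @measurable_Rplus R.
have hnd a b x : (a <= b)%N -> h a x <= h b x.
  by move=> ab; exact/lefP/nd_nnsfun_approx.
have mw := @measurable_wdens.
have -> : (\int[mu_a alpha]_x f x = limn (fun n => \int[mu_a alpha]_x ((h n x)%:E)))%E.
  have fE x : setT x -> (f x = lim ((EFin \o h n) x @[n --> \oo]))%E.
    by move=> Ex; apply/esym/cvg_lim => //; exact: cvg_nnsfun_approx.
  under eq_integral => x /[!inE] /fE -> //.
  apply: monotone_convergence => //.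
  - by move=> n; apply/measurable_EFinP.
  - by move=> n x Ex /=; rewrite lee_fin fun_ge0.
  - by move=> x Ex a b ab; rewrite lee_fin; exact: hnd.
have -> : (\int[leb]_(x in Rp) (f x * (w x)%:E) =
    limn (fun n => \int[leb]_(x in Rp) ((h n x)%:E * (w x)%:E)))%E.
  have fg x : Rp x -> (f x * (w x)%:E = lim (((EFin \o h n) \* (EFin \o w)) x @[n --> \oo]))%E.
    by move=> Ex; apply/esym/cvg_lim => //; apply: cvgeZr => //; exact: cvg_nnsfun_approx.
  under eq_integral => x /[!inE] /fg -> //.
  apply: monotone_convergence => //.
  - move=> n; apply: emeasurable_funM; apply: measurable_funTS.
      apply/measurable_EFinP; have := @measurable_funPT _ _ _ _ (h n); exact: id.
    by apply/measurable_EFinP; exact: mw.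
  - by move=> n x Ex /=; rewrite mule_ge0 ?lee_fin ?wdens_ge0.
  - by move=> x Ex a b ab/=; rewrite lee_wpmul2r ?lee_fin ?wdens_ge0//; exact: hnd.
have mind n r D : measurable_fun (T:=measurableTypeR R) D (\1_(h n @^-1` [set r]) : _ -> R).
  apply: measurable_funTS; apply: measurable_indic.
  by rewrite -[X in measurable X]setTI; exact: (@measurable_funPT _ _ _ _ (h n)).
congr (limn _); apply/funext => n.
under eq_integral do rewrite fimfunE -fsumEFin//.
rewrite ge0_integral_fsum//; last 2 first.
  - by move=> r; apply/measurable_EFinP; exact: measurable_funM.
  - by move=> m y Ey; exact: nnfun_muleindic_ge0.
under [RHS]eq_integral => x xE.
  rewrite fimfunE -fsumEFin// ge0_mule_fsuml; last first.
    by move=> y; exact: nnfun_muleindic_ge0.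
  over.
rewrite ge0_integral_fsum//; last 2 first.
  - move=> y; apply: emeasurable_funM; apply/measurable_EFinP.
      apply: measurable_funM; [exact: measurable_cst|exact: mind].
    exact: mw.
  - by move=> m y Ey; rewrite mule_ge0 ?[(0 <= (w _)%:E)%E]lee_fin ?wdens_ge0// EFinM nnfun_muleindic_ge0.
apply: eq_fsbigr => r /[!inE] -[x0 _ hr].
have r0 : 0 <= r by rewrite -hr.
have mA : measurable (h n @^-1` [set r]) by [].
under eq_integral do rewrite EFinM.
rewrite ge0_integralZl//; last by apply/measurable_EFinP.
rewrite integral_indic// setIT.
under [RHS]eq_integral do rewrite EFinM -muleA.
rewrite ge0_integralZl//; last first.
- by move=> x _; rewrite mule_ge0 ?lee_fin ?wdens_ge0.
- apply: emeasurable_funM; apply/measurable_EFinP; last exact: mw.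
  exact: mind.
congr (_ * _)%E.
rewrite -[LHS]/(mu_a alpha _) /mu_a setIC integral_mkcondr.
apply: eq_integral => x _; rewrite patchE indicE.
by case: ifPn => _; rewrite ?mul1e ?mul0e.
Qed.

Lemma integral_mu_a (f : R -> R) : measurable_fun setT f ->
  (\int[mu_a alpha]_x (f x)%:E = \int[leb]_(x in Rp) (f x * w x)%:E)%E.
Proof.
move=> mf; rewrite [LHS]integralE [RHS]integralE; congr (_ - _)%E.
- rewrite ge0_integral_mu_a//; last first.
    by apply: measurable_funepos; apply/measurable_EFinP.
  by apply: eq_integral => x _; rewrite !funeposE EFinM maxe_pMl ?lee_fin ?wdens_ge0// mul0e.
- rewrite ge0_integral_mu_a//; last first.
    by apply: measurable_funeneg; apply/measurable_EFinP.
  apply: eq_integral => x _; rewrite !funenegE EFinM.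
  by rewrite maxe_pMl ?lee_fin ?wdens_ge0// mul0e mulNe.
Qed.

End weighted_measure.

(** * The Gamma and Bessel functions *)
Section gamma.
Variable R : realType.
Local Notation leb := (@lebesgue_measure R).

Lemma FTC_pos (h h' : R -> R) (a b : R) : 0 < a -> a < b ->
  (forall x : R, 0 < x -> is_derive x (1 : R) h (h' x)) ->
  (forall x : R, 0 < x -> {for x, continuous h'}) ->
  (\int[leb]_(x in `[a, b]) (h' x)%:E = (h b - h a)%:E)%E.
Proof.
move=> a0 ab dh ch.
have pos x : a <= x -> 0 < x by exact: lt_le_trans.
have ct x : 0 < x -> {for x, continuous h}.
  move=> x0; apply/differentiable_continuous/derivable1_diffP.
  by have [] := dh _ x0.
rewrite (@continuous_FTC2 _ h' h)//.
- apply: continuous_in_subspaceT => x /[!inE] /=.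
  by rewrite in_itv/= => /andP[/pos ? _]; exact: ch.
- split.
  + by move=> x; rewrite in_itv/= => /andP[/ltW/pos x0 _]; have [] := dh _ x0.
  + exact: (cvg_at_right_filter (ct _ a0)).
  + exact: (cvg_at_left_filter (ct _ (lt_trans a0 ab))).
- move=> x; rewrite in_itv/= => /andP[/ltW/pos x0 _].
  by rewrite derive1E; have [] := dh _ x0.
Qed.

Definition gfun (s t : R) : R := t `^ (s - 1) * expR (- t).

Lemma gfun_ge0 s t : 0 <= gfun s t.
Proof. by rewrite mulr_ge0 ?powR_ge0 ?expR_ge0. Qed.

Lemma measurable_gfun s (D : set R) : measurable_fun (T:=measurableTypeR R) D (gfun s).
Proof.
apply: measurable_funTS; apply: measurable_funM; first exact: measurable_powR.
by apply: measurableT_comp => //; exact: measurableT_comp.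
Qed.

Lemma continuous_gfun s x : 0 < x -> {for x, continuous (gfun s)}.
Proof.
move=> x0.
have h1 : {for x, continuous (@powR R ^~ (s - 1))}.
  apply/differentiable_continuous/derivable1_diffP.
  by apply: derivable_powR; rewrite in_itv/= x0.
have h2 : {for x, continuous (fun t : R => expR (- t))}.
  by apply: continuous_comp; [exact: continuousN|exact: continuous_expR].
exact: (cvgM h1 h2).
Qed.

Lemma is_derive_gfun s (x : R) : 0 < x ->
  is_derive x (1 : R) (gfun (s + 1)) (s * gfun s x - gfun (s + 1) x).
Proof.
move=> x0; have -> : gfun (s + 1) = (fun t => t `^ s) * (expR \o -%R).
  by apply/funext => t; rewrite /gfun addrK.
have dp := @is_derive1_powR R s x x0.
apply: is_derive_eq.
rewrite /gfun !fctE /GRing.scale /=. ring.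
Qed.

(** This is [ln u < u] at [u = t / (2 * s)]. Only half of the exponential is spent, so the other
    half still gives decay to [gfun]. *)
Lemma powR_le_expR (s t : R) : 0 < s -> 0 < t -> t `^ s <= (2 * s) `^ s * expR (t / 2).
Proof.
move=> s0 t0.
have s20 : 0 < 2 * s by rewrite mulr_gt0.
have {1}-> : t = (2 * s) * (t / (2 * s)) by field; rewrite gt_eqF.
rewrite powRM; [|exact: ltW|by rewrite ltW// divr_gt0].
rewrite ler_wpM2l ?powR_ge0//.
have tp : 0 < t / (2 * s) by rewrite divr_gt0.
rewrite /powR gt_eqF// ler_expR.
have := ltW (ln_sublinear tp); rewrite -(ler_pM2l s0) => /le_trans; apply.
by rewrite le_eqVlt; apply/orP; left; apply/eqP; field; rewrite gt_eqF.
Qed.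

(** Compact pieces of the open half-line, for the fundamental theorem of calculus. Starting at
    [k.+2] keeps the endpoints distinct; [k.+1] would begin with the single point 1. *)
Definition Aset (k : nat) : set R := `[(k.+2%:R)^-1, k.+2%:R].

Lemma Aset_lt (k : nat) : ((k.+2%:R)^-1 : R) < k.+2%:R.
Proof.
apply: (@lt_trans _ _ 1); last by rewrite ltr1n.
by rewrite invf_lt1 ?ltr1n// ltr0n.
Qed.

Lemma Aset_gt0 (k : nat) : 0 < ((k.+2%:R)^-1 : R). Proof. by rewrite invr_gt0 ltr0n. Qed.

Lemma bigcup_Aset : \bigcup_k Aset k = (`]0, +oo[%classic : set R).
Proof.
rewrite predeqE => x; split => [[k _]|].
  by rewrite /Aset /= !in_itv/= andbT => /andP[+ _]; apply: lt_le_trans; exact: Aset_gt0.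
rewrite /= in_itv/= andbT => x0.
pose n := (Num.truncn (Num.max x x^-1)).
have : Num.max x x^-1 < n.+1%:R by exact: truncnS_gt.
rewrite gt_max => /andP[x1 x2].
exists n => //; rewrite /Aset /= in_itv/=; apply/andP; split.
  rewrite invf_ple ?posrE ?ltr0n//; apply/ltW/(lt_trans x2).
  by rewrite ltr_nat.
by apply/ltW/(lt_trans x1); rewrite ltr_nat.
Qed.

Lemma nd_Aset : nondecreasing_seq Aset.
Proof.
move=> m n mn; rewrite subsetEset => x; rewrite /Aset /= !in_itv/= => /andP[h1 h2].
apply/andP; split.
  by apply: (le_trans _ h1); rewrite lef_pV2 ?posrE ?ltr0n// ler_nat !ltnS.
by apply: (le_trans h2); rewrite ler_nat !ltnS.
Qed.

Local Notation Ge s := (\int[leb]_(t in `]0%R, +oo[%classic) (gfun s t)%:E)%E.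

Lemma cvg_Aset_integral (f : R -> R) :
  (forall D, measurable_fun (T:=measurableTypeR R) D f) ->
  (forall x, 0 < x -> 0 <= f x) ->
  (\int[leb]_(t in Aset k) (f t)%:E)%E @[k --> \oo] --> (\int[leb]_(t in `]0%R, +oo[%classic) (f t)%:E)%E.
Proof.
move=> mf f0; rewrite -bigcup_Aset.
apply: ge0_nondecreasing_set_cvg_integral.
- exact: nd_Aset.
- by move=> i; exact: measurable_itv.
- by move=> i; apply/measurable_EFinP; exact: mf.
- move=> i x; rewrite /Aset /= in_itv/= => /andP[h1 _]; rewrite lee_fin; apply: f0.
  by apply: lt_le_trans h1; exact: Aset_gt0.
Qed.

Lemma cvg_gfun_Aset s : 0 < s ->
  ((gfun (s + 1) k.+2%:R - gfun (s + 1) (k.+2%:R^-1))%:E) @[k --> \oo] --> 0%E.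
Proof.
move=> s0; apply: cvg_EFin; first exact: nearW.
rewrite -[X in _ --> X](subr0 (0 : R)).
have c2 : (k.+2%:R^-1 : R) @[k --> \oo] --> (0 : R).
  have := @cvg_harmonic R; rewrite -(cvg_shiftS); exact.
apply: cvgB; last first.
  apply: (@squeeze_cvgr _ _ _ _ (cst 0) (fun k : nat => (k.+2%:R^-1 : R) `^ s)).
  - apply: nearW => k; rewrite gfun_ge0 /gfun addrK ler_piMr ?powR_ge0//.
  - exact: cvg_cst.
  - have /cvg_at_rightP := powR_cvg0 s0; apply; split => // k; exact: Aset_gt0.
apply: (@squeeze_cvgr _ _ _ _ (cst 0) (fun k : nat => (2 * s) `^ s * 2 * (k.+2%:R^-1 : R))).
- apply: nearW => k; rewrite gfun_ge0 /gfun addrK /=.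
  have k0 : 0 < (k.+2%:R : R) by rewrite ltr0n.
  apply: (@le_trans _ _ ((2 * s) `^ s * expR (k.+2%:R / 2) * expR (- k.+2%:R))).
    by rewrite ler_wpM2r ?expR_ge0 ?powR_le_expR.
  rewrite -mulrA -mulrA -expRD ler_wpM2l ?powR_ge0//.
  rewrite (_ : _ / 2 + - _ = - (k.+2%:R / 2)); last by field.
  rewrite expRN -[leRHS]invf_div lef_pV2 ?posrE ?expR_gt0 ?divr_gt0//.
  by apply: le_trans (expR_ge1Dx _); rewrite lerDr.
- exact: cvg_cst.
- by rewrite -[X in _ --> X](mulr0 ((2 * s) `^ s * 2)); apply: cvgMr.
Qed.

Lemma continuous_exp_half : continuous (fun t : R => expR (- (t / 2))).
Proof.
move=> x; apply: continuous_comp; last exact: continuous_expR.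
by apply: cvgN; apply: cvgMl; exact: cvg_id.
Qed.

Lemma integral_exp_half : (\int[leb]_(t in `[0%R, +oo[%classic) (expR (- (t / 2)))%:E = (2 : R)%:E)%E.
Proof.
have dF (x : R) : is_derive x (1 : R) (fun t : R => - 2 * expR (- (t / 2))) (expR (- (x / 2))).
  have -> : (fun t : R => - 2 * expR (- (t / 2))) = (-2) *: (expR \o ((- 2^-1) *: id)).
    by apply/funext => t /=; rewrite !fctE/= /GRing.scale/= !mulNr [t / 2]mulrC.
  apply: is_derive_eq.
  rewrite !fctE /GRing.scale/= (_ : - 2^-1 * x = - (x / 2)); last by ring.
  by field.
rewrite (@ge0_continuous_FTC2y R (fun t => expR (- (t / 2))) (fun t => - 2 * expR (- (t / 2))) _ 0)//.
- by rewrite mul0r oppr0 expR0 mulr1 -EFinB sub0r opprK.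
- exact: continuous_subspaceT continuous_exp_half.
- rewrite -[X in _ --> X](mulr0 (-2)); apply: cvgMr.
  apply: (@cvg_comp _ _ _ (fun x : R => x / 2) (fun x => expR (- x)) _ _ _ _ (@cvgr_expR R)).
  by apply: gt0_cvgMly => //; exact: cvg_id.
- apply: cvg_at_right_filter; apply: cvgMr; exact: continuous_exp_half.
- by move=> x _; rewrite derive1E; have [] := dF x.
Qed.

Lemma Ge_lty s : 0 < s -> (Ge (s + 1) < +oo)%E.
Proof.
move=> s0.
have mexp D : measurable_fun (T:=measurableTypeR R) D (fun t : R => expR (- (t / 2))).
  by apply: measurable_funTS; exact: continuous_measurable_fun continuous_exp_half.
apply: (@le_lt_trans _ _ (\int[leb]_(t in `]0%R, +oo[%classic) (((2 * s) `^ s)%:E * (expR (- (t / 2)))%:E))%E).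
  apply: ge0_le_integral => //.
  - by move=> x _; rewrite lee_fin gfun_ge0.
  - by apply/measurable_EFinP; exact: measurable_gfun.
  - by apply: emeasurable_funM; apply/measurable_EFinP => //; exact: mexp.
  - move=> x; rewrite /= in_itv/= andbT => x0; rewrite -EFinM lee_fin /gfun addrK.
    apply: (@le_trans _ _ ((2 * s) `^ s * expR (x / 2) * expR (- x))).
      by rewrite ler_wpM2r ?expR_ge0 ?powR_le_expR.
    rewrite -mulrA -expRD (_ : _ / 2 + - _ = - (x / 2))//; by field.
rewrite ge0_integralZl//; last 2 first.
- by apply/measurable_EFinP; exact: mexp.
- by rewrite lee_fin powR_ge0.
rewrite lte_mul_pinfty ?lee_fin ?powR_ge0//.
rewrite integral_itv_obnd_cbnd//; last by apply/measurable_EFinP; exact: mexp.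
by rewrite integral_exp_half ltry.
Qed.

(** Integration by parts: [s * gfun s - gfun (s + 1)] is the derivative of [gfun (s + 1)], whose
    boundary values on [Aset k] tend to 0. The identity is between extended reals because the
    finiteness of [Ge s] is deduced from it. *)
Lemma GeS s : 0 < s -> Ge (s + 1) = (s%:E * Ge s)%E.
Proof.
move=> s0.
have intA u k : leb.-integrable (Aset k) (EFin \o gfun u).
  apply: continuous_compact_integrable; first exact: segment_compact.
  apply: continuous_in_subspaceT => x /[!inE]; rewrite /Aset /= in_itv/= => /andP[h _].
  by apply: continuous_gfun; apply: lt_le_trans h; exact: Aset_gt0.
have mA k : measurable (Aset k) by exact: measurable_itv.
have E k : (s%:E * (\int[leb]_(t in Aset k) (gfun s t)%:E) =
   \int[leb]_(t in Aset k) (gfun (s + 1) t)%:E + (gfun (s + 1) k.+2%:R - gfun (s + 1) (k.+2%:R^-1))%:E)%E.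
  have ch (x : R) : 0 < x -> {for x, continuous (fun x => s * gfun s x - gfun (s + 1) x)}.
    move=> x0; apply: cvgB; last exact: continuous_gfun.
    by apply: cvgMr; exact: continuous_gfun.
  rewrite -(@FTC_pos (gfun (s + 1)) (fun x => s * gfun s x - gfun (s + 1) x) _ _ (Aset_gt0 k) (Aset_lt k) (@is_derive_gfun s) ch).
  under [X in (_ + X)%E]eq_integral do rewrite EFinB EFinM.
  rewrite integralB; last 3 first.
  - exact: mA.
  - apply: integrableZl; [exact: mA|exact: intA].
  - exact: intA.
  rewrite integralZl; [|exact: mA|exact: intA].
  rewrite addeCA subee ?adde0//.
  by apply: integrable_fin_num; [exact: mA|exact: intA].
have c0 := @cvg_Aset_integral (gfun s) (fun D => @measurable_gfun s D) (fun x _ => gfun_ge0 s x).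
have c1 := @cvg_Aset_integral (gfun (s + 1)) (fun D => @measurable_gfun _ D) (fun x _ => gfun_ge0 _ x).
have := cvgeD _ c1 (cvg_gfun_Aset s0).
rewrite adde0 => /(_ _) h.
have h2 : (s%:E * (\int[leb]_(t in Aset k) (gfun s t)%:E))%E @[k --> \oo] --> Ge (s + 1).
  by under eq_fun do rewrite E; apply: h; rewrite fin_num_adde_defl.
apply: (cvg_unique _ h2) => //.
by apply: cvgeZl.
Qed.

(** For [s < 1] the integrand is singular at 0 and the exponential bound does not apply; but an
    infinite [Ge s] would make [Ge (s + 1)] infinite through the recursion. *)
Lemma Ge_fin s : 0 < s -> Ge s \is a fin_num.
Proof.
move=> s0; have := Ge_lty s0; rewrite GeS//.
have : (0 <= Ge s)%E by apply: integral_ge0 => x _; rewrite lee_fin gfun_ge0.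
by case: (Ge s) => // _; rewrite gt0_muley ?lte_fin ?ltxx.
Qed.

Lemma Ge_Gamma s : 0 < s -> Ge s = (@Gamma R s)%:E.
Proof.
by move=> s0; have -> : Gamma s = fine (Ge s) by []; rewrite fineK// Ge_fin.
Qed.

Lemma GammaS s : 0 < s -> @Gamma R (s + 1) = s * Gamma s.
Proof.
move=> s0; apply/eqP; rewrite -eqe EFinM -!Ge_Gamma ?addr_gt0//.
by rewrite GeS.
Qed.

Lemma Gamma_gt0 s : 0 < s -> 0 < @Gamma R s.
Proof.
move=> s0.
have h : 0 < expR (-2) * (Num.min (1 : R) (2 `^ (s - 1))) by rewrite mulr_gt0 ?expR_gt0// lt_min ltr01 powR_gt0.
rewrite -lte_fin -Ge_Gamma//.
apply: (@lt_le_trans _ _ (\int[leb]_(t in `[1%R, 2%R]%classic) (expR (-2) * Num.min 1 (2 `^ (s - 1)))%:E)%E).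
  rewrite integral_cst//= lebesgue_measure_itv/= lte_fin ltr1n -EFinB.
  by rewrite -EFinM lte_fin mulr_gt0// subr_gt0 ltr1n.
apply: (@le_trans _ _ (\int[leb]_(t in `[1%R, 2%R]%classic) (gfun s t)%:E)%E).
  apply: ge0_le_integral => //.
  - by apply/measurable_EFinP; exact: measurable_gfun.
  - move=> x; rewrite /= in_itv/= => /andP[x1 x2]; rewrite lee_fin /gfun [leRHS]mulrC.
    apply: ler_pM; rewrite ?expR_ge0// ?le_min ?powR_ge0 ?ler01//.
      by rewrite ler_expR lerN2.
    rewrite ge_min; have [s1|s1] := leP 0 (s - 1).
      apply/orP; left; apply: (@le_trans _ _ (1 `^ (s - 1))); first by rewrite powR1.
      by apply: ge0_ler_powR; rewrite ?nnegrE//; exact: le_trans x1.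
    apply/orP; right.
    have x0 : 0 < x by exact: lt_le_trans x1.
    rewrite -(opprK (s - 1)) powRN [leRHS]powRN lef_pV2 ?posrE ?powR_gt0//.
    by apply: ge0_ler_powR; rewrite ?nnegrE ?oppr_ge0// ltW.
apply: ge0_subset_integral => //.
- by apply/measurable_EFinP; exact: measurable_gfun.
- by move=> x _; rewrite lee_fin gfun_ge0.
- by move=> x; rewrite /= !in_itv/= andbT => /andP[x1 _]; exact: lt_le_trans x1.
Qed.

End gamma.

(** * Gaussian moments on the half-line *)

Section moments.
Variable R : realType.
Local Notation leb := (@lebesgue_measure R).

(** The substitution t = c x^2 in the Gamma integral, made on the pieces [Aset k], whose images
    again exhaust the open half-line. *)
Lemma integral_sqr_subst s c : 0 < s -> 0 < c ->
  (\int[leb]_(x in `]0%R, +oo[%classic) (x `^ (2 * s - 1) * expR (- (c * x ^+ 2)))%:E =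
   (2^-1 * c `^ (- s) * Gamma s)%:E)%E.
Proof.
move=> s0 c0.
pose F : R -> R := fun x => c * x ^+ 2.
have dF (x : R) : is_derive x (1 : R) F (2 * c * x).
  have -> : F = c *: ((id : R -> R) * id) by apply/funext => y; rewrite /F expr2.
  by apply: is_derive_eq; rewrite /GRing.scale/=; ring.
have F'E : F^`()%classic = fun x => 2 * c * x.
  by apply/funext => x; rewrite derive1E; have [] := dF x.
have cF : continuous F.
  by move=> x; apply/differentiable_continuous/derivable1_diffP; have [] := dF x.
have cF' : continuous F^`()%classic.
  by rewrite F'E => x; apply: cvgMr; exact: cvg_id.
have mf D : measurable_fun (T:=measurableTypeR R) D (fun x : R => x `^ (2 * s - 1) * expR (- (c * x ^+ 2))).
  apply: measurable_funTS; apply: measurable_funM; first exact: measurable_powR.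
  apply: measurableT_comp => //; apply: continuous_measurable_fun => x.
  by apply: cvgN; exact: cF.
have E k : (\int[leb]_(x in `[F ((k.+2%:R : R)^-1)%R, F (k.+2%:R : R)%R]) (gfun s x)%:E =
   (2 * c `^ s)%:E * \int[leb]_(x in (Aset k : set R)) (x `^ (2 * s - 1) * expR (- (c * x ^+ 2)))%:E)%E.
  have a0 := Aset_gt0 R k; have ab := Aset_lt R k.
  rewrite (@integration_by_substitution_increasing R F (gfun s) _ _ (ltW ab)).
  - rewrite -ge0_integralZl_EFin//; last 4 first.
    + by apply: measurable_itv.
    + by move=> x _; rewrite lee_fin mulr_ge0 ?powR_ge0 ?expR_ge0.
    + by apply/measurable_EFinP; exact: mf.
    + by rewrite mulr_ge0 ?powR_ge0.
    apply: eq_integral => x; rewrite inE /Aset/= in_itv/= => /andP[ax _].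
    have x0 : 0 < x by exact: lt_le_trans ax.
    rewrite -EFinM; congr (_%:E); rewrite F'E /gfun !fctE/= /F.
    rewrite powRM ?ltW ?exprn_gt0// -(powR_mulrn 2 (ltW x0)) -powRrM.
    have -> : 2 * s - 1 = 2 * (s - 1) + 1 by ring.
    rewrite (@powRD R x (2 * (s - 1)) 1) ?(gt_eqF x0) ?implybT// powRr1 ?ltW//.
    have -> : c `^ s = c `^ (s - 1) * c.
      by rewrite mulrC mulr_powRB1 ?ltW.
    by ring.
  - move=> x y; rewrite !in_itv/= => /andP[ax _] /andP[ay _] xy.
    rewrite /F ltr_pM2l// ltr_pXn2r// nnegrE ltW//; exact: lt_le_trans a0 _.
  - by move=> x _; exact: cF'.
  - by apply: cvgP; apply: cvg_at_right_filter; exact: cF'.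
  - by apply: cvgP; apply: cvg_at_left_filter; exact: cF'.
  - split.
    + by move=> x _; have [] := dF x.
    + by apply: cvg_at_right_filter; exact: cF.
    + by apply: cvg_at_left_filter; exact: cF.
  - apply: continuous_in_subspaceT => x /[!inE]; rewrite /= in_itv/= => /andP[h _].
    apply: continuous_gfun; apply: lt_le_trans h; rewrite /F mulr_gt0// exprn_gt0//.
pose B k : set R := `[F (k.+2%:R^-1), F k.+2%:R]%classic.
have cupB : \bigcup_k B k = (`]0, +oo[%classic : set R).
  rewrite predeqE => x; split => [[k _]|].
    rewrite /B /= !in_itv/= andbT => /andP[+ _]; apply: lt_le_trans.
    by rewrite /F mulr_gt0// exprn_gt0// Aset_gt0.
  rewrite /= in_itv/= andbT => x0.
  have [k _] : (\bigcup_k (Aset k : set R)) (Num.sqrt (x / c)).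
    by rewrite bigcup_Aset /= in_itv/= andbT sqrtr_gt0 divr_gt0.
  rewrite /Aset/= in_itv/= => /andP[h1 h2]; exists k => //.
  have xE : x = F (Num.sqrt (x / c)).
    by rewrite /F sqr_sqrtr ?ltW ?divr_gt0// mulrC divfK ?gt_eqF.
  have mF u v : 0 <= u -> u <= v -> F u <= F v.
    by move=> u0 uv; rewrite /F ler_pM2l// lerXn2r ?nnegrE// (le_trans u0).
  rewrite /B /= in_itv/= {1 2}xE; apply/andP; split; apply: mF => //.
have ndB : nondecreasing_seq B.
  move=> m n mn; rewrite subsetEset => x; rewrite /B /= !in_itv/= => /andP[h1 h2].
  apply/andP; split.
    apply: le_trans h1; rewrite /F ler_pM2l// lerXn2r ?nnegrE ?invr_ge0//.
    by rewrite lef_pV2 ?posrE ?ltr0n// ler_nat !ltnS.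
  apply: (le_trans h2); rewrite /F ler_pM2l// lerXn2r ?nnegrE//.
  by rewrite ler_nat !ltnS.
have c1 : (\int[leb]_(x in B k) (gfun s x)%:E)%E @[k --> \oo] --> (Gamma s)%:E.
  rewrite -Ge_Gamma// -cupB.
  apply: ge0_nondecreasing_set_cvg_integral => //.
  - by move=> i; exact: measurable_itv.
  - by move=> i; apply/measurable_EFinP; exact: measurable_gfun.
  - by move=> i x _; rewrite lee_fin gfun_ge0.
have c2 := @cvg_Aset_integral R (fun x => x `^ (2 * s - 1) * expR (- (c * x ^+ 2))) mf (fun x _ => mulr_ge0 (powR_ge0 _ _) (expR_ge0 _)).
have h2 : (0 : R) < 2 * c `^ s by rewrite mulr_gt0// powR_gt0.
have c3 : (\int[leb]_(x in B k) (gfun s x)%:E)%E @[k --> \oo] -->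
   ((2 * c `^ s)%:E * \int[leb]_(x in `]0%R, +oo[%classic) (x `^ (2 * s - 1) * expR (- (c * x ^+ 2)))%:E)%E.
  by under eq_fun do rewrite E; apply: cvgeZl.
have e := cvg_unique _ c1 c3.
have -> : (2^-1 * c `^ (- s) * Gamma s)%:E = ((2 * c `^ s)^-1%:E * (Gamma s)%:E)%E.
  by rewrite -EFinM powRN invfM.
rewrite e// muleA -EFinM mulVf ?gt_eqF// mul1e//.
Qed.

End moments.

(** * Termwise integration of a series *)

Section termwise_integration.
Context d (T : measurableType d) (R : realType) (mu : {measure set T -> \bar R}).
Variables (h : nat -> T -> R) (H : T -> R) (A I : nat -> R).
Hypothesis mh : forall n, measurable_fun setT (h n).
Hypothesis hA : forall n, (\int[mu]_x `|h n x|%:E <= (A n)%:E)%E.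
Hypothesis cA : cvgn (series A).
Hypothesis hH : forall x, series (h ^~ x) @ \oo --> H x.
Hypothesis hI : forall n, (\int[mu]_x (h n x)%:E = (I n)%:E)%E.

Let mH : measurable_fun setT H.
Proof.
apply: (@measurable_fun_cvg _ _ _ setT (fun n x => series (h ^~ x) n)).
  by move=> n; rewrite /series/=; apply: measurable_sum => i; exact: mh.
by move=> x _; exact: hH.
Qed.

Let G x : \bar R := (\sum_(n <oo) `|h n x|%:E)%E.

Let iG : mu.-integrable setT G.
Proof.
have A0 n : 0 <= A n.
  by rewrite -lee_fin; apply: le_trans (hA n); apply: integral_ge0 => x _; rewrite lee_fin.
apply/integrableP; split.
  apply: ge0_emeasurable_sum => n; first by move=> x _ _; rewrite lee_fin.
  by move=> _; apply/measurable_EFinP; apply: measurableT_comp.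
rewrite (eq_integral G); last first.
  by move=> x _; rewrite gee0_abs//; apply: nneseries_ge0 => n _ _; rewrite lee_fin.
rewrite integral_nneseries//; last first.
  by move=> n; apply/measurable_EFinP; apply: measurableT_comp.
apply: (@le_lt_trans _ _ (\sum_(n <oo) (A n)%:E)%E).
  by apply: lee_nneseries => n *; [apply: integral_ge0 => x _; rewrite lee_fin|exact: hA].
rewrite (_ : (\sum_(n <oo) _)%E = (limn (series A))%:E); first exact: ltry.
apply/cvg_lim => //.
under eq_fun do rewrite sumEFin.
by apply: cvg_EFin => //; apply: nearW.
Qed.

Let dct : mu.-integrable setT (EFin \o H) /\
  (\int[mu]_x (series (h ^~ x) n)%:E)%E @[n --> \oo] --> (\int[mu]_x (H x)%:E)%E.
Proof.
have [] := @dominated_convergence _ _ _ mu setT measurableT (fun n x => (series (h ^~ x) n)%:E) (EFin \o H) G.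
- by move=> n; apply/measurable_EFinP; rewrite /series/=; apply: measurable_sum => i; exact: mh.
- by apply/measurable_EFinP.
- apply: aeW => x _; apply: cvg_EFin; first exact: nearW.
  exact: hH.
- exact: iG.
- apply: aeW => x n _; rewrite /series /=.
  apply: (@le_trans _ _ (\sum_(0 <= i < n) `|h i x|%:E)%E).
    by rewrite sumEFin lee_fin ler_norm_sum.
  by apply: nneseries_lim_ge => k _ _; rewrite lee_fin.
- by [].
Qed.

Lemma integrable_termwise : mu.-integrable setT (EFin \o H).
Proof. by have [] := dct. Qed.

(** By Tonelli the sum of the absolute values is integrable; it dominates every partial sum. The
    series meant here are the power series of Bessel functions under a Gaussian. *)
Lemma integral_termwise : (\int[mu]_x (H x)%:E = (limn (series I))%:E)%E /\ cvgn (series I).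
Proof.
have ih n : mu.-integrable setT (EFin \o h n).
  apply/integrableP; split; first exact/measurable_EFinP.
  by apply: le_lt_trans (hA n) _; exact: ltry.
have [iH cv] := dct.
have e n : (\int[mu]_x (series (h ^~ x) n)%:E = (series I n)%:E)%E.
  rewrite /series/= -sumEFin; under eq_integral do rewrite -sumEFin.
  by rewrite integral_sum//; apply: eq_bigr => i _; rewrite hI.
have fin : (\int[mu]_x (H x)%:E)%E \is a fin_num by exact: integrable_fin_num.
have cI : series I @ \oo --> fine (\int[mu]_x (H x)%:E)%E.
  have /fine_cvgP[_] : (series I n)%:E @[n --> \oo] --> (fine (\int[mu]_x (H x)%:E)%E)%:E.
    by rewrite fineK//; under eq_fun do rewrite -e.
  exact.
split; last by apply: cvgP cI.
by rewrite (cvg_lim _ cI)// fineK.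
Qed.

End termwise_integration.

(** * The Bessel power series and its energy *)

Section bessel.
Opaque Gamma.
Variable R : realType.
Implicit Types a w : R.

Lemma cvg_lin2 (u v : nat -> R) (k l p q : R) :
  u @ \oo --> p -> v @ \oo --> q -> (k * u n + l * v n) @[n --> \oo] --> k * p + l * q.
Proof. by move=> up vq; apply: cvgD; apply: cvgMr. Qed.

Lemma pseriesS (c : nat -> R) w n :
  pseries c w n.+1 = c 0%N + \sum_(0 <= i < n) c i.+1 * w ^+ i.+1.
Proof. by rewrite /pseries /series /= big_nat_recl//= expr0 mulr1. Qed.

Definition besc a (n : nat) : R := (n`!%:R * Gamma (n%:R + a + 1))^-1.

(* J_a(x) / x^a is [2 `^ (- a) * bes a (- (x / 2) ^+ 2)]; at positive arguments
   [bes] is the modified Bessel function I_a in the same normalization. *)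
Definition bes a w : R := limn (pseries (besc a) w).

Lemma bes_arg_gt0 a (n : nat) : - 1 < a -> 0 < n%:R + a + 1.
Proof. by move=> a1; have := ler0n R n; lra. Qed.

Lemma besG_gt0 a (n : nat) : - 1 < a -> 0 < Gamma (n%:R + a + 1).
Proof. by move=> a1; exact/Gamma_gt0/bes_arg_gt0. Qed.

Lemma besc_gt0 a n : - 1 < a -> 0 < besc a n.
Proof. by move=> a1; rewrite invr_gt0 mulr_gt0 ?ltr0n ?fact_gt0// besG_gt0. Qed.

Lemma GammaSn a (n : nat) : - 1 < a ->
  Gamma (n.+1%:R + a + 1) = (n%:R + a + 1) * Gamma (n%:R + a + 1).
Proof.
move=> a1; rewrite -(@GammaS _ (n%:R + a + 1)); last exact: bes_arg_gt0.
by congr Gamma; rewrite -natr1; ring.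
Qed.

(** The factor [n%:R + a + 1] of the recursion is sure to be at least 1 only from [n = 1] on, hence
    the minimum of the first two values. The bound compares the Bessel series with the exponential
    series. *)
Lemma besG_ge a (n : nat) : - 1 < a ->
  Num.min (Gamma (0%:R + a + 1)) (Gamma (1%:R + a + 1)) <= Gamma (n%:R + a + 1).
Proof.
move=> a1; elim: n => [|[|n] IH]; first by rewrite ge_min lexx.
  by rewrite ge_min lexx orbT.
apply: (le_trans IH); rewrite [leRHS]GammaSn// ler_peMl ?ltW ?besG_gt0//.
by rewrite -natr1; have := ler0n R n; lra.
Qed.

Lemma is_cvg_bes a w : - 1 < a -> cvgn (pseries (besc a) w).
Proof.
move=> a1; apply: normed_cvg.
pose m := Num.min (Gamma (0%:R + a + 1)) (Gamma (1%:R + a + 1)).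
have m0 : 0 < m by rewrite lt_min !besG_gt0.
apply: (@series_le_cvg _ _ (fun n => m^-1 * exp_coeff `|w| n)) => //=.
- by move=> n; rewrite mulr_ge0 ?invr_ge0 ?(ltW m0)// /exp_coeff /= divr_ge0 ?exprn_ge0.
- move=> n; rewrite normrM normrX gtr0_norm ?besc_gt0// /besc /exp_coeff/=.
  have -> : (n`!%:R * Gamma (n%:R + a + 1))^-1 * `|w| ^+ n = (Gamma (n%:R + a + 1))^-1 * (`|w| ^+ n / n`!%:R).
    by rewrite invfM mulrAC mulrC [`|w| ^+ n * _]mulrC.
  rewrite ler_wpM2r ?divr_ge0 ?exprn_ge0//.
  by rewrite lef_pV2 ?posrE ?besG_gt0// besG_ge.
- apply: is_cvg_seriesZ; exact: is_cvg_series_exp_coeff.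
Qed.

Lemma cvg_bes a w : - 1 < a -> pseries (besc a) w @ \oo --> bes a w.
Proof. exact: is_cvg_bes. Qed.

Lemma bes_gt0 a w : - 1 < a -> 0 <= w -> 0 < bes a w.
Proof.
move=> a1 w0.
have -> : bes a w = limn (pseries (besc a) w) by [].
apply: (@lt_le_trans _ _ (besc a 0)); first exact: besc_gt0.
apply: limr_ge; first exact: is_cvg_bes.
near=> n.
have -> : n = n.-1.+1 by rewrite prednK//; near: n; exists 1%N.
rewrite pseriesS lerDl sumr_ge0// => i _.
by rewrite mulr_ge0 ?exprn_ge0// ltW// besc_gt0.
Unshelve. all: by end_near. Qed.

Lemma pseries_diffs_besc a : pseries_diffs (besc a) = besc (a + 1).
Proof.
apply/funext => n; rewrite /pseries_diffs /besc.
rewrite factS natrM -mulrA invfM mulrA divff ?pnatr_eq0// mul1r.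
by congr (_ * Gamma _)^-1; rewrite -natr1; ring.
Qed.

Lemma is_derive_bes a w : - 1 < a -> is_derive w (1 : R) (bes a) (bes (a + 1) w).
Proof.
move=> a1; rewrite /bes -pseries_diffs_besc.
have a2 : - 1 < a + 1 by lra.
have a3 : - 1 < a + 1 + 1 by lra.
apply: (@pseries_snd_diffs _ _ (`|w| + 1)).
- exact: is_cvg_bes.
- by rewrite pseries_diffs_besc; exact: is_cvg_bes.
- by rewrite !pseries_diffs_besc; exact: is_cvg_bes.
- by rewrite [ltRHS]ger0_norm ?addr_ge0// ltrDl.
Qed.

Opaque bes.

(** Differentiation raises the index by one, so this recurrence is Bessel's equation w B'' + (a + 1)
    B' = B. It is checked on coefficients; the factor [w] raises the degree, which is why the other
    two partial sums have one more term. *)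
Lemma bes_ode a w : - 1 < a -> w * bes (a + 2) w + (a + 1) * bes (a + 1) w = bes a w.
Proof.
move=> a1.
have c0 := @cvg_bes a w a1.
have c1 : pseries (besc (a + 1)) w @ \oo --> bes (a + 1) w by apply: cvg_bes; lra.
have c2 : pseries (besc (a + 2)) w @ \oo --> bes (a + 2) w by apply: cvg_bes; lra.
have {}c0 : pseries (besc a) w n.+1 @[n --> \oo] --> bes a w by exact: (eq_ind_r id c0 (cvg_shiftS (pseries (besc a) w) (nbhs (bes a w)))).
have {}c1 : pseries (besc (a + 1)) w n.+1 @[n --> \oo] --> bes (a + 1) w.
  by exact: (eq_ind_r id c1 (cvg_shiftS (pseries (besc (a + 1)) w) (nbhs (bes (a + 1) w)))).
have c3 : (w * pseries (besc (a + 2)) w n + (a + 1) * pseries (besc (a + 1)) w n.+1) @[n --> \oo] --> w * bes (a + 2) w + (a + 1) * bes (a + 1) w.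
  exact: (@cvg_lin2 (pseries (besc (a + 2)) w) (fun n => pseries (besc (a + 1)) w n.+1) w (a + 1) _ _ c2 c1).
suff e : (fun n => pseries (besc a) w n.+1) =
  (fun n => w * pseries (besc (a + 2)) w n + (a + 1) * pseries (besc (a + 1)) w n.+1).
  by rewrite e in c0; exact: cvg_unique c3 c0.
clear -a1; apply/funext => n /=; apply/esym.
rewrite !pseriesS.
have e0 : (a + 1) * besc (a + 1) 0 = besc a 0.
  rewrite /besc fact0 !mul1r.
  have -> : Gamma (0%:R + (a + 1) + 1) = (a + 1) * Gamma (0%:R + a + 1).
    by rewrite !add0r GammaS//; lra.
  by rewrite invfM mulrA divff ?mul1r//; apply: lt0r_neq0; lra.
rewrite mulrDr e0 addrCA; congr (_ + _).
rewrite mulr_sumr mulr_sumr -big_split/=; apply: eq_bigr => i _.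
have eg : Gamma (i.+1%:R + (a + 1) + 1) = (i.+1%:R + a + 1) * Gamma (i.+1%:R + a + 1).
  rewrite -(@GammaS _ (i.+1%:R + a + 1)); last exact: bes_arg_gt0.
  by congr Gamma; ring.
have eg2 : Gamma (i%:R + (a + 2) + 1) = Gamma (i.+1%:R + (a + 1) + 1).
  by congr Gamma; rewrite -natr1; ring.
rewrite /besc eg2 eg factS natrM exprS.
have g0 : Gamma (i.+1%:R + a + 1) != 0 by rewrite gt_eqF// besG_gt0.
have f0 : i`!%:R != 0 :> R by rewrite pnatr_eq0 -lt0n fact_gt0.
have i0 : i.+1%:R != 0 :> R by rewrite pnatr_eq0.
have s0 : i.+1%:R + a + 1 != 0 by rewrite lt0r_neq0 ?bes_arg_gt0.
move: g0 f0 i0 s0; move: (Gamma (i.+1%:R + a + 1)) (i`!%:R : R) (i.+1%:R : R) (w ^+ i) => g f k u g0 f0 k0 s0.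
by field; rewrite g0 f0 k0 s0.
Qed.

Lemma is_derive_energy (f g h : R -> R) (x : R) :
  is_derive x (1 : R) f (g x) -> is_derive x (1 : R) g (h x) ->
  is_derive x (1 : R) (fun y => f y ^+ 2 - y * g y ^+ 2)
    (2 * f x * g x - g x ^+ 2 - 2 * x * g x * h x).
Proof.
move=> df dg.
have -> : (fun y => f y ^+ 2 - y * g y ^+ 2) = f * f - id * (g * g) by apply/funext.
by apply: is_derive_eq; rewrite !fctE /GRing.scale/=; ring.
Qed.

(* The energy of Bessel's equation, monotone because a > -1/2, whence
   |j_a(x)| <= j_a(0). *)
Definition bes_energy a w : R := bes a w ^+ 2 - w * bes (a + 1) w ^+ 2.

Lemma bes_energy_le a : - 2^-1 < a -> {homo bes_energy a : x y / x <= y}.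
Proof.
move=> a1; have a1' : -1 < a by lra.
have dE (x : R) : is_derive x (1 : R) (bes_energy a) ((2 * a + 1) * bes (a + 1) x ^+ 2).
  have d1 := @is_derive_bes a x a1'.
  have d2 : is_derive x (1 : R) (bes (a + 1)) (bes (a + 2) x).
    by have := @is_derive_bes (a + 1) x; rewrite (_ : a + 1 + 1 = a + 2); [apply; lra|ring].
  (* With B - w B'' = (a + 1) B', the derivative 2 B B' - B'^2 - 2 w B' B'' becomes (2 a + 1)
     B'^2. *)
  have := is_derive_energy d1 d2; congr is_derive.
  rewrite -(@bes_ode a x)//; move: (bes (a + 2) x) (bes (a + 1) x) => u v; ring.
move=> x y xy.
apply: (@ger0_derive1_ndecr _ (bes_energy a) x y) => //.
- by move=> z _; rewrite derive1E; have [_ ->] := dE z; rewrite mulr_ge0 ?sqr_ge0//; lra.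
- apply: continuous_subspaceT => z.
  by apply/differentiable_continuous/derivable1_diffP; have [] := dE z.
Qed.

Lemma bes_bound a w : - 2^-1 < a -> w <= 0 -> `|bes a w| <= bes a 0.
Proof.
move=> a1 w0.
have b0 : 0 < bes a 0 by apply: bes_gt0 => //; lra.
have := bes_energy_le a1 w0; rewrite /bes_energy mul0r subr0 => h.
rewrite -(ger0_norm (ltW b0)) -ler_sqr ?nnegrE// !real_normK ?num_real//.
apply: le_trans h; rewrite lerDl -mulNr mulr_ge0 ?sqr_ge0//; lra.
Qed.

Lemma continuous_bes a : - 1 < a -> continuous (bes a).
Proof.
move=> a1 z; apply/differentiable_continuous/derivable1_diffP.
by have [] := @is_derive_bes a z a1.
Qed.

(** The energy at a positive argument is at least its value at 0, which is a square; so B^2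
    dominates z^2 B'^2 at z^2. *)
Lemma bes_deriv_le a z : - 2^-1 < a -> 0 <= z -> z * bes (a + 1) (z ^+ 2) <= bes a (z ^+ 2).
Proof.
move=> a1 z0.
have p1 : 0 < bes a (z ^+ 2) by apply: bes_gt0; rewrite ?sqr_ge0//; lra.
have p2 : 0 < bes (a + 1) (z ^+ 2) by apply: bes_gt0; rewrite ?sqr_ge0//; lra.
have := bes_energy_le a1 (sqr_ge0 z); rewrite /bes_energy mul0r subr0 => h.
move: (bes a _) (bes (a + 1) _) (bes a 0) p1 p2 h => B B1 B0 p1 p2 h.
rewrite -(@ler_sqr R (z * B1) B) ?nnegrE ?mulr_ge0 ?(ltW p1) ?(ltW p2)//.
by rewrite exprMn -subr_ge0; apply: le_trans h; rewrite sqr_ge0.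
Qed.

(* exp(- 2 z) I_a(2 z) / z^a *)
Definition ebes a z : R := expR (- (2 * z)) * bes a (z ^+ 2).

(** The derivative has the sign of z B'(z^2) - B(z^2). This monotonicity is the only information on
    the size of Bessel functions that the pointwise bounds of the heat kernel use. *)
Lemma ebes_le a x y : - 2^-1 < a -> 0 <= x -> x <= y -> ebes a y <= ebes a x.
Proof.
move=> a1 x0 xy; have a1' : -1 < a by lra.
have dE (z : R) : is_derive z (1 : R) (ebes a)
   (2 * expR (- (2 * z)) * (z * bes (a + 1) (z ^+ 2) - bes a (z ^+ 2))).
  have d1 := @is_derive_bes a (z ^+ 2) a1'.
  have -> : ebes a = (expR \o ((- 2) *: id)) * (bes a \o ((id : R -> R) ^+ 2)).
    apply/funext => u; rewrite /ebes !fctE /GRing.scale/=; congr (expR _ * _); ring.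
  have d2 : is_derive (((id : R -> R) ^+ 2) z) (1 : R) (bes a) (bes (a + 1) (z ^+ 2)).
    by [].
  apply: is_derive_eq; rewrite !fctE /GRing.scale/=.
  have -> : - 2 * z = - (2 * z) by ring.
  by move: (expR _) (bes _ _) (bes _ _) => e u v; ring.
apply: (@ler0_derive1_nincr _ (ebes a) x y) => //.
- move=> z; rewrite in_itv/= => /andP[xz _]; rewrite derive1E; have [_ ->] := dE z.
  rewrite mulr_ge0_le0 ?mulr_ge0 ?expR_ge0// subr_le0.
  by apply: bes_deriv_le => //; lra.
- apply: continuous_subspaceT => z.
  by apply/differentiable_continuous/derivable1_diffP; have [] := dE z.
Qed.

End bessel.

(** * Weber's integral *)
Section cauchy_product.
Variables (R : realType) (a b : nat -> R).
Implicit Types (u v : nat -> R).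

Definition cauchy_prod u v (n : nat) : R := \sum_(i < n.+1) u i * v (n - i)%N.

Lemma series_cauchy_prod u v n :
  series (cauchy_prod u v) n = \sum_(i < n) u i * series v (n - i)%N.
Proof.
elim: n => [|n IH]; first by rewrite /series/= big_nil big_ord0.
rewrite seriesSr IH /cauchy_prod !big_ord_recr/= subnn subSnn.
rewrite [series v 1]seriesSr [series v 0]/series/= big_nil add0r addrA; congr (_ + _).
rewrite -big_split/=; apply: eq_bigr => i _.
by rewrite -mulrDr subSn ?seriesSr// ltnW.
Qed.

Hypothesis ca : cvgn [normed series a].
Hypothesis cb : cvgn [normed series b].

Let na i := `|a i|.
Let nb i := `|b i|.

Let cvg_half : (fun n : nat => n./2) @ \oo --> \oo.
Proof.
move=> A [N _ NA]; exists N.*2 => // n /= Nn; apply: NA => /=.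
by rewrite -(half_double N) half_leq.
Qed.

(** The pairs with i + j < n form a triangle that contains the square of side n/2 and lies in the
    square of side n. *)
Let Tn : series (cauchy_prod na nb) @ \oo --> limn (series na) * limn (series nb).
Proof.
have h : (series na n * series nb n) @[n --> \oo] --> limn (series na) * limn (series nb).
  by apply: cvgM; [exact: ca|exact: cb].
have h2 : (series na n./2 * series nb n./2) @[n --> \oo] --> limn (series na) * limn (series nb).
  exact: (@cvg_comp _ _ _ half (fun n => series na n * series nb n) _ _ _ cvg_half h).
apply: (squeeze_cvgr _ h2 h); apply: nearW => n; rewrite series_cauchy_prod.
have ndb m p : (m <= p)%N -> series nb m <= series nb p.
  by move=> mp; apply: (@nondecreasing_series _ nb xpredT 0%N) => // i _ _; exact: normr_ge0.
have sb0 m : 0 <= series nb m by rewrite /series/= sumr_ge0// => i _; exact: normr_ge0.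
have hn : (n./2 <= n)%N by rewrite -{2}(odd_double_half n) -addnn addnA leq_addl.
apply/andP; split.
  rewrite {1}/series/= big_mkord mulr_suml.
  rewrite (big_ord_widen n (fun i => na i * series nb n./2)) // big_mkcond /=.
  apply: ler_sum => i _; case: ifPn => ih; last by rewrite mulr_ge0 ?normr_ge0.
  rewrite ler_wpM2l ?normr_ge0//; apply: ndb.
  rewrite leq_subRL; last exact: ltnW.
  rewrite (leq_trans (leq_add (ltnW ih) (leqnn _)))// addnn.
  by rewrite -{2}(odd_double_half n) leq_addl.
rewrite {2}/series/= big_mkord mulr_suml; apply: ler_sum => i _.
by rewrite ler_wpM2l ?normr_ge0//; apply: ndb; exact: leq_subr.
Qed.

(** The product of the partial sums differs from the partial sum of the Cauchy product by terms
    outside the triangle, and these are dominated by the same difference for the absolute values. *)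
Lemma cvg_cauchy_prod : series (cauchy_prod a b) @ \oo --> limn (series a) * limn (series b).
Proof.
have cA := normed_cvg ca; have cB := normed_cvg cb.
have h : (series a n * series b n) @[n --> \oo] --> limn (series a) * limn (series b).
  by apply: cvgM; [exact: cA|exact: cB].
have hn : (series na n * series nb n - series (cauchy_prod na nb) n) @[n --> \oo] --> (0 : R).
  rewrite -[X in _ --> X](subrr (limn (series na) * limn (series nb))).
  by apply: cvgB Tn; apply: cvgM; [exact: ca|exact: cb].
have d0 : (series a n * series b n - series (cauchy_prod a b) n) @[n --> \oo] --> (0 : R).
  apply/norm_cvg0P; apply: (squeeze_cvgr _ (cvg_cst 0) hn); apply: nearW => n.
  have E u v : series u n * series v n - series (cauchy_prod u v) n =
      \sum_(i < n) u i * (series v n - series v (n - i)%N).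
    rewrite series_cauchy_prod {1}/series/= big_mkord mulr_suml -sumrB.
    by apply: eq_bigr => i _; rewrite mulrBr.
  rewrite normr_ge0 /= !E; apply: le_trans (ler_norm_sum _ _ _) _; apply: ler_sum => i _.
  rewrite normrM ler_wpM2l ?normr_ge0//.
  rewrite !sub_series_geq ?leq_subr//.
  exact: ler_norm_sum.
have hd := cvgB h d0; rewrite subr0 in hd.
rewrite (_ : series (cauchy_prod a b) = (fun n => series a n * series b n) -
   (fun n => series a n * series b n - series (cauchy_prod a b) n)); first exact: (hd _).
by apply/funext => n; rewrite !fctE opprB addrC subrK.
Qed.

End cauchy_product.

(** * Rising factorials and a Vandermonde identity *)

Section binomial_pochhammer.
Variable R : realType.
Implicit Types b z : R.

(** The rising factorial b (b + 1) ... (b + n - 1) divided by n!, that is, the coefficient of x^n in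
    (1 - x)^(-b). *)
Fixpoint risef b (n : nat) : R :=
  if n is m.+1 then risef b m * (b + m%:R) / m.+1%:R else 1.

Lemma risefS b n : risef b n.+1 = b / n.+1%:R * risef (b + 1) n.
Proof.
elim: n => [|n IH]; first by rewrite /= addr0 mul1r mulr1.
rewrite -[LHS]/(risef b n.+1 * (b + n.+1%:R) / n.+2%:R) IH.
rewrite -[risef (b + 1) n.+1]/(risef (b + 1) n * (b + 1 + n%:R) / n.+1%:R).
have -> : b + 1 + n%:R = b + n.+1%:R by rewrite -natr1; ring.
by ring.
Qed.

Lemma risef_pascal b n : risef (b + 1) n.+1 = risef b n.+1 + risef (b + 1) n.
Proof.
rewrite [risef b n.+1]risefS -[risef (b + 1) n.+1]/(risef (b + 1) n * (b + 1 + n%:R) / n.+1%:R).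
have n0 : n.+1%:R != 0 :> R by rewrite pnatr_eq0.
have -> : b + 1 + n%:R = b + n.+1%:R by rewrite -natr1; ring.
by field.
Qed.

(** Compare coefficients in (1 - x)^(-b - m) = (1 - x)^(-b) (1 + x / (1 - x))^m. The formal proof is
    an induction on m through Pascal's rule. *)
Lemma risef_vandermonde m b n :
  risef (b + m%:R) n = \sum_(k < n.+1) 'C(m, k)%:R * risef (b + k%:R) (n - k)%N.
Proof.
elim: m b n => [|m IH] b n.
  rewrite big_ord_recl bin0 mul1r subn0 big1 ?addr0// => i _.
  by rewrite bin0n mul0r.
case: n => [|n]; first by rewrite big_ord_recl big_ord0 addr0 bin0 mul1r.
have -> : b + m.+1%:R = b + 1 + m%:R by rewrite -natr1; ring.
rewrite IH big_ord_recr/= subnn mulr1.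
transitivity (\sum_(k < n.+2) 'C(m, k)%:R * risef (b + k%:R) (n.+1 - k)%N +
   \sum_(k < n.+1) 'C(m, k)%:R * risef (b + k.+1%:R) (n - k)%N).
  rewrite [in RHS]big_ord_recr/= subnn mulr1 addrAC; congr (_ + _).
  rewrite -big_split/=; apply: eq_bigr => k _.
  have kn : (k <= n)%N by rewrite -ltnS.
  rewrite -mulrDr subSn //.
  have -> : b + 1 + k%:R = b + k%:R + 1 by ring.
  rewrite risef_pascal; congr (_ * (_ + risef _ _)).
  by rewrite -natr1; ring.
rewrite big_ord_recl [in RHS]big_ord_recl !bin0 -addrA; congr (_ + _).
rewrite -big_split/=; apply: eq_bigr => k _.
by rewrite /bump/= !add1n subSS binS natrD mulrDl.
Qed.

Lemma Gamma_risef b n : 0 < b -> Gamma (n%:R + b) = Gamma b * n`!%:R * risef b n.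
Proof.
move=> b0; elim: n => [|n IH]; first by rewrite add0r mulr1 mulr1.
have -> : n.+1%:R + b = n%:R + b + 1 by rewrite -natr1; ring.
rewrite GammaS ?ltr_wpDl// IH factS natrM.
rewrite -[risef b n.+1]/(risef b n * (b + n%:R) / n.+1%:R).
have n0 : n.+1%:R != 0 :> R by rewrite pnatr_eq0.
by field.
Qed.

Lemma cvg_series_bin_exp k z :
  series (fun m => 'C(m, k)%:R * exp_coeff z m) @ \oo --> exp_coeff z k * expR z.
Proof.
rewrite -(cvg_shiftn k).
have e n : series (fun m => 'C(m, k)%:R * exp_coeff z m) (n + k)%N =
   exp_coeff z k * series (exp_coeff z) n.
  rewrite /series/= (@big_cat_nat _ _ _ k)//=; last exact: leq_addl.
  rewrite big_nat_cond big1 ?add0r; last first.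
    by move=> i /andP[/andP[_ ik] _]; rewrite bin_small// mul0r.
  rewrite -{1}[k]add0n big_addn addnK mulr_sumr; apply: eq_bigr => i _.
  rewrite /exp_coeff/= exprD.
  have -> : ((i + k)`!%:R : R) = 'C(i + k, k)%:R * (k`!%:R * i`!%:R).
    by rewrite -natrM -natrM -(@bin_fact (i + k) k) ?leq_addl// addnK.
  have f1 : (k`!%:R : R) != 0 by rewrite pnatr_eq0 -lt0n fact_gt0.
  have f2 : (i`!%:R : R) != 0 by rewrite pnatr_eq0 -lt0n fact_gt0.
  have f3 : ('C(i + k, k)%:R : R) != 0 by rewrite pnatr_eq0 -lt0n bin_gt0 leq_addl.
  by field; rewrite f1 f2 f3.
rewrite (_ : [sequence _]_n = fun n => exp_coeff z k * series (exp_coeff z) n); last exact/funext.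
by apply: cvgMr; exact: is_cvg_series_exp_coeff.
Qed.

End binomial_pochhammer.

(** * Gaussian integrals of products of Bessel functions *)

Section weber.
Variables (R : realType) (alpha : R).
Hypothesis Ha : - 2^-1 < alpha.
Local Notation leb := (@lebesgue_measure R).
Local Notation nu := (mu_a alpha).
Local Notation beta := (alpha + 1).

Let a1 : - 1 < alpha. Proof. by move: Ha => h; lra. Qed.

Definition kap : R := (2 * pi) `^ (alpha + 1).

(** The mass of exp(- c x^2) is [gmass c * Gamma (alpha + 1)]. The Gamma factor is left out because
    it cancels against the coefficients [besc]. *)
Definition gmass (c : R) : R := kap / 2 * c `^ (- (alpha + 1)).

Lemma kap_gt0 : 0 < kap.
Proof. by rewrite powR_gt0// mulr_gt0// pi_gt0. Qed.

Lemma gmass_gt0 c : 0 < c -> 0 < gmass c.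
Proof. by move=> c0; rewrite mulr_gt0 ?divr_gt0 ?kap_gt0// powR_gt0. Qed.

Lemma measurable_gauss c : measurable_fun [set: R] (fun x : R => expR (- (c * x ^+ 2))).
Proof.
apply: measurableT_comp => //; apply: measurableT_comp => //.
by apply: measurable_funM => //; exact: measurable_funX.
Qed.

Lemma measurable_gauss_mono c (n : nat) :
  measurable_fun [set: R] (fun x : R => x ^+ (2 * n) * expR (- (c * x ^+ 2))).
Proof. by apply: measurable_funM; [exact: measurable_funX|exact: measurable_gauss]. Qed.

Lemma gauss_mono_ge0 c (n : nat) x : 0 <= (x : R) ^+ (2 * n) * expR (- (c * x ^+ 2)).
Proof. by rewrite mulr_ge0 ?expR_ge0// exprM exprn_ge0// sqr_ge0. Qed.

Lemma integral_gauss_mono (c : R) (n : nat) : 0 < c ->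
  (\int[nu]_x (x ^+ (2 * n) * expR (- (c * x ^+ 2)))%:E =
   (gmass c * Gamma (n%:R + alpha + 1) / c ^+ n)%:E)%E.
Proof.
move=> c0; rewrite integral_mu_a; last exact: measurable_gauss_mono.
pose s := n%:R + alpha + 1.
have s0 : 0 < s by exact: bes_arg_gt0.
have mf D : measurable_fun (T:=measurableTypeR R) D (fun x : R => x `^ (2 * s - 1) * expR (- (c * x ^+ 2))).
  apply: measurable_funTS; apply: measurable_funM; first exact: measurable_powR.
  exact: measurable_gauss.
transitivity (\int[leb]_(x in `]0%R, +oo[%classic) (kap%:E * (x `^ (2 * s - 1) * expR (- (c * x ^+ 2)))%:E))%E.
  rewrite integral_itv_obnd_cbnd; last first.
    by apply: emeasurable_funM => //; apply/measurable_EFinP; exact: mf.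
  apply: eq_integral => x; rewrite inE /Rplus /= in_itv/= andbT => x0.
  rewrite -EFinM /wdens -/kap; congr (_%:E).
  have [->|xn0] := eqVneq x 0.
    rewrite !powR0; [by rewrite !(mulr0, mul0r)| |].
      by apply: lt0r_neq0; rewrite /s; have := ler0n R n; move: Ha; lra.
    by apply: lt0r_neq0; move: Ha; lra.
  rewrite -(powR_mulrn _ x0) natrM.
  have -> : 2 * s - 1 = 2%:R * n%:R + (2 * alpha + 1) by rewrite /s; ring.
  rewrite (@powRD R x (2%:R * n%:R)) ?xn0 ?implybT//; ring.
rewrite ge0_integralZl//; last 3 first.
- by apply/measurable_EFinP; exact: mf.
- by move=> x _; rewrite lee_fin mulr_ge0 ?powR_ge0 ?expR_ge0.
- by rewrite lee_fin ltW ?kap_gt0.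
rewrite integral_sqr_subst// -EFinM; congr (_%:E).
have -> : - s = - beta - n%:R by rewrite /s; ring.
rewrite (@powRB R c) ?(gt_eqF c0) ?implybT// powR_mulrn ?ltW// /gmass.
by rewrite -/s; ring.
Qed.

(* A rescaled Laguerre polynomial at [- z]: the integral of [x ^ (2 n)] times a
   Gaussian against a Bessel function is an exponential times [lag n]. *)
Definition lag (n : nat) (z : R) : R :=
  n`!%:R * \sum_(k < n.+1) exp_coeff z k * risef (beta + k%:R) (n - k)%N.

Let lagterm (v c : R) n m :=
  besc alpha m * v ^+ m * (gmass c * Gamma ((n + m)%:R + alpha + 1) / c ^+ (n + m)).

(** The Gamma factor depends on n + m. Written as [Gamma (m%:R + alpha + 1)] times a rising
    factorial, and with Vandermonde applied to the latter, it depends on m only through binomial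
    coefficients, whose exponential series are known. *)
Let lagtermE v c n m : 0 < c -> lagterm v c n m =
  gmass c / c ^+ n * n`!%:R * \sum_(k < n.+1) risef (beta + k%:R) (n - k)%N * ('C(m, k)%:R * exp_coeff (v / c) m).
Proof.
move=> c0; rewrite /lagterm /besc.
have g0 : Gamma (m%:R + alpha + 1) != 0 by rewrite gt_eqF// besG_gt0.
have f0 : m`!%:R != 0 :> R by rewrite pnatr_eq0 -lt0n fact_gt0.
have cn0 : c != 0 by rewrite gt_eqF.
have -> : Gamma ((n + m)%:R + alpha + 1) = Gamma (n%:R + (m%:R + alpha + 1)).
  by congr Gamma; rewrite natrD; ring.
rewrite Gamma_risef; last exact: bes_arg_gt0.
have -> : m%:R + alpha + 1 = beta + m%:R by ring.
rewrite risef_vandermonde.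
have -> : \sum_(k < n.+1) risef (beta + k%:R) (n - k)%N * ('C(m, k)%:R * exp_coeff (v / c) m) =
   (\sum_(k < n.+1) 'C(m, k)%:R * risef (beta + k%:R) (n - k)%N) * exp_coeff (v / c) m.
  by rewrite mulr_suml; apply: eq_bigr => k _; ring.
move: (\sum_(k < n.+1) _) => Sm.
have -> : beta + m%:R = m%:R + alpha + 1 by ring.
rewrite /exp_coeff/= expr_div_n exprD.
have cm0 : c ^+ m != 0 by rewrite expf_neq0.
have cn0' : c ^+ n != 0 by rewrite expf_neq0.
move: (Gamma (m%:R + alpha + 1)) (m`!%:R : R) (n`!%:R : R) (c ^+ m) (c ^+ n) (v ^+ m) (gmass c) g0 f0 cm0 cn0'
 => G fm fn cm cn vm gm G0 fm0 cm0 cn0'.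
by field; rewrite G0 fm0 cm0 cn0'.
Qed.

Let cvg_lagterm v c n : 0 < c ->
  series (lagterm v c n) @ \oo --> gmass c / c ^+ n * (lag n (v / c) * expR (v / c)).
Proof.
move=> c0.
have -> : series (lagterm v c n) = fun N => gmass c / c ^+ n * n`!%:R *
   \sum_(k < n.+1) risef (beta + k%:R) (n - k)%N * series (fun m => 'C(m, k)%:R * exp_coeff (v / c) m) N.
  apply/funext => N; rewrite /series/=.
  under eq_bigr do rewrite lagtermE//.
  rewrite -mulr_sumr exchange_big/=; congr (_ * _); apply: eq_bigr => k _.
  by rewrite mulr_sumr.
rewrite /lag [X in _ --> X](_ : _ = gmass c / c ^+ n * n`!%:R *
   \sum_(k < n.+1) risef (beta + k%:R) (n - k)%N * (exp_coeff (v / c) k * expR (v / c))).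
  apply: cvgMr; apply: cvg_big => [|k _]; first exact: add_continuous. apply: cvgMr.
  exact: cvg_series_bin_exp.
have e : (\sum_(k < n.+1) exp_coeff (v / c) k * risef (beta + k%:R) (n - k)%N) * expR (v / c) =
   \sum_(k < n.+1) risef (beta + k%:R) (n - k)%N * (exp_coeff (v / c) k * expR (v / c)).
  by rewrite mulr_suml; apply: eq_bigr => k _; ring.
by rewrite -e !mulrA.
Qed.

Let gb v c n (x : R) := x ^+ (2 * n) * expR (- (c * x ^+ 2)) * bes alpha (v * x ^+ 2).

Let gbt v c n m (x : R) := besc alpha m * v ^+ m * (x ^+ (2 * (n + m)) * expR (- (c * x ^+ 2))).

Let cvg_gbt v c n x : series (fun m => gbt v c n m x) @ \oo --> gb v c n x.
Proof.
have -> : series (fun m => gbt v c n m x) =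
   fun N => x ^+ (2 * n) * expR (- (c * x ^+ 2)) * pseries (besc alpha) (v * x ^+ 2) N.
  apply/funext => N; rewrite /pseries /series/= mulr_sumr; apply: eq_bigr => m _.
  by rewrite /gbt mulnDr exprD exprMn -exprM; ring.
by apply: cvgMr; exact: cvg_bes.
Qed.

Let integral_gbt v c n m : 0 < c -> (\int[nu]_x (gbt v c n m x)%:E = (lagterm v c n m)%:E)%E.
Proof.
move=> c0; rewrite /gbt; under eq_integral do rewrite EFinM.
rewrite integralZl//; last first.
  apply/integrableP; split; first by apply/measurable_EFinP; exact: measurable_gauss_mono.
  under eq_integral do rewrite gee0_abs ?lee_fin ?gauss_mono_ge0//.
  by rewrite integral_gauss_mono// ltry.
by rewrite integral_gauss_mono// -EFinM.
Qed.

Let measurable_gbt v c n m : measurable_fun [set: R] (gbt v c n m).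
Proof. by apply: measurable_funM => //; exact: measurable_gauss_mono. Qed.

Let abs_gbt v c n m x : `|gbt v c n m x| = gbt `|v| c n m x.
Proof.
rewrite /gbt normrM (ger0_norm (gauss_mono_ge0 _ _ _)) normrM normrX.
by rewrite gtr0_norm ?besc_gt0.
Qed.

Lemma gauss_bes_moment v c n : 0 < c ->
  nu.-integrable [set: R] (EFin \o gb v c n) /\
  (\int[nu]_x (gb v c n x)%:E = (gmass c / c ^+ n * (lag n (v / c) * expR (v / c)))%:E)%E.
Proof.
move=> c0.
have cA : cvgn (series (lagterm `|v| c n)) by apply: cvgP; exact: cvg_lagterm.
have hA m : (\int[nu]_x `|gbt v c n m x|%:E <= (lagterm `|v| c n m)%:E)%E.
  by under eq_integral do rewrite abs_gbt; rewrite integral_gbt.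
split.
  exact: (@integrable_termwise _ _ _ nu (gbt v c n) _ _ (measurable_gbt v c n) hA cA (@cvg_gbt v c n)).
have [-> _] := @integral_termwise _ _ _ nu (gbt v c n) _ _ (lagterm v c n) (measurable_gbt v c n) hA cA (@cvg_gbt v c n) (fun m => @integral_gbt v c n m c0).
by congr (_%:E); apply/cvg_lim => //; exact: cvg_lagterm.
Qed.

Let wterm (u v c : R) n := besc alpha n * u ^+ n * (gmass c / c ^+ n * (lag n (v / c) * expR (v / c))).

(** In each term of [lag n] the rising factorial cancels against the Gamma factor of [besc alpha n].
    What remains is a Bessel coefficient in u v / c^2 times an exponential coefficient in u / c. *)
Let wtermE u v c n : 0 < c -> wterm u v c n = gmass c * expR (v / c) *
  cauchy_prod (fun k => besc alpha k * (u * v / c ^+ 2) ^+ k) (exp_coeff (u / c)) n.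
Proof.
move=> c0; rewrite /wterm /lag /cauchy_prod mulr_sumr !(mulr_suml, mulr_sumr).
apply: eq_bigr => -[k/= kn] _; rewrite ltnS in kn.
have cn0 : c != 0 by rewrite gt_eqF.
have gk : Gamma (k%:R + alpha + 1) != 0 by rewrite gt_eqF// besG_gt0.
have e : Gamma (n%:R + alpha + 1) = Gamma (k%:R + alpha + 1) * (n - k)`!%:R * risef (beta + k%:R) (n - k)%N.
  have -> : n%:R + alpha + 1 = (n - k)%N%:R + (k%:R + alpha + 1) by rewrite natrB//; ring.
  rewrite Gamma_risef; last exact: bes_arg_gt0.
  by congr (_ * risef _ _); ring.
have r0 : risef (beta + k%:R) (n - k)%N != 0.
  have : Gamma (n%:R + alpha + 1) != 0 by rewrite gt_eqF// besG_gt0.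
  by rewrite e mulf_eq0 negb_or => /andP[].
rewrite /besc e /exp_coeff/= !expr_div_n exprMn.
have un : u ^+ n = u ^+ k * u ^+ (n - k)%N by rewrite -exprD subnKC.
have cn : c ^+ n = c ^+ k * c ^+ (n - k)%N by rewrite -exprD subnKC.
have c2k : (c ^+ 2) ^+ k = c ^+ k * c ^+ k by rewrite -exprM mul2n -addnn exprD.
rewrite un cn c2k.
have f1 : n`!%:R != 0 :> R by rewrite pnatr_eq0 -lt0n fact_gt0.
have f2 : k`!%:R != 0 :> R by rewrite pnatr_eq0 -lt0n fact_gt0.
have f3 : (n - k)`!%:R != 0 :> R by rewrite pnatr_eq0 -lt0n fact_gt0.
have ck0 : c ^+ k != 0 by rewrite expf_neq0.
have cnk0 : c ^+ (n - k)%N != 0 by rewrite expf_neq0.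
move: (Gamma (k%:R + alpha + 1)) (n`!%:R : R) (k`!%:R : R) ((n - k)`!%:R : R) (c ^+ k) (c ^+ (n - k)%N)
  (risef (beta + k%:R) (n - k)%N) gk r0 f1 f2 f3 ck0 cnk0 => g fn fk fnk ck cnk rr gk r0 f1 f2 f3 ck0 cnk0.
by field; rewrite gk r0 f1 f2 f3 ck0 cnk0.
Qed.

Let normed_bes w : [normed series (fun n => besc alpha n * w ^+ n)] = pseries (besc alpha) `|w|.
Proof.
apply/funext => N; rewrite /pseries /series/=; apply: eq_bigr => k _.
by rewrite normrM normrX gtr0_norm ?besc_gt0.
Qed.

Let is_cvg_normed_bes w : cvgn [normed series (fun n => besc alpha n * w ^+ n)].
Proof. by rewrite normed_bes; exact: is_cvg_bes. Qed.

Let cvg_wterm u v c : 0 < c ->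
  series (wterm u v c) @ \oo --> gmass c * expR ((u + v) / c) * bes alpha (u * v / c ^+ 2).
Proof.
move=> c0.
have -> : series (wterm u v c) = fun N => gmass c * expR (v / c) *
   series (cauchy_prod (fun k => besc alpha k * (u * v / c ^+ 2) ^+ k) (exp_coeff (u / c))) N.
  by apply/funext => N; rewrite /series/= mulr_sumr; apply: eq_bigr => n _; rewrite wtermE.
have -> : gmass c * expR ((u + v) / c) * bes alpha (u * v / c ^+ 2) =
  gmass c * expR (v / c) * (bes alpha (u * v / c ^+ 2) * expR (u / c)).
  by rewrite mulrDl expRD; ring.
apply: cvgMr; apply: cvg_cauchy_prod.
- exact: is_cvg_normed_bes.
- by rewrite normed_series_exp_coeff; exact: is_cvg_series_exp_coeff.
Qed.

Let ggt u v c n (x : R) := besc alpha n * u ^+ n * gb v c n x.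

Let bes_norm_le w : `|bes alpha w| <= bes alpha `|w|.
Proof.
have := lim_series_norm (@is_cvg_normed_bes w); rewrite normed_bes; exact.
Qed.

(** Only the factor in u is expanded; the factor in v is kept whole and integrated by
    [gauss_bes_moment]. Absolute summability is the same computation at |u| and |v|. Since u and v
    may have any sign, one formula serves the oscillating functions J and the growing functions
    I. *)
Lemma weber u v c : 0 < c ->
  nu.-integrable [set: R] (fun x => (expR (- (c * x ^+ 2)) * bes alpha (u * x ^+ 2) * bes alpha (v * x ^+ 2))%:E) /\
  (\int[nu]_x (expR (- (c * x ^+ 2)) * bes alpha (u * x ^+ 2) * bes alpha (v * x ^+ 2))%:E =
    (gmass c * expR ((u + v) / c) * bes alpha (u * v / c ^+ 2))%:E)%E.
Proof.
move=> c0.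
have mgb w n : measurable_fun [set: R] (gb w c n).
  by have [/integrableP[/measurable_EFinP]] := @gauss_bes_moment w c n c0.
have igb w n := (@gauss_bes_moment w c n c0).1.
have egb w n := (@gauss_bes_moment w c n c0).2.
have mh n : measurable_fun [set: R] (ggt u v c n).
  by apply: measurable_funM.
have iggt u' v' n : (\int[nu]_x (ggt u' v' c n x)%:E = (wterm u' v' c n)%:E)%E.
  rewrite /ggt; under eq_integral do rewrite EFinM.
  rewrite integralZl; [|exact: measurableT|exact: igb].
  by rewrite egb -EFinM.
have hA n : (\int[nu]_x `|ggt u v c n x|%:E <= (wterm `|u| `|v| c n)%:E)%E.
  rewrite -iggt; apply: ge0_le_integral => //.
  - by apply/measurable_EFinP; apply: measurableT_comp.
  - by apply/measurable_EFinP; apply: measurable_funM.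
  - move=> x _; rewrite lee_fin /ggt normrM normrM normrX gtr0_norm ?besc_gt0//.
    rewrite ler_wpM2l ?mulr_ge0 ?(ltW (besc_gt0 _ _)) ?exprn_ge0//.
    rewrite /gb normrM (ger0_norm (gauss_mono_ge0 _ _ _)) ler_wpM2l ?gauss_mono_ge0//.
    by have := bes_norm_le (v * x ^+ 2); rewrite normrM (ger0_norm (sqr_ge0 x)).
have cA : cvgn (series (wterm `|u| `|v| c)) by apply: cvgP; exact: cvg_wterm.
have hH x : series (fun n => ggt u v c n x) @ \oo --> expR (- (c * x ^+ 2)) * bes alpha (u * x ^+ 2) * bes alpha (v * x ^+ 2).
  have -> : series (fun n => ggt u v c n x) =
     fun N => expR (- (c * x ^+ 2)) * bes alpha (v * x ^+ 2) * pseries (besc alpha) (u * x ^+ 2) N.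
    apply/funext => N; rewrite /pseries /series/= mulr_sumr; apply: eq_bigr => n _.
    by rewrite /ggt /gb exprMn -exprM; ring.
  rewrite mulrAC; apply: cvgMr; exact: cvg_bes.
split.
  exact: (@integrable_termwise _ _ _ nu (ggt u v c) _ _ mh hA cA hH).
have [-> _] := @integral_termwise _ _ _ nu (ggt u v c) _ _ (wterm u v c) mh hA cA hH (iggt u v).
by congr (_%:E); apply/cvg_lim => //; exact: cvg_wterm.
Qed.

Lemma gauss_bes v c : 0 < c ->
  nu.-integrable [set: R] (fun x => (expR (- (c * x ^+ 2)) * bes alpha (v * x ^+ 2))%:E) /\
  (\int[nu]_x (expR (- (c * x ^+ 2)) * bes alpha (v * x ^+ 2))%:E =
    (gmass c * expR (v / c))%:E)%E.
Proof.
move=> c0; have [h1 h2] := @gauss_bes_moment v c 0%N c0.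
have e x : expR (- (c * x ^+ 2)) * bes alpha (v * x ^+ 2) = gb v c 0 x.
  by rewrite /gb muln0 expr0 mul1r.
split.
  by under eq_fun do rewrite e; exact: h1.
under eq_integral do rewrite e.
rewrite h2 /lag expr0 divr1 fact0 big_ord_recl big_ord0 addr0 mul1r subnn mulr1.
by rewrite /exp_coeff/= expr0 fact0 divr1 mul1r.
Qed.

End weber.

(** * The heat kernel *)
Section kernels.
Variables (R : realType) (alpha : R).
Hypothesis Ha : - 2^-1 < alpha.
Local Notation nu := (mu_a alpha).
Implicit Types (s t r x y : R).

Let a1 : - 1 < alpha. Proof. by move: Ha => h; lra. Qed.

Definition gss s x : R := expR (- (pi * s * x ^+ 2)).

Definition jb x y : R := 2 `^ (- alpha) * bes alpha (- (pi * x * y) ^+ 2).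

(* The closed form, from Weber's integral, of the integral of
   [gss s z * jb x z * jb z y] with respect to mu_a. *)
Definition hk s x y : R :=
  (2 `^ (- alpha)) ^+ 2 * gmass alpha (pi * s) * expR (- (pi * (x ^+ 2 + y ^+ 2) / s)) *
  bes alpha ((pi * x * y / s) ^+ 2).

Let pi0 : 0 < pi :> R. Proof. exact: pi_gt0. Qed.

Lemma jbesselE x y : jbessel alpha (2 * pi * x * y) = jb x y.
Proof.
rewrite /jb; congr (_ * _).
have -> : bes alpha (- (pi * x * y) ^+ 2) = limn (pseries (besc alpha) (- (pi * x * y) ^+ 2)) by [].
congr (limn _); apply/funext => N; apply: eq_bigr => n _.
rewrite -[[sequence _]_i n]/(besc alpha n * (- (pi * x * y) ^+ 2) ^+ n).
have -> : 2 * pi * x * y / 2 = pi * x * y by move: (pi : R) => p; field.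
move: (pi * x * y) => Z; rewrite -[- (Z ^+ 2)]mulN1r exprMn -exprM -/(besc alpha n).
by rewrite [besc alpha n * _]mulrA [besc alpha n * _]mulrC.
Qed.

Lemma jbC x y : jb x y = jb y x.
Proof. by rewrite /jb mulrAC. Qed.

Definition jmax : R := 2 `^ (- alpha) * bes alpha 0.

Lemma jb_bound x y : `|jb x y| <= jmax.
Proof.
rewrite normrM (ger0_norm (powR_ge0 _ _)) ler_wpM2l ?powR_ge0//.
by apply: bes_bound => //; rewrite oppr_le0 sqr_ge0.
Qed.

Lemma jmax_ge0 : 0 <= jmax.
Proof. exact: le_trans (normr_ge0 _) (jb_bound 0 0). Qed.

Lemma measurable_bes : measurable_fun [set: R] (bes alpha).
Proof. by apply: continuous_measurable_fun; exact: continuous_bes. Qed.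

Lemma measurable_jb2 : measurable_fun [set: R * R] (fun z => jb z.1 z.2).
Proof.
apply: measurable_funM => //; apply: (measurableT_comp measurable_bes).
apply: measurableT_comp => //; apply: measurable_funX.
by apply: measurable_funM => //; apply: measurable_funM.
Qed.

Lemma measurable_jb x : measurable_fun [set: R] (jb x).
Proof.
apply: measurable_funM => //; apply: (measurableT_comp measurable_bes).
by apply: measurableT_comp => //; apply: measurable_funX; apply: measurable_funM.
Qed.

Lemma measurable_gss s : measurable_fun [set: R] (gss s).
Proof. exact: measurable_gauss. Qed.

Lemma measurable_hk2 s : measurable_fun [set: R * R] (fun z => hk s z.1 z.2).
Proof.
apply: measurable_funM; last first.
  apply: (measurableT_comp measurable_bes); apply: measurable_funX.
  by apply: measurable_funM => //; apply: measurable_funM => //; apply: measurable_funM.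
apply: measurable_funM => //; apply: measurableT_comp => //; apply: measurableT_comp => //.
apply: measurable_funM => //; apply: measurable_funM => //.
by apply: measurable_funD; apply: measurable_funX.
Qed.

Lemma measurable_hk s x : measurable_fun [set: R] (hk s x).
Proof.
apply: measurable_funM; last first.
  apply: (measurableT_comp measurable_bes); apply: measurable_funX.
  by apply: measurable_funM => //; apply: measurable_funM.
apply: measurable_funM => //; apply: measurableT_comp => //; apply: measurableT_comp => //.
apply: measurable_funM => //; apply: measurable_funM => //.
by apply: measurable_funD => //; apply: measurable_funX.
Qed.

Lemma hkC s x y : hk s x y = hk s y x.
Proof. by rewrite /hk [x ^+ 2 + _]addrC [pi * x * y]mulrAC. Qed.

Lemma gss_gt0 s x : 0 < gss s x. Proof. exact: expR_gt0. Qed.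

Lemma gss_le1 s x : 0 <= s -> gss s x <= 1.
Proof. by move=> s0; rewrite /gss expR_le1 oppr_le0 mulr_ge0 ?sqr_ge0// mulr_ge0// ltW ?pi0. Qed.

Lemma hk_ge0 s x y : 0 < s -> 0 <= hk s x y.
Proof.
move=> s0; have g0 : 0 < gmass alpha (pi * s) by rewrite gmass_gt0// mulr_gt0 ?pi0.
have b0 : 0 < bes alpha ((pi * x * y / s) ^+ 2) by rewrite bes_gt0// sqr_ge0.
by rewrite /hk mulr_ge0 ?(ltW b0)// mulr_ge0 ?expR_ge0// mulr_ge0 ?sqr_ge0// ltW.
Qed.

Lemma gmass_scale c k : 0 < c -> 0 < k -> gmass alpha (c * k) = gmass alpha c * k `^ (- (alpha + 1)).
Proof. by move=> c0 k0; rewrite /gmass powRM ?ltW// mulrA. Qed.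

(** This is where the normalization (2 pi)^(alpha + 1) of the measure counts. The total mass 1 of
    the heat kernel and its action on the Bessel functions both rest on this product being exactly
    1. *)
Lemma hk_const s : 0 < s ->
  (2 `^ (- alpha)) ^+ 2 * (gmass alpha (pi * s) * gmass alpha (pi / s)) = 1.
Proof.
move=> s0; have sV0 : 0 < s^-1 by rewrite invr_gt0.
rewrite !gmass_scale ?pi0// /gmass /kap.
have e1 : s `^ (- (alpha + 1)) * s^-1 `^ (- (alpha + 1)) = 1.
  by rewrite -powRM ?ltW// mulfV ?gt_eqF// powR1.
have e2 : pi `^ (alpha + 1) * pi `^ (- (alpha + 1)) = 1 :> R.
  by rewrite powRN mulfV ?gt_eqF ?powR_gt0 ?pi0.
have e3 : 2 `^ (- alpha) * 2 `^ (alpha + 1) = 2 :> R.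
  rewrite -powRD; last by rewrite pnatr_eq0 implybT.
  by rewrite addrA addNr add0r powRr1.
rewrite powRM ?(ltW pi0)//.
move: e1 e2 e3; move: (s `^ _) (s^-1 `^ _) (2 `^ _) (2 `^ _) (pi `^ _) (pi `^ _) => sa sb ta tb pa pb e1 e2 e3.
transitivity ((sa * sb) * (pa * pb) ^+ 2 * (ta * tb) ^+ 2 / 4); first by field.
by rewrite e1 [pa * pb]mulrC e2 [ta * tb]mulrC e3 expr1n !mul1r; field.
Qed.

(** The heat semigroup keeps Gaussians Gaussian. At [r = 0] this is the total mass of the kernel; at
    [r > 0] it yields the explicit bounds on column masses. *)
Lemma integral_hk_gss s r x : 0 < s -> 0 <= r ->
  (\int[nu]_y (hk s x y * gss r y)%:E =
   ((1 + r * s) `^ (- (alpha + 1)) * expR (- (pi * r * x ^+ 2 / (1 + r * s))))%:E)%E.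
Proof.
move=> s0 r0; have c0 : 0 < pi / s * (1 + r * s).
  by rewrite mulr_gt0 ?divr_gt0 ?pi0// ltr_wpDr// mulr_ge0// ltW.
have [i1 e1] := gauss_bes Ha ((pi * x / s) ^+ 2) c0.
pose K := (2 `^ (- alpha)) ^+ 2 * gmass alpha (pi * s) * expR (- (pi * x ^+ 2 / s)).
have e y : (hk s x y * gss r y)%:E =
   (K%:E * (expR (- (pi / s * (1 + r * s) * y ^+ 2)) * bes alpha ((pi * x / s) ^+ 2 * y ^+ 2))%:E)%E.
  rewrite -EFinM; congr (_%:E); rewrite /hk /K /gss.
  have -> : (pi * x * y / s) ^+ 2 = (pi * x / s) ^+ 2 * y ^+ 2.
    by rewrite -exprMn; congr (_ ^+ _); ring.
  have -> : expR (- (pi * (x ^+ 2 + y ^+ 2) / s)) = expR (- (pi * x ^+ 2 / s)) * expR (- (pi * y ^+ 2 / s)).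
    by rewrite -expRD; congr expR; ring.
  have -> : expR (- (pi / s * (1 + r * s) * y ^+ 2)) = expR (- (pi * y ^+ 2 / s)) * expR (- (pi * r * y ^+ 2)).
    by rewrite -expRD; congr expR; move: (pi : R) => p; field; rewrite gt_eqF.
  by ring.
under eq_integral do rewrite e.
rewrite integralZl// e1 -EFinM; congr (_%:E).
have rs0 : 0 < 1 + r * s by rewrite ltr_wpDr// mulr_ge0// ltW.
rewrite /K (@gmass_scale (pi / s)) ?divr_gt0 ?pi0//.
have := hk_const s0; move: (gmass alpha (pi * s)) (gmass alpha (pi / s)) ((2 `^ (- alpha)) ^+ 2) => g1 g2 q h.
have -> : expR (- (pi * r * x ^+ 2 / (1 + r * s))) =
   expR (- (pi * x ^+ 2 / s)) * expR ((pi * x / s) ^+ 2 / (pi / s * (1 + r * s))).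
  rewrite -expRD; congr expR; move: pi0; move: (pi : R) => p p0; field.
  by rewrite !gt_eqF.
transitivity (q * (g1 * g2) * ((1 + r * s) `^ (- (alpha + 1)) *
  (expR (- (pi * x ^+ 2 / s)) * expR ((pi * x / s) ^+ 2 / (pi / s * (1 + r * s)))))); first by ring.
by rewrite h mul1r.
Qed.

Lemma integral_hk s x : 0 < s -> (\int[nu]_y (hk s x y)%:E = 1)%E.
Proof.
move=> s0; have := @integral_hk_gss s 0 x s0 (lexx _).
under eq_integral do rewrite /gss mulr0 mul0r oppr0 expR0 mulr1.
by move=> ->; rewrite mul0r addr0 powR1 mulr0 !mul0r oppr0 expR0 mulr1.
Qed.

Lemma integrable_hk s x : 0 < s -> nu.-integrable [set: R] (EFin \o hk s x).
Proof.
move=> s0; apply/integrableP; split; first by apply/measurable_EFinP; exact: measurable_hk.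
rewrite (_ : (\int[nu]_x0 _)%E = (\int[nu]_y (hk s x y)%:E)%E); first by rewrite integral_hk// ltry.
by apply: eq_integral => y _; rewrite /= ger0_norm ?hk_ge0.
Qed.

(** Weber's integral with one positive and one negative parameter: [jb y] is an eigenfunction of the
    heat semigroup, with eigenvalue [gss s y]. *)
Lemma integral_hk_jb s x y : 0 < s ->
  (\int[nu]_z (hk s x z * jb y z)%:E = (gss s y * jb y x)%:E)%E.
Proof.
move=> s0; have c0 : 0 < pi / s by rewrite divr_gt0 ?pi0.
have [i1 e1] := weber Ha ((pi * x / s) ^+ 2) (- (pi * y) ^+ 2) c0.
pose K := (2 `^ (- alpha)) ^+ 3 * gmass alpha (pi * s) * expR (- (pi * x ^+ 2 / s)).
have e z : (hk s x z * jb y z)%:E =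
   (K%:E * (expR (- (pi / s * z ^+ 2)) * bes alpha ((pi * x / s) ^+ 2 * z ^+ 2) * bes alpha (- (pi * y) ^+ 2 * z ^+ 2))%:E)%E.
  rewrite -EFinM; congr (_%:E); rewrite /hk /K /jb.
  have -> : (pi * x * z / s) ^+ 2 = (pi * x / s) ^+ 2 * z ^+ 2.
    by rewrite -exprMn; congr (_ ^+ _); ring.
  have -> : - (pi * y * z) ^+ 2 = - (pi * y) ^+ 2 * z ^+ 2 by rewrite exprMn mulNr.
  have -> : expR (- (pi * (x ^+ 2 + z ^+ 2) / s)) = expR (- (pi * x ^+ 2 / s)) * expR (- (pi / s * z ^+ 2)).
    by rewrite -expRD; congr expR; ring.
  by ring.
under eq_integral do rewrite e.
rewrite integralZl// e1 -EFinM; congr (_%:E).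
have := hk_const s0; rewrite /K /jb /gss.
have -> : (pi * x / s) ^+ 2 * - (pi * y) ^+ 2 / (pi / s) ^+ 2 = - (pi * y * x) ^+ 2.
  by move: pi0; move: (pi : R) => p p0; field; rewrite !gt_eqF.
have -> : expR (- (pi * s * y ^+ 2)) =
   expR (- (pi * x ^+ 2 / s)) * expR (((pi * x / s) ^+ 2 - (pi * y) ^+ 2) / (pi / s)).
  rewrite -expRD; congr expR; move: pi0; move: (pi : R) => p p0; field.
  by rewrite !gt_eqF.
move: (gmass alpha (pi * s)) (gmass alpha (pi / s)) (2 `^ (- alpha)) (bes alpha (- (pi * y * x) ^+ 2)) (expR (- (pi * x ^+ 2 / s))) (expR (((pi * x / s) ^+ 2 - (pi * y) ^+ 2) / (pi / s))) => g1 g2 q b E1 E2 h.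
transitivity (q ^+ 2 * (g1 * g2) * (E1 * E2 * (q * b))); first by ring.
by rewrite h mul1r.
Qed.

Lemma integral_gss_jb2 t x y : 0 < t ->
  (\int[nu]_z (gss t z * jb x z * jb y z)%:E = (hk t x y)%:E)%E.
Proof.
move=> t0; have c0 : 0 < pi * t by rewrite mulr_gt0 ?pi0.
have [i1 e1] := weber Ha (- (pi * x) ^+ 2) (- (pi * y) ^+ 2) c0.
have e z : (gss t z * jb x z * jb y z)%:E =
   (((2 `^ (- alpha)) ^+ 2)%:E * (expR (- (pi * t * z ^+ 2)) * bes alpha (- (pi * x) ^+ 2 * z ^+ 2) * bes alpha (- (pi * y) ^+ 2 * z ^+ 2))%:E)%E.
  rewrite -EFinM; congr (_%:E); rewrite /jb /gss.
  have -> : - (pi * y * z) ^+ 2 = - (pi * y) ^+ 2 * z ^+ 2 by rewrite exprMn mulNr.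
  have -> : - (pi * x * z) ^+ 2 = - (pi * x) ^+ 2 * z ^+ 2 by rewrite exprMn mulNr.
  by ring.
under eq_integral do rewrite e.
rewrite integralZl// e1 -EFinM; congr (_%:E); rewrite /hk.
have -> : (- (pi * x) ^+ 2 - (pi * y) ^+ 2) / (pi * t) = - (pi * (x ^+ 2 + y ^+ 2) / t).
  by move: pi0; move: (pi : R) => p p0; field; rewrite !gt_eqF.
have -> : - (pi * x) ^+ 2 * - (pi * y) ^+ 2 / (pi * t) ^+ 2 = (pi * x * y / t) ^+ 2.
  by move: pi0; move: (pi : R) => p p0; field; rewrite !gt_eqF.
by rewrite !mulrA.
Qed.

Lemma hkE s x y : 0 < s -> hk s x y = (2 `^ (- alpha)) ^+ 2 * gmass alpha (pi * s) *
  expR (- (pi * (x - y) ^+ 2 / s)) * ebes alpha (pi * x * y / s).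
Proof.
move=> s0; rewrite /hk /ebes.
have -> : expR (- (pi * (x ^+ 2 + y ^+ 2) / s)) = expR (- (pi * (x - y) ^+ 2 / s)) * expR (- (2 * (pi * x * y / s))).
  by rewrite -expRD; congr expR; move: (pi : R) => p; field; rewrite gt_eqF.
by rewrite !mulrA.
Qed.

Lemma ebes_gt0 z : 0 <= ebes alpha z.
Proof. by rewrite mulr_ge0 ?expR_ge0// ltW// bes_gt0// sqr_ge0. Qed.

Lemma hk_ubound s x y : 0 < s -> 0 <= x -> 0 <= y ->
  hk s x y <= (2 `^ (- alpha)) ^+ 2 * bes alpha 0 * gmass alpha pi * s `^ (- (alpha + 1)).
Proof.
move=> s0 x0 y0; rewrite hkE// gmass_scale ?pi0//.
have h1 : expR (- (pi * (x - y) ^+ 2 / s)) <= 1.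
  by rewrite expR_le1 oppr_le0 divr_ge0 ?(ltW s0)// mulr_ge0 ?sqr_ge0// ltW ?pi0.
have h2 : ebes alpha (pi * x * y / s) <= bes alpha 0.
  have -> : bes alpha 0 = ebes alpha 0 by rewrite /ebes mulr0 oppr0 expR0 mul1r expr0n.
  by apply: ebes_le => //; rewrite !mulr_ge0 ?invr_ge0 ?(ltW pi0)// ltW.
have g0 := gmass_gt0 alpha pi0.
rewrite (_ : _ * bes alpha 0 * _ * _ = (2 `^ (- alpha)) ^+ 2 * (gmass alpha pi * s `^ (- (alpha + 1))) * (1 * bes alpha 0)); last by ring.
rewrite -mulrA ler_wpM2l ?mulr_ge0 ?powR_ge0 ?(ltW g0)//.
by apply: ler_pM => //; rewrite ?expR_ge0 ?ebes_gt0.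
Qed.

Lemma hk_harnack t x x' y : 0 < t -> 0 <= x -> 0 <= x' -> 0 <= y -> x' <= 2 * x ->
  hk t x y <= 2 `^ (alpha + 1) * expR (pi * (x - x') ^+ 2 / t) * hk (2 * t) x' y.
Proof.
move=> t0 x0 x'0 y0 xx'; have t20 : 0 < 2 * t by rewrite mulr_gt0.
rewrite hkE// hkE// (_ : pi * (2 * t) = pi * t * 2); last by ring.
rewrite (@gmass_scale (pi * t) 2) ?mulr_gt0 ?pi0//.
have h2 : ebes alpha (pi * x * y / t) <= ebes alpha (pi * x' * y / (2 * t)).
  apply: ebes_le => //; first by rewrite !mulr_ge0 ?invr_ge0 ?(ltW pi0)// ltW.
  rewrite -subr_ge0 (_ : _ - _ = pi * y * (2 * x - x') / (2 * t)); last first.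
    by move: (pi : R) => p; field; rewrite gt_eqF.
  by rewrite mulr_ge0 ?invr_ge0 ?(ltW t20)// !mulr_ge0 ?(ltW pi0)// subr_ge0.
have h1 : expR (- (pi * (x - y) ^+ 2 / t)) <=
   expR (pi * (x - x') ^+ 2 / t) * expR (- (pi * (x' - y) ^+ 2 / (2 * t))).
  rewrite -expRD ler_expR -subr_ge0.
  rewrite (_ : _ - _ = pi / (2 * t) * (2 * (x - x') + (x' - y)) ^+ 2); last first.
    by move: (pi : R) => p; field; rewrite gt_eqF.
  by rewrite mulr_ge0 ?sqr_ge0// divr_ge0 ?(ltW pi0) ?(ltW t20).
have g0 : 0 < gmass alpha (pi * t) by rewrite gmass_gt0// mulr_gt0 ?pi0.
have e2 : 2 `^ (alpha + 1) * 2 `^ (- (alpha + 1)) = 1 :> R.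
  by rewrite powRN mulfV// gt_eqF// powR_gt0.
rewrite (_ : 2 `^ (alpha + 1) * _ * _ = (2 `^ (alpha + 1) * 2 `^ (- (alpha + 1))) *
  ((2 `^ (- alpha)) ^+ 2 * gmass alpha (pi * t) * (expR (pi * (x - x') ^+ 2 / t) *
  expR (- (pi * (x' - y) ^+ 2 / (2 * t))) * ebes alpha (pi * x' * y / (2 * t))))); last by ring.
rewrite e2 mul1r -mulrA ler_wpM2l ?mulr_ge0 ?powR_ge0 ?(ltW g0)//.
by apply: ler_pM => //; rewrite ?expR_ge0 ?ebes_gt0.
Qed.

(** Half of the Gaussian exponent is kept as decay; the other half is that of the kernel at time 2
    t. *)
Lemma hk_tail t x y : 0 < t -> 0 <= x -> 0 <= y ->
  hk t x y <= 2 `^ (alpha + 1) * expR (- (pi * (x - y) ^+ 2 / (2 * t))) * hk (2 * t) x y.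
Proof.
move=> t0 x0 y0; have t20 : 0 < 2 * t by rewrite mulr_gt0.
rewrite hkE// hkE// (_ : pi * (2 * t) = pi * t * 2); last by ring.
rewrite (@gmass_scale (pi * t) 2) ?mulr_gt0 ?pi0//.
have h2 : ebes alpha (pi * x * y / t) <= ebes alpha (pi * x * y / (2 * t)).
  apply: ebes_le => //; first by rewrite !mulr_ge0 ?invr_ge0 ?(ltW pi0)// ltW.
  rewrite ler_wpM2l ?mulr_ge0 ?(ltW pi0)// lef_pV2 ?posrE//.
  by rewrite ler_peMl ?(ltW t0)// ler1n.
have e1 : expR (- (pi * (x - y) ^+ 2 / t)) =
   expR (- (pi * (x - y) ^+ 2 / (2 * t))) * expR (- (pi * (x - y) ^+ 2 / (2 * t))).
  by rewrite -expRD; congr expR; move: (pi : R) => p; field; rewrite gt_eqF.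
have g0 : 0 < gmass alpha (pi * t) by rewrite gmass_gt0// mulr_gt0 ?pi0.
have e2 : 2 `^ (alpha + 1) * 2 `^ (- (alpha + 1)) = 1 :> R.
  by rewrite powRN mulfV// gt_eqF// powR_gt0.
rewrite (_ : 2 `^ (alpha + 1) * _ * _ = (2 `^ (alpha + 1) * 2 `^ (- (alpha + 1))) *
  ((2 `^ (- alpha)) ^+ 2 * gmass alpha (pi * t) * (expR (- (pi * (x - y) ^+ 2 / (2 * t))) *
  expR (- (pi * (x - y) ^+ 2 / (2 * t))) * ebes alpha (pi * x * y / (2 * t))))); last by ring.
rewrite e1 e2 mul1r -mulrA ler_wpM2l ?mulr_ge0 ?powR_ge0 ?(ltW g0)//.
by rewrite ler_wpM2l ?mulr_ge0 ?expR_ge0.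
Qed.

Lemma hk_mono2 t x y : 0 < t -> 0 <= x -> 0 <= y ->
  hk t x y <= 2 `^ (alpha + 1) * hk (2 * t) x y.
Proof.
move=> t0 x0 y0; have := @hk_harnack t x x y t0 x0 x0 y0.
by rewrite subrr expr0n/= mulr0 mul0r expR0 mulr1; apply; rewrite ler_peMl// ler1n.
Qed.

Lemma hk_mono16 t x y : 0 < t -> 0 <= x -> 0 <= y ->
  hk t x y <= (2 `^ (alpha + 1)) ^+ 4 * hk (16 * t) x y.
Proof.
move=> t0 x0 y0; have q0 : 0 <= 2 `^ (alpha + 1) :> R by exact: powR_ge0.
have H u K : 0 < u -> 0 <= K -> K * hk u x y <= K * 2 `^ (alpha + 1) * hk (2 * u) x y.
  by move=> u0 K0; rewrite -mulrA ler_wpM2l// hk_mono2.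
have -> : 16 * t = 2 * (2 * (2 * (2 * t))) by ring.
have -> : (2 `^ (alpha + 1)) ^+ 4 = 2 `^ (alpha + 1) * 2 `^ (alpha + 1) * 2 `^ (alpha + 1) * 2 `^ (alpha + 1) :> R by ring.
apply: le_trans (hk_mono2 t0 x0 y0) _.
apply: le_trans (H _ _ _ _) _; rewrite ?mulr_ge0 ?mulr_gt0//.
apply: le_trans (H _ _ _ _) _; rewrite ?mulr_ge0 ?mulr_gt0//.
by apply: H; rewrite ?mulr_ge0 ?mulr_gt0.
Qed.

End kernels.

(** * Thin sets *)
Section thin_columns.
Variables (R : realType) (alpha : R).
Hypothesis Ha : - 2^-1 < alpha.
Local Notation nu := (mu_a alpha).
Local Notation hk := (hk alpha).
Implicit Types (s t x y : R) (S : set R).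

Let a1 : - 1 < alpha. Proof. by move: Ha => h; lra. Qed.
Let pi0 : 0 < pi :> R. Proof. exact: pi_gt0. Qed.

(** The pointwise comparison is asked only where the measure lives, since the bounds on the heat
    kernel are proved for nonnegative arguments. *)
Lemma le_integral_mu_a (f g : R -> \bar R) :
  measurable_fun [set: R] f -> measurable_fun [set: R] g ->
  (forall x, 0 <= f x)%E -> (forall x, 0 <= g x)%E ->
  (forall x, 0 <= x -> (f x <= g x)%E) ->
  (\int[nu]_x f x <= \int[nu]_x g x)%E.
Proof.
move=> mf mg f0 g0 fg; rewrite !ge0_integral_mu_a//.
have mw D : measurable_fun (T:=measurableTypeR R) D (EFin \o wdens alpha).
  by apply/measurable_EFinP; exact: measurable_wdens.
apply: ge0_le_integral => //.
- exact: measurable_Rplus.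
- by move=> x _; rewrite mule_ge0// lee_fin wdens_ge0.
- by apply: emeasurable_funM; [exact: measurable_funTS|exact: mw].
- by apply: emeasurable_funM; [exact: measurable_funTS|exact: mw].
- move=> x; rewrite /Rplus /= in_itv/= andbT => x0.
  by rewrite lee_wpmul2r ?lee_fin ?wdens_ge0// fg.
Qed.

Lemma mu_a_set1 x : nu [set x] = 0%E.
Proof.
rewrite -[LHS]/(mu_a alpha [set x]) /mu_a; apply: (@integral_Sset1 _ _ _ x).
by move=> y [].
Qed.

Lemma mu_a_itvcc x y : x <= y -> (nu `[x, y]%classic <= nu `[x, y[%classic)%E.
Proof.
move=> xy; rewrite -(@setUitv1 _ _ (BLeft x) y true)//.
apply: le_trans (measureU2 _ _ _) _ => //.
have e : mu_a alpha [set y] = 0%E := mu_a_set1 y.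
by rewrite [X in (_ + X)%E]e adde0.
Qed.

Lemma mu_a_itv_lty x y : (nu `[x, y]%classic < +oo)%E.
Proof.
have h0 : 0 <= 2 * alpha + 1 by move: Ha; lra.
rewrite -[X in (X < _)%E]/(mu_a alpha `[x, y]%classic) /mu_a.
pose M := wdens alpha (Num.max 0 y).
apply: (@le_lt_trans _ _ (\int[lebesgue_measure]_(z in `[x, y]) M%:E)%E).
  apply: (@le_trans _ _ (\int[lebesgue_measure]_(z in `[x, y] `&` @Rplus R) M%:E)%E).
    apply: ge0_le_integral => //.
    + by apply: measurableI => //; exact: measurable_Rplus.
    + by move=> z _; rewrite lee_fin wdens_ge0.
    + by apply/measurable_EFinP; exact: measurable_wdens.
    + move=> z []; rewrite /Rplus /= !in_itv/= andbT => /andP[_ zy] z0.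
      rewrite lee_fin /M /wdens ler_wpM2l ?powR_ge0// ge0_ler_powR// ?nnegrE//.
        by rewrite le_max lexx.
      by rewrite le_max zy orbT.
  apply: ge0_subset_integral => //.
  + by apply: measurableI => //; exact: measurable_Rplus.
  + by move=> z _; rewrite lee_fin wdens_ge0.
rewrite integral_cst//= lebesgue_measure_itv/=; case: ifP => _.
  by rewrite -EFinB -EFinM ltry.
by rewrite mule0.
Qed.

Lemma mu_a_itv_gt0 x y : 0 < x -> x < y -> (0 < nu `[x, y]%classic)%E.
Proof.
move=> x0 xy.
have h0 : 0 <= 2 * alpha + 1 by move: Ha; lra.
rewrite -[X in (_ < X)%E]/(mu_a alpha `[x, y]%classic) /mu_a.
have w0 : 0 < wdens alpha x by rewrite mulr_gt0 ?powR_gt0// mulr_gt0.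
have -> : `[x, y]%classic `&` @Rplus R = `[x, y]%classic.
  apply/setIidPl => z; rewrite /Rplus /= !in_itv/= andbT => /andP[h _].
  exact: le_trans (ltW x0) h.
apply: (@lt_le_trans _ _ (\int[lebesgue_measure]_(z in `[x, y]) (wdens alpha x)%:E)%E).
  rewrite integral_cst//= lebesgue_measure_itv/= lte_fin xy -EFinB -EFinM lte_fin.
  by rewrite mulr_gt0// subr_gt0.
apply: ge0_le_integral => //.
- by move=> z _; rewrite lee_fin ltW.
- by apply/measurable_EFinP; exact: measurable_wdens.
- move=> z; rewrite /= in_itv/= => /andP[xz _].
  rewrite lee_fin ler_wpM2l ?powR_ge0// ge0_ler_powR// ?nnegrE ?ltW//.
  exact: lt_le_trans xz.
Qed.

Let mulrMsq_ge0 (a b z : R) : 0 <= a -> 0 <= b -> 0 <= a * b * z ^+ 2.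
Proof. by move=> a0 b0; rewrite mulr_ge0 ?sqr_ge0// mulr_ge0. Qed.

Definition dgs s x : R := gss s x - gss (16 * s) x.

Lemma measurable_dgs s : measurable_fun [set: R] (dgs s).
Proof. by apply: measurable_funB; exact: measurable_gss. Qed.

Lemma dgs_ge0 s x : 0 <= s -> 0 <= dgs s x.
Proof.
move=> s0; rewrite subr_ge0 /gss ler_expR lerN2 ler_wpM2r ?sqr_ge0//.
by rewrite ler_wpM2l ?(ltW pi0)// ler_peMl// ler1n.
Qed.

Lemma dgs_le_gss s x : dgs s x <= gss s x.
Proof. by rewrite lerBlDr lerDl expR_ge0. Qed.

Lemma dgs_le_1gss s x : 0 <= s -> dgs s x <= 1 - gss (16 * s) x.
Proof. by move=> s0; rewrite lerD2r gss_le1. Qed.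

Lemma dgs_le_sq s x : 0 <= s -> dgs s x <= 16 * pi * s * x ^+ 2.
Proof.
move=> s0; apply: le_trans (dgs_le_1gss x s0) _.
rewrite lerBlDr -lerBlDl (_ : 1 - _ = 1 + - (pi * (16 * s) * x ^+ 2)); last by ring.
exact: expR_ge1Dx.
Qed.

Definition hcol S s y : \bar R := (\int[nu]_(x in S) (dgs s x * hk (16 * s) x y)%:E)%E.

Let measurable_hkl t y : measurable_fun [set: R] (fun x => hk t x y).
Proof. by under eq_fun do rewrite hkC; exact: measurable_hk. Qed.

Let m_ds s y : measurable_fun [set: R] (fun x => (dgs s x * hk (16 * s) x y)%:E).
Proof.
by apply/measurable_EFinP; apply: measurable_funM; [exact: measurable_dgs|exact: measurable_hkl].
Qed.

Lemma hcol_le_setT S s y : 0 < s -> measurable S -> (hcol S s y <= hcol setT s y)%E.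
Proof.
move=> s0 mS; apply: ge0_subset_integral => //.
by move=> x _; rewrite lee_fin mulr_ge0 ?dgs_ge0 ?hk_ge0 ?ltW ?mulr_gt0.
Qed.

Lemma hcol_le_gauss s y : 0 < s ->
  (hcol setT s y <= ((1 + 16 * s ^+ 2) `^ (- (alpha + 1)) * expR (- (pi * s * y ^+ 2 / (1 + 16 * s ^+ 2))))%:E)%E.
Proof.
move=> s0; have s160 : 0 < 16 * s by rewrite mulr_gt0.
have := @integral_hk_gss R alpha Ha (16 * s) s y s160 (ltW s0).
rewrite (_ : s * (16 * s) = 16 * s ^+ 2); last by ring.
move=> <-; apply: ge0_le_integral => //.
- by move=> x _; rewrite lee_fin mulr_ge0 ?dgs_ge0 ?hk_ge0 ?ltW.
- apply/measurable_EFinP; apply: measurable_funM; [exact: measurable_hk|exact: measurable_gss].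
- move=> x _; rewrite lee_fin hkC mulrC ler_wpM2l ?hk_ge0//; exact: dgs_le_gss.
Qed.

Lemma hcol_le1 s y : 0 < s -> (hcol setT s y <= 1)%E.
Proof.
move=> s0; apply: le_trans (hcol_le_gauss y s0) _.
have p1 : 1 <= 1 + 16 * s ^+ 2 by rewrite lerDl mulr_ge0 ?sqr_ge0.
rewrite lee_fin mulr_ile1 ?powR_ge0 ?expR_ge0//.
  rewrite powRN invf_le1 ?powR_gt0 ?(lt_le_trans ltr01 p1)//.
  rewrite -{1}(powRr0 (1 + 16 * s ^+ 2)) ler_powR//; move: Ha; lra.
by rewrite expR_le1 oppr_le0 divr_ge0 ?(le_trans ler01 p1)// mulrMsq_ge0 ?ltW.
Qed.

(** The column at y changes regime at scales of order 1 / y^2. For y below 1 the spreading of the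
    kernel takes over and the critical scale stays of order 1, whence the maximum. *)
Let M y := Num.max 1 y.

(** The square of the Gaussian bound is at most 1 / (A + 2 pi s y^2), because 2 (alpha + 1) >= 1;
    and A = 1 + 16 s^2 dominates s. *)
Lemma hcol_le_large s y : 0 < s -> 0 <= y ->
  (hcol setT s y <= (Num.sqrt (s * M y ^+ 2)^-1)%:E)%E.
Proof.
move=> s0 y0; apply: le_trans (hcol_le_gauss y s0) _; rewrite lee_fin.
set A := 1 + 16 * s ^+ 2; set E := expR _.
have A1 : 1 <= A by rewrite lerDl mulr_ge0 ?sqr_ge0.
have A0 : 0 < A by exact: lt_le_trans A1.
have M1 : 1 <= M y by rewrite le_max lexx.
have M0 : 0 < M y by exact: lt_le_trans M1.
have U0 : 0 <= A `^ (- (alpha + 1)) * E by rewrite mulr_ge0 ?powR_ge0 ?expR_ge0.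
have sM : 0 <= s * M y ^+ 2 by rewrite mulr_ge0 ?sqr_ge0// ltW.
rewrite -(@ler_pXn2r _ 2) ?nnegrE ?sqrtr_ge0// sqr_sqrtr ?invr_ge0// exprMn.
have h1 : (A `^ (- (alpha + 1))) ^+ 2 <= A^-1.
  rewrite -powR_mulrn ?powR_ge0// -powRrM -powR_inv1 ?(ltW A0)// ler_powR//.
  by move: Ha; lra.
have h2 : E ^+ 2 <= (1 + 2 * (pi * s * y ^+ 2 / A))^-1.
  rewrite /E -expRM_natl mulrN expRN lef_pV2 ?posrE ?expR_gt0 ?expR_ge1Dx//.
  by rewrite ltr_wpDr// mulr_ge0// divr_ge0 ?(ltW A0)// mulrMsq_ge0 ?ltW.
apply: le_trans (ler_pM _ _ h1 h2) _; rewrite ?sqr_ge0//.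
rewrite -invfM lef_pV2 ?posrE ?mulr_gt0 ?exprn_gt0//; last first.
  by rewrite ltr_wpDr// mulr_ge0// divr_ge0 ?(ltW A0)// mulrMsq_ge0 ?ltW.
have -> : A * (1 + 2 * (pi * s * y ^+ 2 / A)) = A + 2 * pi * s * y ^+ 2.
  by move: (pi : R) => p; field; rewrite gt_eqF.
have As : s <= A.
  have -> : A = s + ((4 * s - 8^-1) ^+ 2 + 63 / 64) by rewrite /A; field.
  by rewrite lerDl addr_ge0 ?sqr_ge0.
have p2 : 1 <= 2 * pi :> R by have := pi_ge2 R; lra.
rewrite /M; case: (leP y 1) => [y1|/ltW y1].
  by rewrite expr1n mulr1; apply: (le_trans As); rewrite lerDl mulrMsq_ge0 ?(le_trans ler01 p2) ?(ltW s0).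
apply: (@le_trans _ _ (2 * pi * s * y ^+ 2)); last by rewrite lerDr (ltW A0).
by rewrite ler_wpM2r ?sqr_ge0// ler_peMl ?(ltW s0).
Qed.

(** The first summand comes from (16 s)^2 in the power factor, the second from pi (16 s) y^2 in the
    Gaussian factor. *)
Definition hcolK : R := 256 * (alpha + 1) + 16 * pi.

(** With 1 - e_{16 s} in place of the Gaussian difference, the column is 1 minus an explicit
    quantity, which is at least exp(- (alpha + 1) (16 s)^2 - 16 pi s y^2). The trivial bound 1
    covers large [s * M y ^+ 2]; otherwise s <= 1 and s^2 is absorbed in s. *)
Lemma hcol_le_small s y : 0 < s -> 0 <= y ->
  (hcol setT s y <= (hcolK * (s * M y ^+ 2))%:E)%E.
Proof.
move=> s0 y0; have s160 : 0 < 16 * s by rewrite mulr_gt0.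
have M1 : 1 <= M y by rewrite le_max lexx.
have K1 : 1 <= hcolK by rewrite /hcolK; have := pi_ge2 R; move: Ha; lra.
have [v1|v1] := leP 1 (s * M y ^+ 2).
  apply: le_trans (hcol_le1 y s0) _; rewrite lee_fin.
  by apply: (le_trans K1); rewrite ler_peMr// (le_trans ler01).
have s1 : s <= 1.
  apply: (le_trans _ (ltW v1)); rewrite ler_peMr ?(ltW s0)//.
  by rewrite exprn_ege1.
apply: (@le_trans _ _ (\int[nu]_x ((hk (16 * s) y x)%:E - (hk (16 * s) y x * gss (16 * s) x)%:E))%E).
  apply: ge0_le_integral => //.
  - by move=> x _; rewrite lee_fin mulr_ge0 ?dgs_ge0 ?hk_ge0 ?ltW.
  - by apply: emeasurable_funB; apply/measurable_EFinP; [exact: measurable_hk|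
      apply: measurable_funM; [exact: measurable_hk|exact: measurable_gss]].
  - move=> x _; rewrite -EFinB lee_fin hkC mulrC -[X in _ <= X - _]mulr1 -mulrBr.
    by rewrite ler_wpM2l ?hk_ge0// dgs_le_1gss// ltW.
rewrite integralB//; last 2 first.
- exact: integrable_hk.
- apply: (@le_integrable _ _ _ _ _ measurableT _ (EFin \o hk (16 * s) y)).
  + apply/measurable_EFinP; apply: measurable_funM; [exact: measurable_hk|exact: measurable_gss].
  + move=> x _ /=; have h0 : 0 <= hk (16 * s) y x by exact: hk_ge0.
    rewrite lee_fin normrM ler_piMr ?normr_ge0// ger0_norm ?expR_ge0//.
    by rewrite gss_le1 ?(ltW s160).
  + exact: integrable_hk.
rewrite integral_hk// integral_hk_gss// ?(ltW s160)// -EFinB lee_fin.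
set t := 16 * s; set A := 1 + t * t.
have A1 : 1 <= A by rewrite lerDl mulr_ge0 ?ltW.
have A0 : 0 < A by exact: lt_le_trans A1.
have h1 : A `^ (- (alpha + 1)) >= expR (- ((alpha + 1) * t ^+ 2)).
  rewrite /powR (gt_eqF A0) ler_expR mulNr lerN2 ler_wpM2l//; first by move: Ha; lra.
  by rewrite expr2; apply: le_ln1Dx; rewrite (lt_le_trans _ (mulr_ge0 (ltW s160) (ltW s160)))// ltrN10.
have h2 : expR (- (pi * t * y ^+ 2 / A)) >= expR (- (pi * t * y ^+ 2)).
  rewrite ler_expR lerN2 ler_pdivrMr// ler_peMr//.
  by rewrite mulrMsq_ge0 ?ltW.
have h3 : expR (- ((alpha + 1) * t ^+ 2)) * expR (- (pi * t * y ^+ 2)) <= A `^ (- (alpha + 1)) * expR (- (pi * t * y ^+ 2 / A)).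
  by apply: ler_pM; rewrite ?expR_ge0.
have h4 : 1 + (- ((alpha + 1) * t ^+ 2) - (pi * t * y ^+ 2)) <= expR (- ((alpha + 1) * t ^+ 2)) * expR (- (pi * t * y ^+ 2)).
  by rewrite -expRD; exact: expR_ge1Dx.
have h5 : (alpha + 1) * t ^+ 2 + pi * t * y ^+ 2 <= hcolK * (s * M y ^+ 2).
  have yM : y ^+ 2 <= M y ^+ 2 by rewrite lerXn2r ?nnegrE ?(le_trans ler01 M1)// le_max lexx orbT.
  have M21 : 1 <= M y ^+ 2 by exact: exprn_ege1.
  rewrite /hcolK /t [leRHS]mulrDl; apply: lerD.
    rewrite exprMn (_ : (alpha + 1) * _ = 256 * (alpha + 1) * (s * s)); last by ring.
    rewrite ler_wpM2l ?mulr_ge0//; first by move: Ha; lra.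
    by rewrite ler_wpM2l ?(ltW s0)// (le_trans s1).
  rewrite (_ : pi * _ * _ = 16 * pi * (s * y ^+ 2)); last by ring.
  by rewrite ler_wpM2l ?mulr_ge0 ?(ltW pi0)// ler_wpM2l ?(ltW s0).
by move: h3 h4 h5; move: (_ * expR _) (expR _ * expR _) => u v; lra.
Qed.

(** The increment of u / (1 + u) from u to 2 u is u / ((1 + u) (1 + 2 u)), at least one sixth of
    min(u, 1/u). Telescoping bounds the two-sided sum without locating its peak. *)
Lemma sum_min_geometric (h : R) N : 0 < h ->
  \sum_(i < N) Num.min (2 ^+ i * h) (2 ^+ i * h)^-1 <= 6.
Proof.
move=> h0; pose g u : R := u / (1 + u).
have key u : 0 < u -> Num.min u u^-1 <= 6 * (g (2 * u) - g u).
  move=> u0; have u1 : 0 < 1 + u by lra.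
  have u2 : 0 < 1 + 2 * u by lra.
  have -> : 6 * (g (2 * u) - g u) = 6 * u / ((1 + u) * (1 + 2 * u)).
    by rewrite /g; field; rewrite !gt_eqF.
  rewrite ler_pdivlMr ?mulr_gt0//; have [uh|uh] := leP u u^-1.
    have uu : u * u <= 1 by rewrite -(mulVf (lt0r_neq0 u0)) ler_wpM2r ?(ltW u0).
    have ul : u <= 1 by rewrite leNgt; apply/negP => hu; have := ltr_pM _ _ hu hu; lra.
    rewrite [leRHS]mulrC ler_wpM2l ?(ltW u0)//; nra.
  rewrite mulrC ler_pdivrMr//.
  have uu : 1 <= u * u by rewrite -(mulVf (lt0r_neq0 u0)) ler_wpM2r ?(ltW u0) ?(ltW uh).
  nra.
apply: (@le_trans _ _ (\sum_(i < N) 6 * (g (2 ^+ i.+1 * h) - g (2 ^+ i * h)))).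
  apply: ler_sum => i _; rewrite exprS -mulrA; apply: key.
  by rewrite mulr_gt0// exprn_gt0.
rewrite -mulr_sumr -(big_mkord xpredT (fun i => g (2 ^+ i.+1 * h) - g (2 ^+ i * h))).
rewrite (telescope_sumr (fun i => g (2 ^+ i * h)))//.
have g1 u : 0 < u -> 0 <= g u <= 1.
  move=> u0; have u1 : 0 < 1 + u by lra.
  apply/andP; split; first by rewrite /g divr_ge0 ?(ltW u0) ?(ltW u1).
  by rewrite /g ler_pdivrMr//; lra.
have /andP[_ gN] := g1 _ (mulr_gt0 (exprn_gt0 N (ltr0n R 2)) h0).
have /andP[g0 _] := g1 _ (mulr_gt0 (exprn_gt0 0 (ltr0n R 2)) h0).
lra.
Qed.

(* [hcol] is at most both [delta] and [min (K h) (K / h)] with [h] geometric in the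
   scale, hence at most the geometric mean of the two, which is summable. *)
Lemma sum_hcol_le S (delta : R) s y N : 0 < s -> 0 <= y -> measurable S -> 0 <= delta ->
  (forall u, 0 < u -> (hcol S u y <= delta%:E)%E) ->
  (\sum_(i < N) hcol S (16 ^+ i * s) y <= (6 * Num.sqrt (delta * hcolK))%:E)%E.
Proof.
move=> s0 y0 mS d0 hd.
have K1 : 1 <= hcolK by rewrite /hcolK; have := pi_ge2 R; move: Ha; lra.
have M1 : 1 <= M y by rewrite le_max lexx.
(* A fourth root, so that 16^i s M^2 = (2^i h)^4. In z = 2^i h the two column bounds are
   [hcolK * z ^+ 4] and [z^-1 ^+ 2], both at most [hcolK] times the square of min(z, 1/z). *)
pose h := Num.sqrt (Num.sqrt (s * M y ^+ 2)).
have v0 : 0 < s * M y ^+ 2 by rewrite mulr_gt0// exprn_gt0// (lt_le_trans ltr01).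
have h0 : 0 < h by rewrite !sqrtr_gt0.
have step (i : nat) : (hcol S (16 ^+ i * s) y <= (Num.sqrt (delta * hcolK) * Num.min (2 ^+ i * h) (2 ^+ i * h)^-1)%:E)%E.
  have u0 : 0 < 16 ^+ i * s by rewrite mulr_gt0// exprn_gt0.
  have c0 : (0 <= hcol S (16 ^+ i * s) y)%E.
    by apply: integral_ge0 => x _; rewrite lee_fin mulr_ge0 ?dgs_ge0 ?hk_ge0 ?ltW ?mulr_gt0.
  have l1 := hd _ u0.
  have l2 := le_trans (hcol_le_setT y u0 mS) (hcol_le_large u0 y0).
  have l3 := le_trans (hcol_le_setT y u0 mS) (hcol_le_small u0 y0).
  have cf : hcol S (16 ^+ i * s) y \is a fin_num.
    by rewrite ge0_fin_numE// (le_lt_trans l1)// ltry.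
  move: c0 l1 l2 l3; rewrite -(fineK cf); move: (fine _) => c; rewrite !lee_fin => c0 l1 l2 l3.
  have e : 16 ^+ i * s * M y ^+ 2 = (2 ^+ i * h) ^+ 4.
    rewrite exprMn -[(2 ^+ i) ^+ 4]exprM mulnC exprM (_ : 2 ^+ 4 = 16); last by ring.
    rewrite -mulrA; congr (_ * _).
    by rewrite (_ : 4 = 2 * 2)%N// exprM /h sqr_sqrtr ?sqrtr_ge0// sqr_sqrtr// ltW.
  have z0 : 0 < 2 ^+ i * h by rewrite mulr_gt0// exprn_gt0.
  rewrite e in l2 l3; move: z0 l2 l3; move: (2 ^+ i * h) => z z0 l2 l3.
  have l2' : c <= z^-1 ^+ 2.
    have : Num.sqrt (z ^+ 4)^-1 = z^-1 ^+ 2.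
      rewrite -exprVn (_ : 4 = 2 * 2)%N// exprM sqrtr_sqr ger0_norm// sqr_ge0//.
    by move=> <-.
  have q0 : 0 <= Num.sqrt (delta * hcolK) by exact: sqrtr_ge0.
  have m0 : 0 <= Num.min z z^-1 by rewrite le_min invr_ge0 ltW.
  rewrite -(@ler_pXn2r _ 2) ?nnegrE ?mulr_ge0// exprMn sqr_sqrtr ?(mulr_ge0 d0 (le_trans ler01 K1))//.
  have cc : c <= hcolK * (Num.min z z^-1) ^+ 2.
    have [zz|zz] := leP z z^-1.
      apply: (le_trans l3); rewrite ler_wpM2l ?(le_trans ler01)//.
      have uu : z * z <= 1 by rewrite -(mulVf (lt0r_neq0 z0)) ler_wpM2r ?(ltW z0).
      rewrite (_ : z ^+ 4 = z ^+ 2 * z ^+ 2); last by ring.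
      by rewrite ler_piMr ?sqr_ge0// expr2.
    by apply: (le_trans l2'); rewrite ler_peMl// sqr_ge0.
  rewrite expr2 -mulrA; apply: ler_pM => //.
apply: (@le_trans _ _ (\sum_(i < N) (Num.sqrt (delta * hcolK) * Num.min (2 ^+ i * h) (2 ^+ i * h)^-1)%:E)%E).
  by apply: lee_sum => i _; exact: step.
rewrite sumEFin lee_fin -mulr_sumr mulrC ler_wpM2r ?sqrtr_ge0//.
exact: sum_min_geometric.
Qed.

End thin_columns.

(** * Column masses over a thin set *)

Section thin_sets.
Variables (R : realType) (alpha : R).
Hypothesis Ha : - 2^-1 < alpha.
Local Notation nu := (mu_a alpha).
Local Notation hk := (hk alpha).
Implicit Types (s t x y u : R) (S : set R).

Let a1 : - 1 < alpha. Proof. by move: Ha => h; lra. Qed.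
Let pi0 : 0 < pi :> R. Proof. exact: pi_gt0. Qed.

(** Averaging the hypothesis over z bounds F on the cell by D times the mean of G there; thinness
    supplies the factor [eps] when this constant is integrated over the part of S in the cell. *)
Lemma thin_cell S eps (F G : R -> R) (D u : R) : thin alpha eps S -> 0 < eps -> 0 <= D -> 1 <= u ->
  measurable_fun [set: R] F -> measurable_fun [set: R] G ->
  (forall x, 0 <= F x) -> (forall x, 0 <= G x) -> (\int[nu]_x (G x)%:E < +oo)%E ->
  (forall x z, u <= x < u + u^-1 -> u <= z < u + u^-1 -> F x <= D * G z) ->
  (\int[nu]_(x in S `&` `[u, (u + u^-1)%R[) (F x)%:E <= (D * eps)%:E * \int[nu]_(x in `[u, (u + u^-1)%R[) (G x)%:E)%E.
Proof.
move=> [mS [_ [thin1 thin2]]] eps0 D0 u1 mF mG F0 G0 Gfin FG.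
have u0 : 0 < u by exact: lt_le_trans u1.
set I := `[u, u + u^-1[%classic : set R.
have mI : measurable I by exact: measurable_itv.
have uu : u < u + u^-1 by rewrite ltrDl invr_gt0.
have hm : (nu (S `&` I) <= eps%:E * nu I)%E.
  apply: (@le_trans _ _ (eps%:E * nu (Icc u (u + u^-1)))%E); last first.
    by rewrite lee_pmul2l// mu_a_itvcc// ltW.
  apply: (@le_trans _ _ (nu (S `&` Icc u (u + u^-1)))).
    apply: le_measure; rewrite ?inE; [exact: measurableI|by apply: measurableI => //; exact: measurable_itv|].
    by apply: setIS => z; rewrite /I /Icc /= !in_itv/= => /andP[-> /ltW ->].
  (* The cell at [u = 1] is [1, 2]; it falls under the unit-length clause of thinness, the other
     clause being for x > 1 only. *)
  move: u1; rewrite le_eqVlt => /orP[/eqP <-|u1]; last exact: thin2.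
  by rewrite invr1; apply: thin1; rewrite ler01 lexx.
have mfin : nu I \is a fin_num.
  rewrite ge0_fin_numE//; apply: le_lt_trans (mu_a_itv_lty Ha u (u + u^-1)).
  apply: le_measure; rewrite ?inE; [exact: mI|exact: measurable_itv|].
  by move=> z; rewrite /I /= !in_itv/= => /andP[-> /ltW ->].
have m0 : (0 < nu I)%E.
  exact: lt_le_trans (mu_a_itv_gt0 Ha u0 uu) (mu_a_itvcc _ (ltW uu)).
set J := (\int[nu]_(x in I) (G x)%:E)%E.
have J0 : (0 <= J)%E by apply: integral_ge0 => x _; rewrite lee_fin.
have Jfin : J \is a fin_num.
  rewrite ge0_fin_numE//; apply: le_lt_trans Gfin.
  apply: ge0_subset_integral => //; first by apply/measurable_EFinP.
  by move=> x _; rewrite lee_fin.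
have key x : I x -> ((F x)%:E * nu I <= D%:E * J)%E.
  move=> Ix; rewrite -integral_cst// /J -ge0_integralZl_EFin//; last first.
  - by apply/measurable_EFinP; exact: measurable_funTS.
  - by move=> z _; rewrite lee_fin.
  apply: ge0_le_integral => //.
  - by move=> z _; rewrite lee_fin.
  - by apply/measurable_EFinP; apply: measurable_funM => //; exact: measurable_funTS.
  - move=> z Iz; rewrite -EFinM lee_fin; apply: FG.
      by move: Ix; rewrite /I /= in_itv.
    by move: Iz; rewrite /I /= in_itv.
move: m0 hm key; rewrite -(fineK mfin) -(fineK Jfin); move: (fine (nu I)) (fine J) => m j.
rewrite lte_fin => m0 hm key.
have mSI : measurable (S `&` I) by exact: measurableI.
apply: (@le_trans _ _ (\int[nu]_(x in S `&` I) (D * j / m)%:E)%E).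
  apply: ge0_le_integral => //.
  - by move=> x _; rewrite lee_fin.
  - by apply/measurable_EFinP; exact: measurable_funTS.
  - by move=> x [_ Ix]; have := key x Ix; rewrite -!EFinM !lee_fin ler_pdivlMr.
have c0 : 0 <= D * j / m.
  have := key u; rewrite -!EFinM !lee_fin => h; rewrite divr_ge0 ?(ltW m0)//.
  apply: le_trans (h _); first by rewrite mulr_ge0 ?(ltW m0).
  by rewrite /I /= in_itv/= lexx.
rewrite integral_cst//; apply: (@le_trans _ _ ((D * j / m)%:E * (eps%:E * m%:E))%E).
  by rewrite lee_wpmul2l// lee_fin.
by rewrite -!EFinM lee_fin (_ : D * j / m * _ = D * eps * j)//; field; rewrite gt_eqF.
Qed.

(* The cells [nodes n, nodes n.+1[ tile [1, +oo[. *)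
Fixpoint nodes (n : nat) : R := if n is n'.+1 then nodes n' + (nodes n')^-1 else 1.

Lemma nodes_ge1 n : 1 <= nodes n.
Proof. by elim: n => //= n h; rewrite (le_trans h)// lerDl invr_ge0 (le_trans ler01). Qed.

(** Squaring u + 1/u adds at least 2 to u^2, so the nodes are unbounded and the cells do reach every
    point of [1, +oo[. *)
Lemma nodes_sqr n : n%:R <= nodes n ^+ 2.
Proof.
elim: n => [|n h]; first exact: sqr_ge0.
have u0 : 0 < nodes n by exact: lt_le_trans (nodes_ge1 n).
rewrite /= sqrrD divff ?gt_eqF// -addn1 natrD.
by have := sqr_ge0 (nodes n)^-1; lra.
Qed.

Lemma thin_cover S eps (F G : R -> R) (D : R) : thin alpha eps S -> 0 < eps -> 0 <= D ->
  measurable_fun [set: R] F -> measurable_fun [set: R] G ->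
  (forall x, 0 <= F x) -> (forall x, 0 <= G x) -> (\int[nu]_x (G x)%:E < +oo)%E ->
  (forall u x z, 1 <= u -> u <= x < u + u^-1 -> u <= z < u + u^-1 -> F x <= D * G z) ->
  (\int[nu]_(x in S `&` `[1%R, +oo[) (F x)%:E <= (D * eps)%:E * \int[nu]_x (G x)%:E)%E.
Proof.
move=> St eps0 D0 mF mG F0 G0 Gfin FG; have mS : measurable S by case: St.
have mF' E : measurable_fun E (EFin \o F) by apply/measurable_EFinP; exact: measurable_funTS.
have mG' E : measurable_fun E (EFin \o G) by apply/measurable_EFinP; exact: measurable_funTS.
have F0' x : (0 <= (F x)%:E)%E by rewrite lee_fin.
have G0' x : (0 <= (G x)%:E)%E by rewrite lee_fin.
pose I n := `[1%R, nodes n[%classic : set R.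
have mI n : measurable (I n) by exact: measurable_itv.
have mSI n : measurable (S `&` I n) by exact: measurableI.
have step n : (\int[nu]_(x in S `&` I n) (F x)%:E <= (D * eps)%:E * \int[nu]_(x in I n) (G x)%:E)%E.
  elim: n => [|n IH].
    have -> : I 0 = set0 by rewrite /I /= set_itvco0.
    by rewrite setI0 !integral_set0 mule0.
  pose C := `[nodes n, nodes n + (nodes n)^-1[%classic : set R.
  have mC : measurable C by exact: measurable_itv.
  have IE : I n.+1 = I n `|` C.
    rewrite /I /C; apply: itv_bndbnd_setU; rewrite bnd_simp; first exact: nodes_ge1.
    by rewrite /= lerDl invr_ge0 (le_trans ler01 (nodes_ge1 n)).
  have disj : I n `&` C = set0.
    rewrite -subset0 => z []; rewrite /I /C /= !in_itv/= => /andP[_ h1] /andP[h2 _].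
    by have := le_lt_trans h2 h1; rewrite ltxx.
  rewrite IE setIUr ge0_integral_setU//; last 2 first.
  - exact: measurableI.
  - by apply/disj_setPS; rewrite setIACA disj setI0.
  rewrite (@ge0_integral_setU _ _ _ nu (I n) C)//; last by apply/disj_setPS; rewrite disj.
  rewrite ge0_muleDr; [|exact: integral_ge0|exact: integral_ge0].
  apply: leeD => //; apply: thin_cell => //; first exact: nodes_ge1.
  by move=> x z; apply: FG; exact: nodes_ge1.
have UE : \bigcup_n (S `&` I n) = S `&` `[1%R, +oo[.
  rewrite -setI_bigcupr; congr (_ `&` _); apply/seteqP; split => z.
    by move=> [n _]; rewrite /I /= !in_itv/= andbT => /andP[].
  rewrite /= in_itv/= andbT => z1; exists (Num.truncn (z ^+ 2)).+1 => //.
  apply/andP; split; rewrite bnd_simp//.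
  rewrite -(@ltr_pXn2r _ 2) ?nnegrE ?(le_trans ler01 z1)//; last exact: le_trans ler01 (nodes_ge1 _.+1).
  by apply: lt_le_trans (nodes_sqr _); exact: truncnS_gt.
rewrite -UE.
have ndI : nondecreasing_seq (fun n => S `&` I n).
  apply/nondecreasing_seqP => n; rewrite subsetEset; apply: setIS => z.
  rewrite /I /= !in_itv/= => /andP[-> h]/=; apply: (lt_le_trans h).
  by rewrite lerDl invr_ge0 (le_trans ler01 (nodes_ge1 n)).
have := @ge0_nondecreasing_set_cvg_integral _ _ _ (fun n => S `&` I n) (EFin \o F) nu ndI mSI.
move=> /(_ (fun=> mF' _) (fun n x _ => F0' x)) cv.
rewrite -(cvg_lim _ cv)//; apply: lime_le; first by apply/cvg_ex; eexists; exact: cv.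
apply: nearW => n; apply: le_trans (step n) _; rewrite lee_wpmul2l// ?lee_fin ?mulr_ge0// ?(ltW eps0)//.
exact: ge0_subset_integral.
Qed.

(** The threshold [tau] separates three regions, with t = 16 s. Where t x^2 < tau the Gaussian
    difference is at most pi tau. For larger t x^2 and x < 1 the kernel is bounded, and S has little
    mass in [0, 1]. For x >= 1 Harnack's inequality on a cell costs only a constant depending on
    [tau]. *)
Lemma thin_hcol S eps s y tau : thin alpha eps S -> 0 < eps -> 0 < s -> 0 <= y -> 0 < tau ->
  (hcol alpha S s y <= (pi * tau)%:E +
     ((2 `^ (- alpha)) ^+ 2 * bes alpha 0 * gmass alpha pi * tau `^ (- (alpha + 1)))%:E *
        (eps%:E * nu (Icc 0 1)) + (2 `^ (alpha + 1) * expR (4 * pi / tau) * eps)%:E)%E.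
Proof.
move=> St eps0 s0 y0 tau0; have mS : measurable S by case: St.
have S0 x : S x -> 0 <= x.
  by case: St => _ [SR _] /SR; rewrite /Rplus /= in_itv/= andbT.
set t := 16 * s; have t0 : 0 < t by rewrite mulr_gt0.
have hk0 x : 0 <= hk t x y by exact: hk_ge0.
have mhk : measurable_fun [set: R] (fun x => hk t x y).
  by under eq_fun do rewrite hkC; exact: measurable_hk.
have mhk' E : measurable_fun E (fun x => (hk t x y)%:E).
  by apply/measurable_EFinP; exact: measurable_funTS.
pose H x := if tau <= t * x ^+ 2 then hk t x y else 0.
have H0 x : 0 <= H x by rewrite /H; case: ifP.
have mH : measurable_fun [set: R] H.
  apply: measurable_fun_ifT => //; apply: measurable_fun_ler => //.
  by apply: measurable_funM => //; exact: measurable_funX.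
have mH' E : measurable_fun E (EFin \o H).
  by apply/measurable_EFinP; exact: measurable_funTS.
apply: (@le_trans _ _ (\int[nu]_(x in S) ((pi * tau)%:E * (hk t x y)%:E + (H x)%:E))%E).
  apply: ge0_le_integral => //.
  - by move=> x Sx; rewrite lee_fin mulr_ge0// dgs_ge0// ltW.
  - apply/measurable_EFinP; apply: measurable_funTS; apply: measurable_funM => //.
    exact: measurable_dgs.
  - by apply: emeasurable_funD => //; apply: emeasurable_funM.
  - move=> x Sx; rewrite -EFinM -EFinD lee_fin /H; case: (leP tau) => h.
      apply: ler_wpDl; first by apply: mulr_ge0 => //; rewrite mulr_ge0 ?(ltW pi0) ?(ltW tau0).
      rewrite ler_piMl//; apply: le_trans (dgs_le_gss _ _) _.
      by apply: gss_le1; exact: ltW.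
    rewrite addr0 ler_wpM2r//; apply: le_trans (dgs_le_sq _ (ltW s0)) _.
    rewrite (_ : _ * _ * _ * _ = pi * (t * x ^+ 2)); last by rewrite /t; ring.
    by rewrite ler_wpM2l ?(ltW pi0)// ltW.
rewrite ge0_integralD//; last 3 first.
- by move=> x _; apply: mule_ge0; rewrite lee_fin// mulr_ge0 ?(ltW pi0) ?(ltW tau0).
- by apply: emeasurable_funM.
- by move=> x _; rewrite lee_fin.
rewrite -[X in (_ <= X)%E]addeA; apply: leeD.
  rewrite ge0_integralZl_EFin//; last by rewrite mulr_ge0 ?(ltW pi0) ?(ltW tau0).
  rewrite -[X in (_ <= X)%E]mule1 lee_wpmul2l// ?lee_fin ?mulr_ge0 ?(ltW pi0) ?(ltW tau0)//.
    apply: (@le_trans _ _ (\int[nu]_x (hk t x y)%:E)%E).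
      by apply: ge0_subset_integral => // x _; rewrite lee_fin.
    by under eq_integral do rewrite hkC; rewrite integral_hk.
  by move=> x _; rewrite lee_fin.
have SE : S = (S `&` `]-oo, 1%R[) `|` (S `&` `[1%R, +oo[).
  by rewrite -setIUr -itv_bndbnd_setU// set_itvNyy setIT.
rewrite [X in (\int[nu]_(x in X) _)%E]SE ge0_integral_setU//; last 4 first.
- exact: measurableI.
- exact: measurableI.
- by move=> x _; rewrite lee_fin.
- apply/disj_setPS => z [[_ /=]]; rewrite in_itv/= => h [_]; rewrite /= in_itv/= andbT => h'.
  by have := le_lt_trans h' h; rewrite ltxx.
apply: leeD.
  (* In this region x < 1 and t x^2 >= tau, so t >= tau and the kernel is bounded independently of
     the scale. *)
  set c0 := _ * gmass alpha pi * _.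
  have c00 : 0 <= c0.
    have := @hk_ubound R alpha Ha tau 0 0 tau0 (lexx _) (lexx _); apply: le_trans.
    exact: hk_ge0.
  apply: (@le_trans _ _ (\int[nu]_(x in S `&` `]-oo, 1%R[) c0%:E)%E).
    apply: ge0_le_integral => //.
    + exact: measurableI.
    + by move=> x _; rewrite lee_fin.
    move=> x [Sx]; rewrite /= in_itv/= => x1; rewrite lee_fin /H; case: (leP tau) => // h.
    apply: le_trans (hk_ubound Ha t0 (S0 _ Sx) y0) _; rewrite /c0 ler_wpM2l//.
      by rewrite !mulr_ge0 ?sqr_ge0 ?powR_ge0// ltW// ?gmass_gt0// bes_gt0.
    rewrite !powRN lef_pV2 ?posrE ?powR_gt0// ge0_ler_powR ?nnegrE ?(ltW t0) ?(ltW tau0)//.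
      by move: Ha; lra.
    apply: (le_trans h); rewrite ler_piMr ?(ltW t0)// exprn_ile1 ?(S0 _ Sx) ?(ltW x1)//.
  rewrite integral_cst//; last exact: measurableI.
  rewrite lee_wpmul2l ?lee_fin//; case: St => _ [_ [thin1 _]].
  have := thin1 0; rewrite lexx ler01 add0r => /(_ isT); apply: le_trans.
  apply: le_measure; rewrite ?inE; [exact: measurableI|by apply: measurableI => //; exact: measurable_itv|].
  by move=> z [Sz]; rewrite /= /Icc !in_itv/= => z1; split => //=; rewrite in_itv/= S0 ?ltW.
have t20 : 0 < 2 * t by rewrite mulr_gt0.
have D0 : 0 <= 2 `^ (alpha + 1) * expR (4 * pi / tau) by rewrite mulr_ge0 ?powR_ge0 ?expR_ge0.
pose G x := hk (2 * t) x y.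
have mG : measurable_fun [set: R] G.
  by rewrite /G; under eq_fun do rewrite hkC; exact: measurable_hk.
have G0 x : 0 <= G x by exact: hk_ge0.
have G1 : (\int[nu]_x (G x)%:E = 1)%E.
  by under eq_integral do rewrite /G hkC; rewrite integral_hk.
rewrite -[X in (_ <= X)%E]mule1 -G1; apply: thin_cover => //; first by rewrite G1 ltry.
move=> u x z u1 /andP[ux xu] /andP[uz zu].
rewrite /H; case: (leP tau) => h; last by rewrite mulr_ge0.
have u0 : 0 < u by exact: lt_le_trans u1.
(* As u >= 1, all points of the cell lie in [u, 2 u]. This gives the hypothesis z <= 2 x of
   Harnack's inequality and, from tau <= t x^2, the bound tau <= 4 t u^2 behind its exponent. *)
have ui : u^-1 <= u by rewrite (le_trans _ u1)// invf_le1.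
have x0 : 0 < x by exact: lt_le_trans ux.
have z0 : 0 < z by exact: lt_le_trans uz.
have zx : z <= 2 * x by lra.
apply: le_trans (hk_harnack Ha t0 (ltW x0) (ltW z0) y0 zx) _.
rewrite ler_wpM2r ?(G0 z)// ler_wpM2l ?powR_ge0// ler_expR.
have xz : (x - z) ^+ 2 <= (u^-1) ^+ 2.
  have : `|x - z| <= u^-1 by rewrite ler_norml; apply/andP; split; lra.
  by rewrite -(@ler_pXn2r _ 2) ?nnegrE ?invr_ge0 ?(ltW u0)// real_normK// num_real.
have tu : tau <= t * (4 * u ^+ 2).
  apply: (le_trans h); rewrite ler_wpM2l ?(ltW t0)//.
  rewrite (_ : 4 * u ^+ 2 = (2 * u) ^+ 2); last by ring.
  by rewrite ler_pXn2r ?nnegrE ?mulr_ge0 ?(ltW x0) ?(ltW u0)//; lra.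
rewrite ler_pdivrMr// mulrAC ler_pdivlMr//.
rewrite (_ : 4 * pi * t = pi * (4 * t)); last by ring.
rewrite -mulrA ler_wpM2l ?(ltW pi0)//.
apply: (@le_trans _ _ (u^-1 ^+ 2 * (t * (4 * u ^+ 2)))).
  by apply: ler_pM => //; rewrite ?sqr_ge0 ?(ltW tau0).
rewrite (_ : u^-1 ^+ 2 * _ = 4 * t)//; field; exact: lt0r_neq0.
Qed.

Lemma thin_hcol_small (delta : R) : 0 < delta -> exists2 eps0 : R, 0 < eps0 &
  forall eps S s y, 0 < eps < eps0 -> thin alpha eps S -> 0 < s -> 0 <= y ->
  (hcol alpha S s y <= delta%:E)%E.
Proof.
(* Makes the first term of [thin_hcol] equal to delta / 2. The two others are K eps, and [eps0]
   makes them less than the remaining half. *)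
move=> d0; pose tau := delta / (2 * pi).
have tau0 : 0 < tau by rewrite divr_gt0// mulr_gt0.
pose c0 := (2 `^ (- alpha)) ^+ 2 * bes alpha 0 * gmass alpha pi * tau `^ (- (alpha + 1)).
have c00 : 0 <= c0.
  have := @hk_ubound R alpha Ha tau 0 0 tau0 (lexx _) (lexx _); apply: le_trans.
  exact: hk_ge0.
have mfin : nu (Icc 0 1) \is a fin_num by rewrite ge0_fin_numE// mu_a_itv_lty.
pose K := c0 * fine (nu (Icc 0 1)) + 2 `^ (alpha + 1) * expR (4 * pi / tau).
have K0 : 0 < K.
  apply: ltr_wpDl; last by rewrite mulr_gt0 ?powR_gt0 ?expR_gt0.
  by rewrite mulr_ge0 ?fine_ge0.
exists (delta / (2 * K)); first by rewrite divr_gt0// mulr_gt0.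
move=> eps S s y /andP[e0 e1] St s0 y0.
apply: le_trans (thin_hcol St e0 s0 y0 tau0) _.
rewrite -(fineK mfin) -/c0 -!EFinM -!EFinD lee_fin.
move: e1; rewrite ltr_pdivlMr ?mulr_gt0// => e1.
have -> : pi * tau = delta / 2 by rewrite /tau; move: pi0; move: (pi : R) => p p0; field; rewrite gt_eqF.
move: e1; rewrite /K; move: (fine _) (_ * expR _) => m k; lra.
Qed.

End thin_sets.

(** * The Fourier-Bessel transform and the heat semigroup *)
Section transform.
Variables (R : realType) (alpha : R).
Hypothesis Ha : - 2^-1 < alpha.
Local Notation nu := (mu_a alpha).
Local Notation hk := (hk alpha).
Local Notation jb := (jb alpha).
Local Notation integ f := (nu.-integrable [set: R] (EFin \o f)).
Implicit Types (s t x y z : R) (f g h u v : R -> R).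

Let pi0 : 0 < pi :> R. Proof. exact: pi_gt0. Qed.

(** The kernel is even in each variable, which carries bounds proved on the half-line over to
    functions on the whole line. *)
Lemma hk_abs s x y : hk s `|x| `|y| = hk s x y.
Proof.
rewrite /hk -!normrX !(ger0_norm (sqr_ge0 _)); congr (_ * bes _ _).
by rewrite !exprMn -!normrX !(ger0_norm (sqr_ge0 _)).
Qed.

Lemma integrable_measurable f : integ f -> measurable_fun [set: R] f.
Proof. by case/integrableP => /measurable_EFinP. Qed.

Lemma integrable_mul_bounded f u (M : R) : integ f -> measurable_fun [set: R] u ->
  (forall x, `|u x| <= M) -> integ (fun x => f x * u x).
Proof.
move=> fi mu uM; have mf := integrable_measurable fi.
apply: (@le_integrable _ _ _ _ _ measurableT _ (EFin \o (fun x => M * f x))).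
- by apply/measurable_EFinP; exact: measurable_funM.
- move=> x _ /=; rewrite lee_fin !normrM mulrC ler_wpM2r// (le_trans (uM x))//.
  exact: ler_norm.
- by rewrite (_ : _ \o _ = (fun x => M%:E * (EFin \o f) x)%E)//; exact: integrableZl.
Qed.

Lemma EFin_Rintegral f : integ f -> (\int[nu]_x f x)%:E = (\int[nu]_x (f x)%:E)%E.
Proof. by move=> fi; rewrite fineK// integrable_fin_num. Qed.

Lemma measurable_Rintegral (F : R * R -> R) : measurable_fun [set: R * R] F ->
  measurable_fun [set: R] (fun x => \int[nu]_y F (x, y)).
Proof.
move=> mF; have {}mF : measurable_fun [set: R * R] (EFin \o F) by apply/measurable_EFinP.
have mp : measurable_fun [set: R] (fubini_F nu (EFin \o F)^\+%E).
  by apply: measurable_fun_fubini_tonelli_F => //; exact: measurable_funepos.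
have mn : measurable_fun [set: R] (fubini_F nu (EFin \o F)^\-%E).
  by apply: measurable_fun_fubini_tonelli_F => //; exact: measurable_funeneg.
rewrite /Rintegral; apply: measurableT_comp => //.
rewrite (_ : (fun x => _) = (fun x => fubini_F nu (EFin \o F)^\+%E x - fubini_F nu (EFin \o F)^\-%E x)%E); last first.
  apply/funext => x; rewrite [LHS]integralE.
  by congr (_ - _)%E; apply: eq_integral => y _; rewrite !(funeposE, funenegE).
exact: emeasurable_funB.
Qed.

Definition FB f y : R := \int[nu]_x (f x * jb x y).

Lemma integrable_FB_kernel f y : integ f -> integ (fun x => f x * jb x y).
Proof.
move=> fi; apply: (integrable_mul_bounded (M := jmax alpha)) => //.
  by under eq_fun do rewrite jbC; exact: measurable_jb.
by move=> x; exact: jb_bound.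
Qed.

Lemma FB_bound f y : integ f -> `|FB f y| <= jmax alpha * \int[nu]_x `|f x|.
Proof.
move=> fi; have fai : integ (fun x => `|f x|) by exact: integrable_norm.
apply: le_trans (le_normr_Rintegral _ (integrable_FB_kernel y fi)) _ => //.
rewrite -RintegralZl//; apply: le_Rintegral => //.
- exact: integrable_norm (integrable_FB_kernel y fi).
- by rewrite (_ : _ \o _ = (fun x => (jmax alpha)%:E * (EFin \o (fun x => `|f x|%R)) x)%E)//; exact: integrableZl.
- by move=> x _; rewrite normrM mulrC ler_wpM2r// jb_bound.
Qed.

Lemma measurable_FB f : measurable_fun [set: R] f -> measurable_fun [set: R] (FB f).
Proof.
move=> mf; apply: (measurable_Rintegral (F := fun z : R * R => f z.2 * jb z.2 z.1)).
apply: measurable_funM; first exact: measurableT_comp.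
by under eq_fun do rewrite jbC; exact: measurable_jb2.
Qed.

(** The Bessel kernel is bounded, so |f(x)| |h(y)| dominates the double integrand up to a constant
    and Fubini applies. *)
Lemma FB_symmetric f h : integ f -> integ h ->
  \int[nu]_x (f x * FB h x) = \int[nu]_x (h x * FB f x).
Proof.
move=> fi hi; congr fine.
have mf := integrable_measurable fi; have mh := integrable_measurable hi.
pose F (z : R * R) := (f z.1 * h z.2 * jb z.1 z.2)%:E.
have mF : measurable_fun [set: R * R] F.
  apply/measurable_EFinP; apply: measurable_funM; last exact: measurable_jb2.
  by apply: measurable_funM; exact: measurableT_comp.
have FI : (nu \x nu)%E.-integrable [set: R * R] F.
  apply/integrable12ltyP => //.
  apply: (@le_lt_trans _ _ (\int[nu]_x (`|f x|%:E * (jmax alpha * \int[nu]_y `|h y|)%:E))%E).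
    apply: ge0_le_integral => //.
    - by move=> x _; apply: integral_ge0.
    - apply: (@measurable_fun_fubini_tonelli_F _ _ _ _ R nu (abse \o F)) => //.
        exact: measurableT_comp.
      by move=> z; exact: abse_ge0.
    - apply/measurable_EFinP; apply: measurable_funM => //.
      exact: measurableT_comp.
    - move=> x _; rewrite EFinM muleA EFin_Rintegral; last exact: integrable_norm.
      rewrite -ge0_integralZl//; last 2 first.
      + by apply/measurable_EFinP; exact: measurableT_comp.
      + by rewrite mule_ge0// lee_fin jmax_ge0.
      apply: ge0_le_integral => //.
      + by apply: measurableT_comp => //; apply: (measurableT_comp mF); exact: measurable_pair1.
      + by apply: emeasurable_funM => //; apply/measurable_EFinP; exact: measurableT_comp.
      + move=> y _; rewrite /F /= -!EFinM lee_fin normrM (normrM (f x)) mulrAC ler_wpM2r// ler_wpM2l//.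
        exact: jb_bound.
  rewrite ge0_integralZr//; last 2 first.
  - by apply/measurable_EFinP; exact: measurableT_comp.
  - by rewrite lee_fin mulr_ge0 ?jmax_ge0// Rintegral_ge0.
  have /integrableP[_ flt] := fi.
  by rewrite muleC lte_mul_pinfty// lee_fin mulr_ge0 ?jmax_ge0// Rintegral_ge0.
transitivity (\int[nu]_x \int[nu]_y F (x, y))%E.
  apply: eq_integral => x _; rewrite EFinM EFin_Rintegral; last exact: integrable_FB_kernel.
  rewrite -integralZl//; last exact: integrable_FB_kernel.
  by apply: eq_integral => y _; rewrite /F -EFinM jbC mulrA.
rewrite Fubini//; apply: eq_integral => x _; rewrite EFinM EFin_Rintegral; last exact: integrable_FB_kernel.
rewrite -integralZl//; last exact: integrable_FB_kernel.
apply: eq_integral => y _; rewrite /F -EFinM; congr EFin.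
by rewrite [LHS]/= (mulrC (f y)) -mulrA.
Qed.

Lemma integrable_gss s : 0 < s -> integ (gss s).
Proof.
move=> s0; have sV0 : 0 < s^-1 by rewrite invr_gt0.
have b0 : 0 < bes alpha 0 by apply: bes_gt0 => //; move: Ha; lra.
pose C := (2 `^ (- alpha)) ^+ 2 * gmass alpha (pi * s^-1) * bes alpha 0.
have C0 : 0 < C.
  by rewrite mulr_gt0// mulr_gt0 ?exprn_gt0 ?powR_gt0// gmass_gt0// mulr_gt0.
have -> : EFin \o gss s = (fun y => C^-1%:E * (EFin \o hk s^-1 0) y)%E.
  apply/funext => y; rewrite /= /hk -EFinM; congr EFin.
  rewrite mulr0 !mul0r expr0n/= add0r invrK [X in C^-1 * X]mulrAC -/C mulKf ?gt_eqF//.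
  by rewrite /gss mulrAC.
by apply: integrableZl => //; exact: integrable_hk.
Qed.

Definition heat t f x : R := \int[nu]_y (hk t x y * f y).

Lemma FB_hk s x z : 0 < s -> FB (hk s x) z = gss s z * jb z x.
Proof.
move=> s0; rewrite /FB /Rintegral; under eq_integral do rewrite jbC.
by rewrite integral_hk_jb.
Qed.

Lemma heat_FB s f x : 0 < s -> integ f -> heat s (FB f) x = FB (fun z => gss s z * f z) x.
Proof.
move=> s0 fi; rewrite /heat FB_symmetric//; last exact: integrable_hk.
by apply: eq_Rintegral => z _; rewrite FB_hk// mulrA [f z * _]mulrC.
Qed.

(** A regularized inversion formula: the Gaussian makes the transform of f integrable, and
    transforming back gives the heat flow instead of f. *)
Lemma FB_gss_FB t f z : 0 < t -> integ f -> FB (fun y => gss t y * FB f y) z = heat t f z.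
Proof.
move=> t0 fi; rewrite {1}/FB; under eq_Rintegral do rewrite mulrAC.
rewrite FB_symmetric//; last exact: integrable_FB_kernel (integrable_gss t0).
apply: eq_Rintegral => x _; rewrite mulrC; congr (_ * _).
rewrite /FB /Rintegral -[RHS]/(fine (hk t z x)%:E) -(integral_gss_jb2 Ha z x t0).
by congr fine; apply: eq_integral => y _; rewrite (jbC _ y z) (jbC _ y x).
Qed.

Lemma integrable_gss_FB t f : 0 < t -> integ f -> integ (fun y => gss t y * FB f y).
Proof.
move=> t0 fi; apply: (integrable_mul_bounded (integrable_gss t0)).
  by apply: measurable_FB; exact: integrable_measurable.
by move=> y; exact: FB_bound.
Qed.

Lemma integrable_gss_mul s f : 0 <= s -> integ f -> integ (fun x => gss s x * f x).
Proof.
move=> s0 fi; under eq_fun do rewrite mulrC.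
apply: (integrable_mul_bounded (M := 1) fi); first exact: measurable_gss.
by move=> x; rewrite ger0_norm ?gss_le1// ltW// gss_gt0.
Qed.

Lemma heat_plancherel t f : 0 < t -> integ f ->
  \int[nu]_y (gss t y * FB f y ^+ 2) = \int[nu]_x (f x * heat t f x).
Proof.
move=> t0 fi; under eq_Rintegral do rewrite expr2 mulrA.
rewrite (FB_symmetric (integrable_gss_FB t0 fi) fi).
by apply: eq_Rintegral => x _; rewrite FB_gss_FB.
Qed.

Definition hform s t f : R := \int[nu]_x (gss s x * f x * heat t f x).

(** Write the heat flow of f as the transform of e_t times g, move that transform onto e_s f, and
    recognize the heat flow of g. *)
Lemma hform_FB s t f : 0 < s -> 0 < t -> integ f -> hform s t f = hform t s (FB f).
Proof.
move=> s0 t0 fi; rewrite /hform.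
under eq_Rintegral => x _ do rewrite -FB_gss_FB//.
rewrite FB_symmetric; [|exact: integrable_gss_mul (ltW s0) fi|exact: integrable_gss_FB].
by apply: eq_Rintegral => x _; rewrite heat_FB.
Qed.

End transform.

(** * The heat semigroup as an approximate identity *)

Section approximate_identity.
Variables (R : realType) (alpha : R).
Hypothesis Ha : - 2^-1 < alpha.
Local Notation nu := (mu_a alpha).
Local Notation hk := (hk alpha).
Implicit Types (s t x y : R) (f g h u v : R -> R) (F G : R -> R -> R).

Let pi0 : 0 < pi :> R. Proof. exact: pi_gt0. Qed.

Definition measurable2 F := measurable_fun [set: R * R] (fun z => F z.1 z.2).

Definition dint F : \bar R := (\int[nu]_x \int[nu]_y (F x y)%:E)%E.

Lemma measurable2_hk s : measurable2 (hk s).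
Proof. exact: measurable_hk2. Qed.

Lemma measurable2l u : measurable_fun [set: R] u -> measurable2 (fun x _ => u x).
Proof. by move=> mu; exact: measurableT_comp. Qed.

Lemma measurable2r u : measurable_fun [set: R] u -> measurable2 (fun _ y => u y).
Proof. by move=> mu; exact: measurableT_comp. Qed.

Lemma measurable2_row F x : measurable2 F -> measurable_fun [set: R] (fun y => (F x y)%:E).
Proof.
move=> mF; apply/measurable_EFinP.
exact: (measurableT_comp mF (measurable_pair1 x)).
Qed.

Lemma measurable_inner F : measurable2 F -> (forall x y, 0 <= F x y) ->
  measurable_fun [set: R] (fun x => \int[nu]_y (F x y)%:E)%E.
Proof.
move=> mF F0; pose H (z : R * R) := (F z.1 z.2)%:E.
have mH : measurable_fun [set: R * R] H by apply/measurable_EFinP.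
have H0 z : (0 <= H z)%E by rewrite lee_fin.
rewrite -[X in measurable_fun _ X]/(fubini_F nu H).
exact: measurable_fun_fubini_tonelli_F.
Qed.

Lemma inner_ge0 F x : (forall x y, 0 <= F x y) -> (0 <= \int[nu]_y (F x y)%:E)%E.
Proof. by move=> F0; apply: integral_ge0 => y _; rewrite lee_fin. Qed.

Lemma dint_swap F : measurable2 F -> (forall x y, 0 <= F x y) -> dint F = dint (fun x y => F y x).
Proof.
move=> mF F0; pose H (z : R * R) := (F z.1 z.2)%:E.
have mH : measurable_fun [set: R * R] H by apply/measurable_EFinP.
have H0 z : (0 <= H z)%E by rewrite lee_fin.
rewrite -[LHS]/(\int[nu]_x \int[nu]_y H (x, y))%E.
rewrite -[RHS]/(\int[nu]_y \int[nu]_x H (x, y))%E.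
exact: fubini_tonelli.
Qed.

Lemma dint_le F G : measurable2 F -> measurable2 G -> (forall x y, 0 <= F x y) ->
  (forall x y, F x y <= G x y) -> (dint F <= dint G)%E.
Proof.
move=> mF mG F0 FG; have G0 x y : 0 <= G x y by exact: le_trans (FG x y).
apply: ge0_le_integral => //.
- by move=> x _; exact: inner_ge0.
- exact: measurable_inner.
- exact: measurable_inner.
- move=> x _; apply: ge0_le_integral => //.
  + by move=> y _; rewrite lee_fin.
  + exact: measurable2_row.
  + exact: measurable2_row.
  + by move=> y _; rewrite lee_fin.
Qed.

Lemma dintD F G : measurable2 F -> measurable2 G ->
  (forall x y, 0 <= F x y) -> (forall x y, 0 <= G x y) ->
  dint (fun x y => F x y + G x y) = (dint F + dint G)%E.
Proof.
move=> mF mG F0 G0; rewrite /dint -ge0_integralD//.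
- apply: eq_integral => x _; rewrite -ge0_integralD//.
  + by move=> y _; rewrite lee_fin.
  + exact: measurable2_row.
  + by move=> y _; rewrite lee_fin.
  + exact: measurable2_row.
- by move=> x _; exact: inner_ge0.
- exact: measurable_inner.
- by move=> x _; exact: inner_ge0.
- exact: measurable_inner.
Qed.

Lemma dintZ c F : 0 <= c -> measurable2 F -> (forall x y, 0 <= F x y) ->
  dint (fun x y => c * F x y) = (c%:E * dint F)%E.
Proof.
move=> c0 mF F0; rewrite /dint -ge0_integralZl_EFin//.
- apply: eq_integral => x _; rewrite -ge0_integralZl_EFin//.
  + by move=> y _; rewrite lee_fin.
  + exact: measurable2_row.
- by move=> x _; exact: inner_ge0.
- exact: measurable_inner.
Qed.

Lemma dint_hkl s u : 0 < s -> measurable_fun [set: R] u -> (forall x, 0 <= u x) ->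
  dint (fun x y => hk s x y * u x) = (\int[nu]_x (u x)%:E)%E.
Proof.
move=> s0 mu u0; apply: eq_integral => x _.
under eq_integral do rewrite EFinM.
rewrite ge0_integralZr//; last 3 first.
- by apply/measurable_EFinP; exact: measurable_hk.
- by move=> y _; rewrite lee_fin hk_ge0.
- by rewrite lee_fin.
by rewrite integral_hk// mul1e.
Qed.

Lemma dint_hkr s u : 0 < s -> measurable_fun [set: R] u -> (forall x, 0 <= u x) ->
  dint (fun x y => hk s x y * u y) = (\int[nu]_x (u x)%:E)%E.
Proof.
move=> s0 mu u0; rewrite dint_swap; last 2 first.
- by apply: measurable_funM; [exact: measurable2_hk|exact: measurable2r].
- by move=> x y; rewrite mulr_ge0 ?hk_ge0.
by rewrite -(dint_hkl s0 mu u0); congr dint; apply/funext => x; apply/funext => y; rewrite hkC.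
Qed.

Lemma dint_hk_le s u F : 0 < s -> measurable_fun [set: R] u -> (forall x, 0 <= u x) ->
  measurable2 F -> (forall x y, 0 <= F x y) ->
  (forall x y, F x y <= hk s x y * u x + hk s x y * u y) ->
  (dint F <= \int[nu]_x (u x)%:E + \int[nu]_x (u x)%:E)%E.
Proof.
move=> s0 mu u0 mF F0 FG.
have m1 : measurable2 (fun x y => hk s x y * u x).
  by apply: measurable_funM; [exact: measurable2_hk|exact: (measurable2l mu)].
have m2 : measurable2 (fun x y => hk s x y * u y).
  by apply: measurable_funM; [exact: measurable2_hk|exact: (measurable2r mu)].
have h1 x y : 0 <= hk s x y * u x by apply: mulr_ge0 => //; exact: hk_ge0.
have h2 x y : 0 <= hk s x y * u y by apply: mulr_ge0 => //; exact: hk_ge0.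
apply: (le_trans (dint_le mF (measurable_funD m1 m2) F0 FG)).
by rewrite (dintD m1 m2 h1 h2) (dint_hkl s0 mu u0) (dint_hkr s0 mu u0).
Qed.

Definition nsq f : \bar R := (\int[nu]_x (f x ^+ 2)%:E)%E.

Lemma integral_sqrZ c f : 0 <= c -> measurable_fun [set: R] f ->
  (\int[nu]_x (c * f x ^+ 2)%:E = c%:E * nsq f)%E.
Proof.
move=> c0 mf; rewrite /nsq -ge0_integralZl_EFin//.
- by move=> x _; rewrite lee_fin sqr_ge0.
- by apply/measurable_EFinP; exact: measurable_funX.
Qed.

(** Convergence of the heat flow to f is measured by this quadratic form. Its kernel is positive, so
    Tonelli's theorem applies and infinite values are harmless. *)
Definition energy s f : \bar R := dint (fun x y => hk s x y * (f x - f y) ^+ 2).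

Lemma measurable2_energy s f : measurable_fun [set: R] f ->
  measurable2 (fun x y => hk s x y * (f x - f y) ^+ 2).
Proof.
move=> mf; apply: measurable_funM; first exact: measurable2_hk.
apply: measurable_funX; apply: measurable_funB.
  exact: (measurable2l mf).
exact: (measurable2r mf).
Qed.

Lemma energy_kernel_ge0 s f x y : 0 < s -> 0 <= hk s x y * (f x - f y) ^+ 2.
Proof. by move=> s0; rewrite mulr_ge0 ?sqr_ge0// hk_ge0. Qed.

Lemma energy_ge0 s f : 0 < s -> (0 <= energy s f)%E.
Proof.
move=> s0; apply: integral_ge0 => x _; apply: integral_ge0 => y _.
by rewrite lee_fin energy_kernel_ge0.
Qed.

Lemma energy_le_nsq s f : 0 < s -> measurable_fun [set: R] f -> (energy s f <= (4:R)%:E * nsq f)%E.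
Proof.
move=> s0 mf; have mf2 : measurable_fun [set: R] (fun x => 2 * f x ^+ 2).
  by apply: measurable_funM => //; exact: measurable_funX.
have f20 x : 0 <= 2 * f x ^+ 2 by rewrite mulr_ge0 ?sqr_ge0.
have -> : ((4:R)%:E * nsq f = \int[nu]_x (2 * f x ^+ 2)%:E + \int[nu]_x (2 * f x ^+ 2)%:E)%E.
  by rewrite integral_sqrZ// -ge0_muleDl ?lee_fin// -EFinD (_ : 2 + 2 = 4 :> R)//; ring.
apply: (dint_hk_le s0 mf2 f20 (measurable2_energy s mf)) => x y; first exact: energy_kernel_ge0.
rewrite -mulrDr ler_wpM2l ?hk_ge0//.
by have := sqr_ge0 (f x + f y); rewrite sqrrD sqrrB; lra.
Qed.

Lemma energyD s f g : 0 < s -> measurable_fun [set: R] f -> measurable_fun [set: R] g ->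
  (energy s (fun x => f x + g x)%R <= (2:R)%:E * energy s f + (2:R)%:E * energy s g)%E.
Proof.
move=> s0 mf mg.
have ef := measurable2_energy s mf; have eg := measurable2_energy s mg.
have f0 x y := energy_kernel_ge0 f x y s0; have g0 x y := energy_kernel_ge0 g x y s0.
rewrite /energy -(dintZ (ler0n R 2) ef f0) -(dintZ (ler0n R 2) eg g0) -dintD; last 4 first.
- by apply: measurable_funM.
- by apply: measurable_funM.
- by move=> x y; rewrite mulr_ge0.
- by move=> x y; rewrite mulr_ge0.
apply: dint_le.
- by apply: measurable2_energy; exact: measurable_funD.
- by apply: measurable_funD; apply: measurable_funM.
- by move=> x y; exact: (energy_kernel_ge0 (fun x => f x + g x)).
- move=> x y; rewrite ![2 * (_ * _)]mulrCA -mulrDr ler_wpM2l ?hk_ge0//.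
  have := sqr_ge0 ((f x - f y) - (g x - g y)).
  have -> : f x + g x - (f y + g y) = (f x - f y) + (g x - g y) by ring.
  by rewrite sqrrB sqrrD; lra.
Qed.

Lemma energyZ s c f : 0 < s -> measurable_fun [set: R] f ->
  (energy s (fun x => c * f x)%R = (c ^+ 2)%:E * energy s f)%E.
Proof.
move=> s0 mf.
rewrite /energy -(dintZ (sqr_ge0 c) (measurable2_energy s mf) (fun x y => energy_kernel_ge0 f x y s0)).
by congr dint; apply/funext => x; apply/funext => y; rewrite -mulrBr exprMn mulrCA.
Qed.

Let sk (k : nat) : R := 16^-1 ^+ k.

Let sk0 k : 0 < sk k. Proof. by rewrite exprn_gt0. Qed.

Definition energy_vanishes f := forall e : R, 0 < e -> \forall k \near \oo, (energy (16^-1 ^+ k) f <= e%:E)%E.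

Lemma energy_vanishesD f g : measurable_fun [set: R] f -> measurable_fun [set: R] g ->
  energy_vanishes f -> energy_vanishes g -> energy_vanishes (fun x => f x + g x).
Proof.
move=> mf mg vf vg e e0; have e4 : 0 < e / 4 by rewrite divr_gt0.
apply: filterS2 (vf _ e4) (vg _ e4) => k ef eg.
apply: le_trans (energyD (sk0 k) mf mg) _.
apply: (@le_trans _ _ ((2:R)%:E * (e / 4)%:E + (2:R)%:E * (e / 4)%:E)%E).
  by apply: leeD; apply: lee_wpmul2l; rewrite ?lee_fin.
by rewrite -!EFinM -EFinD lee_fin; lra.
Qed.

Lemma energy_vanishesZ c f : measurable_fun [set: R] f -> energy_vanishes f -> energy_vanishes (fun x => c * f x).
Proof.
move=> mf vf e e0; have c1 : 0 < 1 + c ^+ 2 by rewrite ltr_pwDl ?sqr_ge0.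
apply: filterS (vf _ (divr_gt0 e0 c1)) => k ef; rewrite (energyZ _ (sk0 k) mf).
apply: (@le_trans _ _ ((c ^+ 2)%:E * (e / (1 + c ^+ 2))%:E)%E).
  by apply: lee_wpmul2l; rewrite ?lee_fin ?sqr_ge0.
rewrite -EFinM lee_fin mulrCA ler_piMr ?(ltW e0)// ler_pdivrMr// mul1r.
by rewrite lerDr.
Qed.

Lemma energy_vanishes_cst c : energy_vanishes (fun=> c).
Proof.
move=> e e0; apply: nearW => k; rewrite (_ : energy _ _ = 0%E) ?lee_fin ?ltW//.
apply: integral0_eq => x _; apply: integral0_eq => y _.
by rewrite subrr expr0n/= mulr0.
Qed.

Lemma energy_vanishes_sum N (F : 'I_N -> R -> R) : (forall i, measurable_fun [set: R] (F i)) ->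
  (forall i, energy_vanishes (F i)) -> energy_vanishes (fun x => \sum_(i < N) F i x).
Proof.
elim: N F => [|N IH] F mF vF.
  by under eq_fun do rewrite big_ord0; exact: energy_vanishes_cst.
under eq_fun do rewrite big_ord_recl; apply: energy_vanishesD => //.
  by apply: measurable_sum.
exact: IH.
Qed.

(** The energy is at most 4 times the squared norm at every scale, so vanishing passes to L^2
    limits; with the factor 2 from [energyD] the budget is 2 (e/4) + 2 (4 (e/16)) = e. *)
Lemma energy_vanishes_approx f : measurable_fun [set: R] f ->
  (forall e : R, 0 < e -> exists h, [/\ measurable_fun [set: R] h, energy_vanishes h & (nsq (fun x => f x - h x)%R <= e%:E)%E]) ->
  energy_vanishes f.
Proof.
move=> mf H e e0; have e16 : 0 < e / 16 by rewrite divr_gt0.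
have e4 : 0 < e / 4 by rewrite divr_gt0.
have [h [mh vh fh]] := H _ e16.
have mfh : measurable_fun [set: R] (fun x => f x - h x) by exact: measurable_funB.
apply: filterS (vh _ e4) => k eh.
rewrite (_ : f = fun x => h x + (f x - h x)); last by apply/funext => x; rewrite subrKC.
apply: le_trans (energyD (sk0 k) mh mfh) _.
apply: (@le_trans _ _ ((2:R)%:E * (e / 4)%:E + (2:R)%:E * ((4:R)%:E * (e / 16)%:E))%E).
  apply: leeD; apply: lee_wpmul2l; rewrite ?lee_fin//.
  by apply: le_trans (energy_le_nsq (sk0 k) mfh) _; apply: lee_wpmul2l; rewrite ?lee_fin.
by rewrite -!EFinM -EFinD lee_fin; lra.
Qed.

End approximate_identity.

(** * Vanishing energy for square integrable functions of bounded support *)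

Section density.
Variables (R : realType) (alpha : R).
Hypothesis Ha : - 2^-1 < alpha.
Local Notation nu := (mu_a alpha).
Local Notation hk := (hk alpha).
Local Notation energy_vanishes := (energy_vanishes alpha).
Local Notation nsq := (nsq alpha).
Local Notation energy := (energy alpha).
Implicit Types (s t x y : R) (f g h u v : R -> R).

Let pi0 : 0 < pi :> R. Proof. exact: pi_gt0. Qed.

Lemma mu_a_negative : nu (~` @Rplus R) = 0%E.
Proof. by rewrite -[LHS]/(mu_a alpha _) /mu_a setICl integral_set0. Qed.

(** The heat started at x that lands outside a ball of radius r: [hk_tail] gives exp(- q) with q =
    pi r^2 / (2 s), and exp(- q) <= 1 / q makes it linear in s. *)
Lemma escape_le (U : set R) s x (r : R) : measurable U -> 0 < s -> 0 <= x -> 0 < r ->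
  (forall y, `|x - y| < r -> U y) ->
  (\int[nu]_y (hk s x y * \1_(~` U) y)%:E <= (2 `^ (alpha + 1) * (2 / (pi * r ^+ 2)) * s)%:E)%E.
Proof.
move=> mU s0 x0 r0 HU; have s20 : 0 < 2 * s by rewrite mulr_gt0.
have c0 : 0 < pi * r ^+ 2 by rewrite mulr_gt0// exprn_gt0.
have p0 : 0 <= 2 `^ (alpha + 1) * (2 / (pi * r ^+ 2)) * s.
  by rewrite mulr_ge0 ?(ltW s0)// mulr_ge0 ?powR_ge0// divr_ge0// ltW.
have mUC : measurable_fun [set: R] (\1_(~` U) : R -> R).
  by apply: measurable_indic; exact: measurableC.
apply: (@le_trans _ _ (\int[nu]_y ((2 `^ (alpha + 1) * (2 / (pi * r ^+ 2)) * s)%:E * (hk (2 * s) x y)%:E))%E).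
  apply: le_integral_mu_a => //.
  - by apply/measurable_EFinP; apply: measurable_funM => //; exact: measurable_hk.
  - by apply: emeasurable_funM => //; apply/measurable_EFinP; exact: measurable_hk.
  - by move=> y; rewrite lee_fin mulr_ge0// hk_ge0.
  - by move=> y; rewrite -EFinM lee_fin mulr_ge0// hk_ge0.
  - move=> y y0; rewrite -EFinM lee_fin indicE; case: (boolP (y \in ~` U)) => yU; last first.
      by rewrite mulr0 mulr_ge0// hk_ge0.
    rewrite mulr1; apply: le_trans (hk_tail Ha s0 x0 y0) _.
    rewrite ler_wpM2r ?hk_ge0// -[leRHS]mulrA ler_wpM2l ?powR_ge0//.
    have rxy : r ^+ 2 <= (x - y) ^+ 2.
      have : r <= `|x - y| by rewrite leNgt; apply/negP => /HU; move: yU; rewrite inE.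
      by rewrite -(@ler_pXn2r _ 2) ?nnegrE ?(ltW r0)// real_normK// num_real.
    have q0 : 0 < pi * r ^+ 2 / (2 * s) by rewrite divr_gt0.
    apply: (@le_trans _ _ (pi * r ^+ 2 / (2 * s))^-1); last first.
      rewrite invf_div le_eqVlt; apply/orP; left; apply/eqP.
      by move: c0; move: (pi * r ^+ 2) => c c0; field; rewrite gt_eqF.
    rewrite expRN lef_pV2 ?posrE ?expR_gt0//.
    apply: (@le_trans _ _ (pi * (x - y) ^+ 2 / (2 * s))).
      by rewrite ler_pM2r ?invr_gt0// ler_pM2l.
    by apply: le_trans (expR_ge1Dx _); rewrite lerDr.
rewrite ge0_integralZl_EFin//.
- by rewrite integral_hk// mule1.
- by move=> y _; rewrite lee_fin hk_ge0.
- by apply/measurable_EFinP; exact: measurable_hk.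
Qed.

Let cvg_sk (c : R) : (fun k : nat => (c * 16^-1 ^+ k)%:E) @ \oo --> (0%R : R)%:E.
Proof.
apply: cvg_EFin; first exact: nearW.
rewrite -[X in _ --> X](mulr0 c); apply: cvgMr; apply: cvg_expr.
by rewrite ger0_norm ?invr_ge0// invf_lt1// ltr1n.
Qed.

Lemma energy_vanishes_open (U : set R) : open U -> (nu U < +oo)%E -> energy_vanishes (\1_U).
Proof.
move=> oU Ufin; have mU : measurable U by exact: open_measurable.
have mI : measurable_fun [set: R] (\1_U : R -> R) by exact: measurable_indic.
have mC : measurable_fun [set: R] (\1_(~` U) : R -> R).
  by apply: measurable_indic; exact: measurableC.
pose F k x y := hk (16^-1 ^+ k) x y * \1_(~` U) y : R.
have sk0 k : 0 < 16^-1 ^+ k :> R by rewrite exprn_gt0.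
have F0 k x y : 0 <= F k x y by rewrite mulr_ge0// hk_ge0.
have mF k : measurable2 (F k).
  by apply: measurable_funM; [exact: measurable2_hk|exact: (measurable2r mC)].
pose G k x y := \1_U x * F k x y.
have G0 k x y : 0 <= G k x y by rewrite mulr_ge0.
have mG k : measurable2 (G k) by apply: measurable_funM; [exact: (measurable2l mI)|exact: (mF k)].
have GE k x : (\int[nu]_y (G k x y)%:E = (\1_U x)%:E * \int[nu]_y (F k x y)%:E)%E.
  rewrite -ge0_integralZl_EFin//; first by move=> y _; rewrite lee_fin.
  exact: measurable2_row.
(* The difference of indicators is nonzero exactly when one of the two points is in U and the other
   is not, so by symmetry the energy is twice the heat that leaves U. *)
have eE k : (energy (16^-1 ^+ k) \1_U = dint alpha (G k) + dint alpha (G k))%E.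
  have mGs : measurable2 (fun x y => G k y x).
    apply: measurable_funM; first exact: (measurable2r mI).
    apply: measurable_funM; last exact: (measurable2l mC).
    by under eq_fun do rewrite hkC; exact: measurable_hk2.
  have e1 : dint alpha (G k) = dint alpha (fun x y => G k y x) by exact: dint_swap (mG k) (G0 k).
  rewrite [X in (_ + X)%E]e1 -(dintD alpha (mG k) mGs (G0 k) (fun x y => G0 k y x)).
  congr dint; apply/funext => x; apply/funext => y.
  rewrite /G /F (hkC _ _ y x) !indicE !in_setC.
  by case: (x \in U); case: (y \in U) => /=; ring.
suff cG : dint alpha (G k) @[k --> \oo] --> (0%R : R)%:E.
  move=> e e0; have e2 : 0 < e / 2 by rewrite divr_gt0.
  move/fine_cvgP: cG => [fin cG].
  apply: filterS2 fin (@cvgr_le _ _ _ _ _ _ cG _ e2) => k /= fin le.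
  rewrite eE -(fineK fin) -EFinD lee_fin; lra.
have FK k x : (\int[nu]_y (F k x y)%:E <= 1)%E.
  rewrite -(integral_hk Ha x (sk0 k)); apply: ge0_le_integral => //.
  - by move=> y _; rewrite lee_fin.
  - exact: measurable2_row.
  - by apply/measurable_EFinP; exact: measurable_hk.
  - by move=> y _; rewrite lee_fin /F ler_piMr ?hk_ge0// indicE; case: (_ \in _).
have [] := @dominated_convergence _ _ R nu setT measurableT (fun k x => \int[nu]_y (G k x y)%:E)%E
  (fun=> 0%E) (fun x => (\1_U x)%:E).
- by move=> k; exact: measurable_inner.
- exact: measurable_cst.
(* The escape bound is available for x >= 0 only; the negative numbers form the exceptional null
   set. *)
- exists (~` @Rplus R); split.
  + by apply: measurableC; exact: measurable_Rplus.
  + exact: mu_a_negative.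
  + move=> x /=; apply: contra_notP => /contrapT; rewrite /Rplus /= in_itv/= andbT => x0 _.
    have [xU|xU] := boolP (x \in U); last first.
      rewrite (_ : (fun k => _) = fun=> 0%E); first exact: cvg_cst.
      by apply/funext => k; rewrite GE indicE (negbTE xU) mul0e.
    rewrite inE in xU.
    have /nbhs_ballP[r /= r0 rU] : nbhs x U by apply: open_nbhs_nbhs.
    have hU y : `|x - y| < r -> U y by move=> h; exact: rU.
    apply: (@squeeze_cvge _ _ _ _ (fun=> (0%R : R)%:E) _ (fun k => ((2 `^ (alpha + 1) * (2 / (pi * r ^+ 2))) * 16^-1 ^+ k)%:E)).
    * apply: nearW => k; rewrite GE indicE mem_set// mul1e.
      by apply/andP; split; [exact: inner_ge0|exact: escape_le].
    * exact: cvg_cst.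
    * exact: cvg_sk.
- apply/integrableP; split; first by apply/measurable_EFinP.
  rewrite (_ : (\int[nu]_x _)%E = nu U)//.
  rewrite -[RHS]/(nu U) -[in RHS](setIT U) -integral_indic//.
  by apply: eq_integral => x _; rewrite /= ger0_norm.
- apply: aeW => x k _.
  rewrite gee0_abs; last exact: inner_ge0.
  by rewrite GE -[X in (_ <= X)%E]mule1 lee_wpmul2l ?lee_fin.
- move=> _ _; rewrite integral0; exact: id.
Qed.

Lemma nsq_indic (A : set R) : measurable A -> nsq \1_A = nu A.
Proof.
move=> mA; rewrite -[RHS]/(nu A) -[in RHS](setIT A) -integral_indic//; apply: eq_integral => x _.
by rewrite indicE; case: (_ \in _); rewrite ?expr1n ?expr0n.
Qed.

Lemma mu_a_le_lebesgue (A : set R) (b : R) : measurable A -> 0 <= b -> A `<=` `]-oo, b[%classic ->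
  (nu A <= (wdens alpha b)%:E * lebesgue_measure A)%E.
Proof.
move=> mA b0 Ab; rewrite -[X in (X <= _)%E]/(mu_a alpha A) /mu_a.
have h0 : 0 <= 2 * alpha + 1 by move: Ha; lra.
have mAR : measurable (A `&` @Rplus R) by apply: measurableI => //; exact: measurable_Rplus.
apply: (@le_trans _ _ (\int[lebesgue_measure]_(x in A `&` @Rplus R) (wdens alpha b)%:E)%E).
  apply: ge0_le_integral => //.
  - by move=> x _; rewrite lee_fin wdens_ge0.
  - by apply/measurable_EFinP; exact: measurable_wdens.
  - move=> x [/Ab]; rewrite /Rplus /= !in_itv/= andbT => xb x0.
    by rewrite lee_fin /wdens ler_wpM2l ?powR_ge0// ge0_ler_powR// ?nnegrE// ltW.
rewrite integral_cst//; apply: lee_wpmul2l; first by rewrite lee_fin wdens_ge0.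
by apply: le_measure; rewrite ?inE//; exact: subIsetl.
Qed.

(** Open sets come first because each of their points has a ball around it inside the set; outer
    regularity of Lebesgue measure then reaches measurable sets. *)
Lemma energy_vanishes_indic (A : set R) (b : R) : measurable A -> A `<=` `[0, b]%classic -> energy_vanishes (\1_A).
Proof.
move=> mA Ab; have [b0|b0] := ltP b 0.
  have -> : \1_A = (fun=> 0) :> (R -> R); last exact: energy_vanishes_cst.
  apply/funext => x; rewrite indicE memNset// => /Ab; rewrite /= in_itv/= => /andP[h1 h2].
  by have := lt_le_trans b0 (le_trans h1 h2); rewrite ltxx.
apply: energy_vanishes_approx => // e e0; pose W := wdens alpha (b + 1) + 1.
have W0 : 0 < W by rewrite ltr_wpDl ?wdens_ge0.
have Afin : (lebesgue_measure A < +oo)%E.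
  apply: (@le_lt_trans _ _ (lebesgue_measure `[0, b]%classic)).
    by apply: le_measure; rewrite ?inE//; exact: measurable_itv.
  by rewrite lebesgue_measure_itv/=; case: ifP => _; rewrite -?EFinB ltry.
have [V [oV AV mVA]] := lebesgue_regularity_outer mA Afin (divr_gt0 e0 W0).
(* Cutting V down to a bounded interval bounds the weight by [W], so that a small Lebesgue measure
   of U minus A gives a small mu_a mass. The interval is open and contains [0, b]. *)
pose U := V `&` `](-1), (b + 1)[%classic.
have oU : open U by apply: openI => //; exact: interval_open.
have mU : measurable U by exact: open_measurable.
have AU : A `<=` U.
  move=> x Ax; split; first exact: AV.
  by have := Ab _ Ax; rewrite /= !in_itv/= => /andP[h1 h2]; apply/andP; split; lra.
exists (\1_U); split; first exact: measurable_indic.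
  apply: energy_vanishes_open => //; apply: le_lt_trans (mu_a_itv_lty Ha (-1) (b + 1)).
  apply: le_measure; rewrite ?inE//.
  by move=> x [_]; rewrite /= !in_itv/= => /andP[/ltW -> /ltW ->].
have -> : nsq (fun x => \1_A x - \1_U x) = nu (U `\` A).
  rewrite -nsq_indic; last exact: measurableD.
  apply: eq_integral => x _; rewrite !indicE in_setD.
  have [xA|xA] := boolP (x \in A).
    by rewrite (_ : x \in U)/= ?subrr ?andbF ?expr0n//; rewrite !inE in xA *; exact: AU.
  by rewrite andbT sub0r sqrrN.
apply: (@le_trans _ _ ((wdens alpha (b + 1))%:E * lebesgue_measure (U `\` A))%E).
  apply: mu_a_le_lebesgue; [exact: measurableD|by rewrite addr_ge0|].
  by move=> x [[_]]; rewrite /= !in_itv/= => /andP[_ ->].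
apply: (@le_trans _ _ (W%:E * (e / W)%:E)%E); last first.
  by rewrite -EFinM lee_fin mulrCA divff ?mulr1// gt_eqF.
apply: lee_pmul => //; first by rewrite lee_fin wdens_ge0.
  by rewrite lee_fin /W lerDl.
apply: le_trans (ltW mVA); apply: le_measure; rewrite ?inE.
- exact: measurableD.
- by apply: measurableD => //; exact: open_measurable.
- by move=> x [[Vx _] Ax].
Qed.

Import HBNNSimple.

Lemma energy_vanishes_nnsfun (h : {nnsfun R >-> R}) (b : R) :
  (forall x, ~ `[0, b]%classic x -> h x = 0) -> energy_vanishes h.
Proof.
have mr (r : R) : measurable (h @^-1` [set r]) by [].
move=> hb; rewrite (funext (fimfunEord h)).
apply: (energy_vanishes_sum Ha) => i; first by apply: measurable_funM => //; exact: measurable_indic.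
move: (_`_i) => r.
have [->|r0] := eqVneq r 0.
  by under eq_fun do rewrite mul0r; exact: energy_vanishes_cst.
apply: energy_vanishesZ => //.
apply: (energy_vanishes_indic (b := b)) => // x /= hx; apply: contrapT => /hb; rewrite hx => re.
by rewrite re eqxx in r0.
Qed.

(** Simple functions increasing to f stay below f, hence keep its support, and they converge in L^2
    by domination by f^2. *)
Lemma energy_vanishes_ge0 f (b : R) : measurable_fun [set: R] f -> (forall x, 0 <= f x) ->
  (forall x, ~ `[0, b]%classic x -> f x = 0) -> (nsq f < +oo)%E -> energy_vanishes f.
Proof.
move=> mf f0 fb ffin; have mEf : measurable_fun [set: R] (EFin \o f) by apply/measurable_EFinP.
pose h := nnsfun_approx (@measurableT _ _) mEf.
have hf x : (EFin \o h^~ x) @ \oo --> (f x)%:E.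
  by apply: (cvg_nnsfun_approx (@measurableT _ _) mEf) => // z _; rewrite lee_fin.
have hle k x : h k x <= f x.
  have nd : nondecreasing_seq (fun k => (h k x)%:E).
    by move=> m n mn; rewrite lee_fin; exact/lefP/nd_nnsfun_approx.
  have := ereal_nondecreasing_cvgn nd => /cvg_unique/(_ (hf x)) E.
  rewrite -lee_fin -E//; apply: ereal_sup_ubound; by exists k.
have h0 k x : 0 <= h k x by exact: fun_ge0.
apply: energy_vanishes_approx => // e e0.
have : (fun k => \int[nu]_x ((f x - h k x) ^+ 2)%:E)%E @ \oo --> (0%R : R)%:E.
  have [] := @dominated_convergence _ _ R nu setT measurableT (fun k x => ((f x - h k x) ^+ 2)%:E)%E
    (fun=> 0%E) (fun x => (f x ^+ 2)%:E).
  - move=> k; apply/measurable_EFinP; apply: measurable_funX; exact: measurable_funB.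
  - exact: measurable_cst.
  - apply: aeW => x _.
    apply: cvg_EFin; first exact: nearW.
    rewrite -[X in _ --> X](_ : (f x - f x) ^+ 2 = 0); last by rewrite subrr expr0n.
    rewrite expr2; under [X in X @ _ --> _]eq_fun do rewrite expr2.
    have hfx : (fun k => h k x) @ \oo --> f x by move/fine_cvgP: (hf x) => [].
    by apply: cvgM; apply: cvgB => //; exact: cvg_cst.
  - apply/integrableP; split; first by apply/measurable_EFinP; exact: measurable_funX.
    by under eq_integral do rewrite /= ger0_norm ?sqr_ge0//.
  - apply: aeW => x k _.
    rewrite /= ger0_norm ?sqr_ge0// lee_fin lerXn2r ?nnegrE ?subr_ge0//.
    by rewrite lerBlDr lerDl.
  - by move=> _ _; rewrite integral0; exact: id.
move=> /fine_cvgP[fin cv].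
have [k _ /(_ k (leqnn k)) [kfin kle]] := filterI fin (@cvgr_le _ _ _ _ _ _ cv _ e0).
exists (h k); split => //.
  apply: (energy_vanishes_nnsfun (b := b)) => x /fb fx.
  by apply/eqP; rewrite eq_le h0 andbT -fx.
by rewrite /nsq -(fineK kfin) lee_fin.
Qed.

Lemma nsq_le f g : measurable_fun [set: R] f -> measurable_fun [set: R] g ->
  (forall x, f x ^+ 2 <= g x ^+ 2) -> (nsq f <= nsq g)%E.
Proof.
move=> mf mg fg; apply: ge0_le_integral => //.
- by move=> x _; rewrite lee_fin sqr_ge0.
- by apply/measurable_EFinP; exact: measurable_funX.
- by apply/measurable_EFinP; exact: measurable_funX.
- by move=> x _; rewrite lee_fin.
Qed.

Lemma energy_vanishes_compact f (b : R) : measurable_fun [set: R] f ->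
  (forall x, ~ `[0, b]%classic x -> f x = 0) -> (nsq f < +oo)%E -> energy_vanishes f.
Proof.
move=> mf fb ffin; pose p x := Num.max (f x) 0; pose q x := Num.max (- f x) 0.
have mp : measurable_fun [set: R] p by exact: measurable_maxr.
have mq : measurable_fun [set: R] q by apply: measurable_maxr => //; exact: measurableT_comp.
rewrite (_ : f = fun x => p x + (-1) * q x); last first.
  by apply/funext => x; rewrite /p /q !maxEle oppr_le0; case: (leP (f x) 0) => h;
    case: (leP 0 (f x)) => h'; lra.
apply: energy_vanishesD => //; first by apply: measurable_funM.
  apply: (energy_vanishes_ge0 (b := b)) => //.
  - by move=> x; rewrite /p le_max lexx orbT.
  - by move=> x /fb fx; rewrite /p fx maxxx.
  - apply: le_lt_trans ffin; apply: nsq_le => // x.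
    by rewrite /p maxEle; case: ifP => _//; rewrite expr0n sqr_ge0.
apply: energy_vanishesZ => //; apply: (energy_vanishes_ge0 (b := b)) => //.
- by move=> x; rewrite /q le_max lexx orbT.
- by move=> x /fb fx; rewrite /q fx oppr0 maxxx.
- apply: le_lt_trans ffin; apply: nsq_le => // x.
  by rewrite /q maxEle; case: ifP => _//; rewrite ?sqrrN ?expr0n ?sqr_ge0.
Qed.

End density.

(** * Telescoping and Schur's test *)
Section telescoping.
Variables (R : realType) (alpha : R).
Hypothesis Ha : - 2^-1 < alpha.
Local Notation nu := (mu_a alpha).
Local Notation hk := (hk alpha).
Local Notation nsq := (nsq alpha).
Local Notation dint := (dint alpha).
Local Notation FB := (FB alpha).
Local Notation heat := (heat alpha).
Local Notation hform := (hform alpha).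
Local Notation integ f := (nu.-integrable [set: R] (EFin \o f)).
Implicit Types (s t x y : R) (f g h u v w : R -> R).

Let pi0 : 0 < pi :> R. Proof. exact: pi_gt0. Qed.

(** As [fine] sends infinite values to 0, a real-valued integral is bounded by the integral of the
    modulus even where the latter diverges. *)
Lemma abse_fine_le (X : \bar R) : (`|(fine X)%:E| <= `|X|)%E.
Proof. by case: X => [r| |]//=; rewrite ?normr0 leey. Qed.

Lemma measurable_heat t f : measurable_fun [set: R] f -> measurable_fun [set: R] (heat t f).
Proof.
move=> mf; apply: (@measurable_Rintegral R alpha (fun z : R * R => hk t z.1 z.2 * f z.2)).
by apply: measurable_funM; [exact: measurable_hk2|exact: measurableT_comp].
Qed.

Lemma form_kernel_ge0 (a : R) t f x y : 0 <= a -> 0 < t -> 0 <= a * hk t x y * (`|f x| * `|f y|).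
Proof.
by move=> a0 t0; apply: mulr_ge0; [apply: mulr_ge0 => //; exact: hk_ge0|exact: mulr_ge0].
Qed.

Lemma measurable2_abs f : measurable_fun [set: R] f -> measurable2 (fun x y => `|f x| * `|f y|).
Proof.
move=> mf; apply: measurable_funM; apply: measurableT_comp => //.
  exact: (measurable2l mf).
exact: (measurable2r mf).
Qed.

Definition wform w t f : R := \int[nu]_x (w x * f x * heat t f x).

Lemma wform_le w t f : measurable_fun [set: R] w -> measurable_fun [set: R] f -> 0 < t ->
  (forall x, 0 <= w x) ->
  (`|wform w t f|%:E <= dint (fun x y => w x * hk t x y * (`|f x| * `|f y|))%R)%E.
Proof.
move=> mw mf t0 w0; have mh := measurable_heat t mf.
have mwf : measurable_fun [set: R] (fun x => w x * f x) by exact: measurable_funM.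
apply: le_trans (abse_fine_le _) _; apply: le_trans (le_abse_integral _ _ _) _ => //.
  by apply/measurable_EFinP; exact: measurable_funM.
have mF : measurable2 (fun x y => w x * hk t x y * (`|f x| * `|f y|)).
  apply: measurable_funM; first by apply: measurable_funM; [exact: (measurable2l mw)|exact: measurable2_hk].
  exact: measurable2_abs.
have F0 x y : 0 <= w x * hk t x y * (`|f x| * `|f y|) by exact: form_kernel_ge0.
apply: ge0_le_integral => //.
- by apply/measurable_EFinP; apply: measurableT_comp => //; exact: measurable_funM.
- exact: measurable_inner.
- move=> x _; rewrite abse_EFin normrM EFinM.
  apply: (@le_trans _ _ (`|w x * f x|%:E * \int[nu]_y (hk t x y * `|f y|)%:E)%E).
    rewrite lee_wpmul2l ?lee_fin//; apply: le_trans (abse_fine_le _) _.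
    have mk : measurable_fun [set: R] (fun y => hk t x y * f y).
      by apply: measurable_funM => //; exact: measurable_hk.
    apply: le_trans (le_abse_integral _ _ _) _ => //; first by apply/measurable_EFinP.
    rewrite le_eqVlt; apply/orP; left; apply/eqP; apply: eq_integral => y _.
    by rewrite /= normrM ger0_norm// hk_ge0.
  rewrite -ge0_integralZl_EFin//.
  + rewrite le_eqVlt; apply/orP; left; apply/eqP; apply: eq_integral => y _.
    by rewrite -EFinM normrM (ger0_norm (w0 x)); congr EFin; ring.
  + by move=> y _; rewrite lee_fin mulr_ge0// hk_ge0.
  + apply/measurable_EFinP; apply: measurable_funM; first exact: measurable_hk.
    exact: measurableT_comp.
Qed.

Lemma dint_hk_le_nsq s f : 0 < s -> measurable_fun [set: R] f ->
  (dint (fun x y => hk s x y * (`|f x| * `|f y|))%R <= nsq f)%E.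
Proof.
move=> s0 mf; have mf2 : measurable_fun [set: R] (fun x => 2^-1 * f x ^+ 2).
  by apply: measurable_funM => //; exact: measurable_funX.
have f20 x : 0 <= 2^-1 * f x ^+ 2 by rewrite mulr_ge0 ?sqr_ge0.
have -> : (nsq f = \int[nu]_x (2^-1 * f x ^+ 2)%:E + \int[nu]_x (2^-1 * f x ^+ 2)%:E)%E.
  rewrite integral_sqrZ// -ge0_muleDl ?lee_fin// -EFinD (_ : 2^-1 + 2^-1 = 1 :> R) ?mul1e//.
  by field.
apply: (dint_hk_le Ha s0 mf2 f20) => [|x y|x y].
- by apply: measurable_funM; [exact: measurable2_hk|exact: measurable2_abs].
- by apply: mulr_ge0; [exact: hk_ge0|exact: mulr_ge0].
- rewrite -mulrDr ler_wpM2l ?hk_ge0//.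
  rewrite -(real_normK (num_real (f x))) -(real_normK (num_real (f y))).
  by have := sqr_ge0 (`|f x| - `|f y|); rewrite sqrrB; lra.
Qed.

Lemma heat_bounded t f : 0 < t -> integ f ->
  exists M, forall x, `|heat t f x| <= M.
Proof.
move=> t0 fi; exists (jmax alpha * \int[nu]_x `|gss t x * FB f x|) => x.
by rewrite -FB_gss_FB//; apply: FB_bound => //; exact: integrable_gss_FB.
Qed.

Lemma heat_FB_bounded t f : 0 < t -> integ f ->
  exists M, forall x, `|heat t (FB f) x| <= M.
Proof.
move=> t0 fi; exists (jmax alpha * \int[nu]_x `|gss t x * f x|) => x.
by rewrite heat_FB//; apply: FB_bound => //; exact: integrable_gss_mul (ltW t0) fi.
Qed.

Lemma integrable_sqr f : measurable_fun [set: R] f -> (nsq f < +oo)%E -> integ (fun x => f x ^+ 2).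
Proof.
move=> mf ffin; apply/integrableP; split; first by apply/measurable_EFinP; exact: measurable_funX.
by under eq_integral do rewrite /= ger0_norm ?sqr_ge0//.
Qed.

(** By [heat_plancherel] the Gaussian-weighted norm of the transform is a form of a symmetric kernel
    of mass 1, hence at most the squared norm of f; monotone convergence removes the Gaussian. *)
Lemma nsq_FB_le f : integ f -> (nsq (FB f) <= nsq f)%E.
Proof.
move=> fi; have mf := integrable_measurable fi.
have mg := measurable_FB Ha mf.
pose s k : R := 16^-1 ^+ k; have s0 k : 0 < s k by rewrite exprn_gt0.
pose G k x := (gss (s k) x * FB f x ^+ 2)%:E.
have mG k : measurable_fun [set: R] (G k).
  by apply/measurable_EFinP; apply: measurable_funM; [exact: measurable_gss|exact: measurable_funX].
have G0 k x : (0 <= G k x)%E by rewrite lee_fin mulr_ge0 ?sqr_ge0// ltW// gss_gt0.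
have Gle k : (\int[nu]_x G k x <= nsq f)%E.
  have Gi : integ (fun x => gss (s k) x * FB f x ^+ 2).
    rewrite (_ : (fun x => _) = fun x => gss (s k) x * FB f x * FB f x); last first.
      by apply/funext => x; rewrite expr2 mulrA.
    by apply: (integrable_mul_bounded (integrable_gss_FB Ha (s0 k) fi) mg) => x; exact: FB_bound.
  rewrite -(EFin_Rintegral Gi) heat_plancherel//.
  apply: (@le_trans _ _ (`|wform (fun=> 1) (s k) f|%:E)).
    rewrite lee_fin /wform; under [in leRHS]eq_Rintegral do rewrite mul1r.
    exact: ler_norm.
  apply: le_trans (wform_le _ mf (s0 k) _) _ => //.
  under eq_fun do under eq_fun do rewrite mul1r.
  exact: dint_hk_le_nsq.
have cG : (fun k => \int[nu]_x G k x)%E @ \oo --> nsq (FB f).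
  rewrite (_ : nsq (FB f) = \int[nu]_x (fun x => (FB f x ^+ 2)%:E) x)%E//.
  have E x : (FB f x ^+ 2)%:E = limn (G ^~ x).
    apply/esym/cvg_lim => //; apply: cvg_EFin; first exact: nearW.
    rewrite /comp /G /= -[X in _ --> X]mul1r; apply: cvgMl.
    rewrite -[X in _ --> X]expR0; apply: continuous_cvg; first exact: continuous_expR.
    rewrite -[X in _ --> X]oppr0; apply: cvgN.
    rewrite (_ : (fun k => _) = fun k => pi * x ^+ 2 * 16^-1 ^+ k); last by apply/funext => k; rewrite /s; ring.
    rewrite -[X in _ --> X](mulr0 (pi * x ^+ 2)); apply: cvgMr; apply: cvg_expr.
    by rewrite ger0_norm ?invr_ge0// invf_lt1// ltr1n.
  under [X in _ --> X]eq_integral do rewrite E.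
  apply: cvg_monotone_convergence => // x _ m n mn.
  rewrite lee_fin ler_wpM2r ?sqr_ge0// ler_expR lerN2 ler_wpM2r ?sqr_ge0// ler_wpM2l ?(ltW pi0)//.
  by rewrite /s ler_wiXn2l ?invr_ge0// invf_le1// ler1n.
rewrite -(cvg_lim _ cG)//; apply: lime_le; first by apply/cvg_ex; eexists; exact: cG.
by apply: nearW.
Qed.

Definition Qform s f : \bar R := dint (fun x y => dgs s x * hk (16 * s) x y * (`|f x| * `|f y|)).

Let K4 : R := (2 `^ (alpha + 1)) ^+ 4.

Let K40 : 0 <= K4. Proof. by rewrite exprn_ge0// powR_ge0. Qed.

Lemma measurable2_Qform s f : measurable_fun [set: R] f ->
  measurable2 (fun x y => dgs s x * hk (16 * s) x y * (`|f x| * `|f y|)).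
Proof.
move=> mf; apply: measurable_funM.
  by apply: measurable_funM; [exact: (measurable2l (measurable_dgs s))|exact: measurable2_hk].
exact: measurable2_abs.
Qed.

Lemma Qform_kernel_ge0 s f x y : 0 < s -> 0 <= dgs s x * hk (16 * s) x y * (`|f x| * `|f y|).
Proof.
by move=> s0; apply: form_kernel_ge0; [exact: dgs_ge0 (ltW s0)|exact: mulr_gt0].
Qed.

Lemma hk_mono16_abs s x y : 0 < s -> hk s x y <= K4 * hk (16 * s) x y.
Proof.
by move=> s0; rewrite -(hk_abs _ s x y) -(hk_abs _ (16 * s) x y) hk_mono16.
Qed.

(** The increment in f carries the heat kernel at time s, the one in the transform at time 16 s.
    Four doublings of time, at the price [K4], bring the first to the kernel of [Qform]. *)
Lemma wform_dgs_le s f : 0 < s -> measurable_fun [set: R] f ->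
  (`|wform (dgs s) s f|%:E <= K4%:E * Qform s f)%E.
Proof.
move=> s0 mf; have d0 x : 0 <= dgs s x by apply: dgs_ge0; exact: ltW.
apply: le_trans (wform_le (measurable_dgs s) mf s0 d0) _.
rewrite -(dintZ alpha K40 (measurable2_Qform s mf) (fun x y => Qform_kernel_ge0 f x y s0)).
apply: dint_le.
- apply: measurable_funM; first by apply: measurable_funM; [exact: (measurable2l (measurable_dgs s))|exact: measurable2_hk].
  exact: measurable2_abs.
- by apply: measurable_funM => //; exact: measurable2_Qform.
- by move=> x y; exact: form_kernel_ge0.
- move=> x y; rewrite [leRHS]mulrA; apply: ler_wpM2r; first exact: mulr_ge0.
  by rewrite [leRHS]mulrCA; apply: ler_wpM2l => //; exact: hk_mono16_abs.
Qed.

Lemma wform_dgs_le16 s f : 0 < s -> measurable_fun [set: R] f ->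
  (`|wform (dgs s) (16 * s) f|%:E <= Qform s f)%E.
Proof.
move=> s0 mf; apply: wform_le => //; first exact: measurable_dgs; first by rewrite mulr_gt0.
by move=> x; apply: dgs_ge0; exact: ltW.
Qed.

(* The scale of the Gaussian changes first; the scale of the heat kernel becomes
   the scale of the Gaussian for [FB f]. *)
Lemma hform_step s f : 0 < s -> integ f ->
  hform s s f = hform (16 * s) (16 * s) f + wform (dgs s) s f + wform (dgs s) (16 * s) (FB f).
Proof.
move=> s0 fi; have s160 : 0 < 16 * s by rewrite mulr_gt0.
have mf := integrable_measurable fi.
have [M1 hM1] := heat_bounded s0 fi; have [M2 hM2] := heat_FB_bounded s160 fi.
have i1 r : 0 < r -> integ (fun x => gss r x * f x * heat s f x).
  move=> r0; apply: integrable_mul_bounded hM1; last exact: measurable_heat.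
  exact: integrable_gss_mul (ltW r0) fi.
have i2 r : 0 < r -> integ (fun x => gss r x * FB f x * heat (16 * s) (FB f) x).
  move=> r0; apply: integrable_mul_bounded hM2; first exact: integrable_gss_FB.
  by apply: measurable_heat; exact: (measurable_FB Ha mf).
have e1 : wform (dgs s) s f = hform s s f - hform (16 * s) s f.
  rewrite /hform -RintegralB//; [|exact: i1|exact: i1].
  by apply: eq_Rintegral => x _; rewrite /dgs; ring.
have e2 : wform (dgs s) (16 * s) (FB f) = hform s (16 * s) (FB f) - hform (16 * s) (16 * s) (FB f).
  rewrite /hform -RintegralB//; [|exact: i2|exact: i2].
  by apply: eq_Rintegral => x _; rewrite /dgs; ring.
have alg (a b c d e w1 w2 : R) : w1 = a - b -> w2 = c - d -> b = c -> e = d -> a = e + w1 + w2.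
  by move=> -> -> -> ->; ring.
exact: alg e1 e2 (hform_FB Ha s160 s0 fi) (hform_FB Ha s160 s160 fi).
Qed.

Lemma hform_telescope s f N : 0 < s -> integ f ->
  ((hform s s f)%:E <= (hform (16 ^+ N * s) (16 ^+ N * s) f)%:E +
    (K4%:E * (\sum_(i < N) Qform (16 ^+ i * s) f) + \sum_(i < N) Qform (16 ^+ i * s) (FB f)))%E.
Proof.
move=> s0 fi; have mf := integrable_measurable fi; have mg := measurable_FB Ha mf.
have Q0 r h : 0 < r -> (0 <= Qform r h)%E.
  move=> r0; apply: integral_ge0 => x _; apply: integral_ge0 => y _.
  by rewrite lee_fin; exact: Qform_kernel_ge0.
elim: N => [|N IH].
  by rewrite expr0 mul1r !big_ord0 mule0 !adde0.
have u0 : 0 < 16 ^+ N * s by rewrite mulr_gt0// exprn_gt0.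
apply: (le_trans IH); rewrite !big_ord_recr/=.
have S0 h : (0 <= \sum_(i < N) Qform (16 ^+ i * s) h)%E.
  by apply: sume_ge0 => i _; rewrite Q0// mulr_gt0// exprn_gt0.
rewrite ge0_muleDr ?Q0// (hform_step u0 fi) exprS -mulrA.
set u := 16 ^+ N * s; set A := (_ * \sum_(i < N) _)%E; set B := (\sum_(i < N) _)%E.
rewrite (addeACA A _ B) [X in (_ <= _ + X)%E]addeC addeA leeD2r//.
rewrite -addrA EFinD leeD2l// EFinD; apply: leeD.
  by apply: le_trans (wform_dgs_le u0 mf); rewrite lee_fin ler_norm.
by apply: le_trans (wform_dgs_le16 u0 mg); rewrite lee_fin ler_norm.
Qed.

(** For integrable f the uniform bound s^(- (alpha + 1)) on the kernel gives decay; since s >= 1 it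
    is weakened to s^(-1/2), a power that does not depend on alpha. *)
Lemma hform_le_power s f : 1 <= s -> integ f ->
  `|hform s s f| <= (2 `^ (- alpha)) ^+ 2 * bes alpha 0 * gmass alpha pi * (\int[nu]_x `|f x|) ^+ 2 / Num.sqrt s.
Proof.
move=> s1 fi; have s0 : 0 < s by exact: lt_le_trans s1.
have mf := integrable_measurable fi.
have mnf : measurable_fun [set: R] (fun x => `|f x|) by exact: measurableT_comp.
have nfi : integ (fun x => `|f x|) by exact: integrable_norm.
set C := _ * gmass alpha pi; set L := Rintegral _ _ _.
have C0 : 0 <= C.
  by rewrite !mulr_ge0 ?exprn_ge0 ?powR_ge0// ltW// ?gmass_gt0// bes_gt0//; move: Ha; lra.
have q0 : 0 < Num.sqrt s by rewrite sqrtr_gt0.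
have kb x y : hk s x y <= C / Num.sqrt s.
  rewrite -hk_abs; apply: le_trans (hk_ubound Ha s0 (normr_ge0 x) (normr_ge0 y)) _.
  rewrite ler_wpM2l// powRN lef_pV2 ?posrE ?powR_gt0// -powR12_sqrt ?(ltW s0)//.
  by rewrite ler_powR//; move: Ha; lra.
rewrite -lee_fin; apply: (@le_trans _ _ (dint (fun x y => C / Num.sqrt s * (`|f x| * `|f y|)))).
  apply: le_trans (wform_le (measurable_gss s) mf s0 (fun x => ltW (gss_gt0 s x))) _.
  apply: dint_le.
  - apply: measurable_funM; first by apply: measurable_funM; [exact: (measurable2l (measurable_gss s))|exact: measurable2_hk].
    exact: measurable2_abs.
  - apply: measurable_funM => //.
    exact: measurable2_abs.
  - by move=> x y; apply: form_kernel_ge0 => //; exact: ltW (gss_gt0 s x).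
  - move=> x y; rewrite ler_wpM2r ?mulr_ge0//; apply: le_trans (kb x y).
    by rewrite ler_piMl ?hk_ge0// gss_le1// ltW.
rewrite dintZ.
- have -> : dint (fun x y => `|f x| * `|f y|) = (L%:E * L%:E)%E.
    rewrite /dint /L (EFin_Rintegral nfi) -[X in (_ = X * _)%E](EFin_Rintegral nfi) -/L.
    rewrite muleC -ge0_integralZr//; last 2 first.
    + by apply/measurable_EFinP.
    + by rewrite lee_fin Rintegral_ge0.
    apply: eq_integral => x _.
    rewrite /L (EFin_Rintegral nfi) -ge0_integralZl_EFin//.
    by apply/measurable_EFinP.
  by rewrite -!EFinM lee_fin expr2 mulrAC.
- by rewrite divr_ge0// ltW.
- exact: measurable2_abs.
- by move=> x y; rewrite mulr_ge0.
Qed.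

End telescoping.

(** * Schur's test summed over the scales *)

Section schur.
Variables (R : realType) (alpha : R).
Hypothesis Ha : - 2^-1 < alpha.
Local Notation nu := (mu_a alpha).
Local Notation hk := (hk alpha).
Local Notation nsq := (nsq alpha).
Local Notation dint := (dint alpha).
Local Notation Qform := (Qform alpha).
Local Notation hcol := (hcol alpha).
Local Notation hcolK := (hcolK alpha).
Implicit Types (s t x y : R) (f g h : R -> R) (A S : set R).

Lemma hcolK_ge1 : 1 <= hcolK.
Proof. by rewrite /hcolK; have := pi_ge2 R; move: Ha; lra. Qed.

Definition nsqr A f : \bar R := (\int[nu]_x (\1_A x * f x ^+ 2)%:E)%E.

Lemma measurable_nsqr A f : measurable A -> measurable_fun [set: R] f ->
  measurable_fun [set: R] (fun x => \1_A x * f x ^+ 2).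
Proof.
by move=> mA mf; apply: measurable_funM; [exact: measurable_indic|exact: measurable_funX].
Qed.

Lemma nsqr_ge0 A f : (0 <= nsqr A f)%E.
Proof. by apply: integral_ge0 => x _; rewrite lee_fin mulr_ge0 ?sqr_ge0. Qed.

Lemma indic_le1 A x : \1_A x <= 1 :> R.
Proof. by rewrite indicE; case: (_ \in _). Qed.

Lemma nsqr_le_nsq A f : measurable A -> measurable_fun [set: R] f -> (nsqr A f <= nsq f)%E.
Proof.
move=> mA mf; apply: ge0_le_integral => //.
- by move=> x _; rewrite lee_fin mulr_ge0 ?sqr_ge0.
- by apply/measurable_EFinP; exact: measurable_nsqr.
- by apply/measurable_EFinP; exact: measurable_funX.
- by move=> x _; rewrite lee_fin ler_piMl ?sqr_ge0// indic_le1.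
Qed.

(** Only the first variable is localized: thinness controls the mass of the kernel over x in A,
    while y stays free. *)
Definition Qpart A s f : \bar R :=
  dint (fun x y => \1_A x * (dgs s x * hk (16 * s) x y * (`|f x| * `|f y|))).

Lemma Qform_split A s f : 0 < s -> measurable A -> measurable_fun [set: R] f ->
  Qform s f = (Qpart A s f + Qpart (~` A) s f)%E.
Proof.
move=> s0 mA mf; have mQ B : measurable B -> measurable2 (fun x y => \1_B x * (dgs s x * hk (16 * s) x y * (`|f x| * `|f y|))).
  move=> mB; apply: measurable_funM; last exact: measurable2_Qform.
  by apply: measurable2l; exact: measurable_indic.
have Q0 B x y : 0 <= \1_B x * (dgs s x * hk (16 * s) x y * (`|f x| * `|f y|)).
  by apply: mulr_ge0 => //; exact: Qform_kernel_ge0.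
rewrite /Qpart -(dintD alpha (mQ _ mA) (mQ _ (measurableC mA)) (Q0 A) (Q0 _)).
congr dint; apply/funext => x; apply/funext => y; rewrite -mulrDl !indicE in_setC.
by case: (x \in A); rewrite /= ?addr0 ?add0r mul1r.
Qed.

Lemma sum_dgs N s x : 0 < s -> \sum_(i < N) dgs (16 ^+ i * s) x <= 1.
Proof.
move=> s0; have -> : \sum_(i < N) dgs (16 ^+ i * s) x = gss s x - gss (16 ^+ N * s) x.
  elim: N => [|N IH]; first by rewrite big_ord0 expr0 mul1r subrr.
  by rewrite big_ord_recr/= IH /dgs mulrA -exprS; ring.
apply: (@le_trans _ _ (gss s x)); last by rewrite gss_le1 ?ltW.
by rewrite lerBlDr lerDl ltW// gss_gt0.
Qed.

(** Schur's test with a free weight: in the term with f(x)^2 the y-integral of the heat kernel is 1,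
    in the term with f(y)^2 the x-integral is the column mass. *)
Lemma Qpart_AMGM A s (lam : R) f : 0 < s -> 0 < lam -> measurable A -> measurable_fun [set: R] f ->
  (Qpart A s f <= (lam / 2)%:E * \int[nu]_x (\1_A x * dgs s x * f x ^+ 2)%:E +
    (lam^-1 / 2)%:E * \int[nu]_y ((f y ^+ 2)%:E * hcol A s y))%E.
Proof.
move=> s0 l0 mA mf; have s160 : 0 < 16 * s by rewrite mulr_gt0.
have d0 x : 0 <= dgs s x by apply: dgs_ge0; exact: ltW.
have mI : measurable_fun [set: R] (\1_A : R -> R) by exact: measurable_indic.
have md := measurable_dgs s.
have mf2 : measurable_fun [set: R] (fun x => f x ^+ 2) by exact: measurable_funX.
pose k1 x y := hk (16 * s) x y * (\1_A x * dgs s x * f x ^+ 2).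
pose k2 x y := hk (16 * s) x y * (\1_A x * dgs s x) * f y ^+ 2.
have mu1 : measurable_fun [set: R] (fun x => \1_A x * dgs s x * f x ^+ 2).
  by apply: measurable_funM => //; exact: measurable_funM.
have mu2 : measurable_fun [set: R] (fun x => \1_A x * dgs s x) by exact: measurable_funM.
have u10 x : 0 <= \1_A x * dgs s x * f x ^+ 2.
  by apply: mulr_ge0; [exact: mulr_ge0|exact: sqr_ge0].
have u20 x : 0 <= \1_A x * dgs s x by exact: mulr_ge0.
have mk1 : measurable2 k1 by apply: measurable_funM; [exact: measurable2_hk|exact: (measurable2l mu1)].
have mk3 : measurable2 (fun x y => hk (16 * s) x y * (\1_A x * dgs s x)).
  by apply: measurable_funM; [exact: measurable2_hk|exact: (measurable2l mu2)].
have mk2 : measurable2 k2 by apply: measurable_funM; [exact: mk3|exact: (measurable2r mf2)].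
have k10 x y : 0 <= k1 x y by apply: mulr_ge0 => //; exact: hk_ge0.
have k30 x y : 0 <= hk (16 * s) x y * (\1_A x * dgs s x) by apply: mulr_ge0 => //; exact: hk_ge0.
have k20 x y : 0 <= k2 x y by apply: mulr_ge0 => //; exact: sqr_ge0.
have lam20 : 0 <= lam / 2 by rewrite divr_ge0// ltW.
have lamV20 : 0 <= lam^-1 / 2 by rewrite divr_ge0// invr_ge0 ltW.
have e1 : dint k1 = (\int[nu]_x (\1_A x * dgs s x * f x ^+ 2)%:E)%E by exact: dint_hkl.
have e2 : dint k2 = (\int[nu]_y ((f y ^+ 2)%:E * hcol A s y))%E.
  rewrite (dint_swap alpha mk2 k20); apply: eq_integral => y _.
  rewrite /hcol -ge0_integralZl_EFin//; last 3 first.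
  - by move=> x _; rewrite lee_fin; apply: mulr_ge0 => //; exact: hk_ge0.
  - apply/measurable_EFinP; apply: measurable_funTS; apply: measurable_funM => //.
    by under eq_fun do rewrite hkC; exact: measurable_hk.
  - exact: sqr_ge0.
  rewrite [RHS]integral_mkcond; apply: eq_integral => x _; rewrite patchE /k2 indicE; case: (x \in A) => /=.
    by rewrite -EFinM mul1r; congr EFin; ring.
  by rewrite mul0r mulr0 mul0r.
rewrite -e1 -e2 -(dintZ alpha lam20 mk1 k10) -(dintZ alpha lamV20 mk2 k20).
have m1' : measurable2 (fun x y => lam / 2 * k1 x y) by exact: measurable_funM.
have m2' : measurable2 (fun x y => lam^-1 / 2 * k2 x y) by exact: measurable_funM.
rewrite -(dintD alpha m1' m2' (fun x y => mulr_ge0 lam20 (k10 x y)) (fun x y => mulr_ge0 lamV20 (k20 x y))).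
apply: dint_le.
- by apply: measurable_funM; [exact: (measurable2l mI)|exact: measurable2_Qform].
- exact: measurable_funD.
- by move=> x y; apply: mulr_ge0 => //; exact: Qform_kernel_ge0.
- move=> x y; rewrite /k1 /k2.
  have -> : \1_A x * (dgs s x * hk (16 * s) x y * (`|f x| * `|f y|)) =
     hk (16 * s) x y * (\1_A x * dgs s x) * (`|f x| * `|f y|) by ring.
  have -> : lam / 2 * (hk (16 * s) x y * (\1_A x * dgs s x * f x ^+ 2)) +
     lam^-1 / 2 * (hk (16 * s) x y * (\1_A x * dgs s x) * f y ^+ 2) =
     hk (16 * s) x y * (\1_A x * dgs s x) * (lam / 2 * f x ^+ 2 + lam^-1 / 2 * f y ^+ 2) by ring.
  apply: ler_wpM2l; first exact: k30.
  rewrite -(real_normK (num_real (f x))) -(real_normK (num_real (f y))).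
  move: (`|f x|) (`|f y|) => a b.
  have -> : lam / 2 * a ^+ 2 + lam^-1 / 2 * b ^+ 2 = a * b + (lam * a - b) ^+ 2 / (2 * lam).
    by field; rewrite gt_eqF.
  by rewrite lerDl divr_ge0 ?sqr_ge0// mulr_ge0// ltW.
Qed.

Lemma measurable_hcol A s : 0 < s -> measurable A -> measurable_fun [set: R] (hcol A s).
Proof.
move=> s0 mA; have s160 : 0 < 16 * s by rewrite mulr_gt0.
pose k y x := hk (16 * s) x y * (\1_A x * dgs s x).
have mk : measurable2 k.
  apply: measurable_funM.
    by under eq_fun do rewrite hkC; exact: measurable_hk2.
  apply: (measurable2r (u := fun x => \1_A x * dgs s x)).
  by apply: measurable_funM; [exact: measurable_indic|exact: measurable_dgs].
have k0 y x : 0 <= k y x.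
  by apply: mulr_ge0; [exact: hk_ge0|apply: mulr_ge0 => //; apply: dgs_ge0; exact: ltW].
rewrite (_ : hcol A s = fun y => \int[nu]_x (k y x)%:E)%E; first exact: measurable_inner.
apply/funext => y; rewrite /hcol integral_mkcond; apply: eq_integral => x _.
rewrite patchE /k indicE; case: (x \in A) => /=; first by rewrite mul1r mulrC.
by rewrite mul0r mulr0.
Qed.

Lemma hcol_ge0 A s y : 0 < s -> (0 <= hcol A s y)%E.
Proof.
move=> s0; apply: integral_ge0 => x _; rewrite lee_fin; apply: mulr_ge0.
  by apply: dgs_ge0; exact: ltW.
by apply: hk_ge0 => //; rewrite mulr_gt0.
Qed.

(** The first terms add up by [sum_dgs], uniformly in N; the second ones are the column sums of
    [sum_hcol_le]. *)
Lemma sum_Qpart_le A (lam delta : R) s f N : 0 < s -> 0 < lam -> 0 <= delta ->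
  measurable A -> measurable_fun [set: R] f ->
  (forall u y, 0 < u -> 0 <= y -> (hcol A u y <= delta%:E)%E) ->
  (\sum_(i < N) Qpart A (16 ^+ i * s) f <=
    (lam / 2)%:E * nsqr A f + (lam^-1 / 2 * (6 * Num.sqrt (delta * hcolK)))%:E * nsq f)%E.
Proof.
move=> s0 l0 d0 mA mf hd; have u0 i : 0 < 16 ^+ i * s by rewrite mulr_gt0// exprn_gt0.
have mI : measurable_fun [set: R] (\1_A : R -> R) by exact: measurable_indic.
have mf2 : measurable_fun [set: R] (fun x => f x ^+ 2) by exact: measurable_funX.
pose a i x := \1_A x * dgs (16 ^+ i * s) x * f x ^+ 2.
have a0 i x : 0 <= a i x.
  apply: mulr_ge0; last exact: sqr_ge0.
  by apply: mulr_ge0 => //; apply: dgs_ge0; exact: ltW.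
have ma i : measurable_fun [set: R] (a i).
  by apply: measurable_funM => //; apply: measurable_funM => //; exact: measurable_dgs.
pose b i y := ((f y ^+ 2)%:E * hcol A (16 ^+ i * s) y)%E.
have b0 i y : (0 <= b i y)%E by apply: mule_ge0; [rewrite lee_fin sqr_ge0|exact: hcol_ge0].
have mb i : measurable_fun [set: R] (b i).
  by apply: emeasurable_funM; [apply/measurable_EFinP|exact: measurable_hcol].
have lam20 : 0 <= lam / 2 by rewrite divr_ge0// ltW.
have lamV20 : 0 <= lam^-1 / 2 by rewrite divr_ge0// invr_ge0 ltW.
apply: (@le_trans _ _ (\sum_(i < N) ((lam / 2)%:E * \int[nu]_x (a i x)%:E + (lam^-1 / 2)%:E * \int[nu]_y b i y))%E).
  by apply: lee_sum => i _; exact: Qpart_AMGM.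
rewrite big_split/= -!ge0_sume_distrr; last 2 first.
- by move=> i _; exact: integral_ge0.
- by move=> i _; apply: integral_ge0 => x _; rewrite lee_fin.
apply: leeD.
  apply: lee_wpmul2l; first by rewrite lee_fin.
  rewrite -ge0_integral_sum//; last 2 first.
  - by move=> i; apply/measurable_EFinP.
  - by move=> i x _; rewrite lee_fin.
  apply: ge0_le_integral => //.
  - by move=> x _; apply: sume_ge0 => i _; rewrite lee_fin.
  - by apply: emeasurable_sum => i; apply/measurable_EFinP.
  - by apply/measurable_EFinP; exact: measurable_nsqr.
  - move=> x _; rewrite sumEFin lee_fin /a -mulr_suml -mulr_sumr mulrAC ler_piMr//.
      by apply: mulr_ge0 => //; exact: sqr_ge0.
    exact: sum_dgs.
rewrite (EFinM (lam^-1 / 2)) -muleA; apply: lee_wpmul2l; first by rewrite lee_fin.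
rewrite -ge0_integral_sum// /nsq -ge0_integralZl_EFin//; last 2 first.
- by move=> x _; rewrite lee_fin sqr_ge0.
- by apply/measurable_EFinP.
apply: le_integral_mu_a => //.
- exact: emeasurable_sum.
- by apply: emeasurable_funM => //; apply/measurable_EFinP.
- by move=> y; exact: sume_ge0.
- by move=> y; rewrite -EFinM lee_fin mulr_ge0 ?sqr_ge0// mulr_ge0// sqrtr_ge0.
- move=> y y0; rewrite /b -ge0_sume_distrr; last by move=> i _; exact: hcol_ge0.
  rewrite muleC; apply: lee_wpmul2r; first by rewrite lee_fin sqr_ge0.
  by apply: sum_hcol_le => // u u1; exact: hd.
Qed.

(** For x in S the columns are small and the weight [kappa] suffices. For x off S only the bound 1
    on columns is at hand, so a weight inversely proportional to [kappa] moves the cost to the mass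
    of f off S. *)
Lemma sum_Qform_thin (kappa : R) : 0 < kappa -> exists2 eps0 : R, 0 < eps0 & exists2 C : R, 0 <= C &
  forall eps S s f N, 0 < eps < eps0 -> thin alpha eps S -> 0 < s -> measurable_fun [set: R] f ->
  (\sum_(i < N) Qform (16 ^+ i * s) f <= kappa%:E * nsq f + C%:E * nsqr (~` S) f)%E.
Proof.
move=> k0; have K1 := hcolK_ge1; have K0 : 0 < hcolK by exact: lt_le_trans K1.
(* Gives [6 * Num.sqrt (delta * hcolK) = kappa ^+ 2 / 2], so that the second term with weight
   [kappa] is kappa / 4. With kappa / 2 from the first term and kappa / 4 from the part off S, the
   total is kappa. *)
pose delta := (kappa ^+ 2 / 12) ^+ 2 / hcolK.
have d0 : 0 < delta by rewrite divr_gt0// exprn_gt0// divr_gt0// exprn_gt0.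
have [eps0 e0 He] := thin_hcol_small Ha d0.
pose q := 6 * Num.sqrt (1 * hcolK).
have q0 : 0 < q by rewrite mulr_gt0// sqrtr_gt0 mul1r.
(* With the column sum bounded by [q], the second term off S is q / (2 lam) = kappa / 4. *)
pose lam := 2 * q / kappa; have lam0 : 0 < lam by rewrite divr_gt0// mulr_gt0.
exists eps0 => //; exists (lam / 2); first by rewrite divr_ge0// ltW.
move=> eps S s f N ee St s0 mf; have mS : measurable S by case: St.
have u0 i : 0 < 16 ^+ i * s by rewrite mulr_gt0// exprn_gt0.
under eq_bigr => i _ do rewrite (Qform_split (u0 i) mS mf).
rewrite big_split/=.
have h1 := sum_Qpart_le N s0 k0 (ltW d0) mS mf (fun u y hu hy => He eps S u y ee St hu hy).
have h2 : (\sum_(i < N) Qpart (~` S) (16 ^+ i * s) f <=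
    (lam / 2)%:E * nsqr (~` S) f + (lam^-1 / 2 * q)%:E * nsq f)%E.
  apply: sum_Qpart_le => //; first exact: measurableC.
  move=> u y u1 y0; apply: le_trans (hcol_le1 Ha y u1).
  by apply: hcol_le_setT => //; exact: measurableC.
apply: le_trans (leeD h1 h2) _.
have e1 : Num.sqrt (delta * hcolK) = kappa ^+ 2 / 12.
  by rewrite /delta divfK ?gt_eqF// sqrtr_sqr ger0_norm// divr_ge0// sqr_ge0.
have n0 : (0 <= nsq f)%E by apply: integral_ge0 => x _; rewrite lee_fin sqr_ge0.
rewrite e1.
apply: (@le_trans _ _ ((kappa / 2)%:E * nsq f + (kappa^-1 / 2 * (6 * (kappa ^+ 2 / 12)))%:E * nsq f +
   ((lam / 2)%:E * nsqr (~` S) f + (lam^-1 / 2 * q)%:E * nsq f))%E).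
  rewrite leeD2r// leeD2r//; apply: lee_wpmul2l; first by rewrite lee_fin divr_ge0// ltW.
  exact: nsqr_le_nsq.
rewrite addeCA -addeA [X in (_ <= X)%E]addeC leeD2l//.
have -> : lam^-1 / 2 * q = kappa / 4.
  have alg (r : R) : 0 < r -> (2 * r / kappa)^-1 / 2 * r = kappa / 4.
    by move=> r0; field; rewrite !gt_eqF.
  exact: alg.
rewrite (_ : kappa^-1 / 2 * _ = kappa / 4); last by field; rewrite gt_eqF.
have k4 : 0 <= kappa / 4 by rewrite divr_ge0// ltW.
have k2 : 0 <= kappa / 2 by rewrite divr_ge0// ltW.
rewrite -ge0_muleDl ?lee_fin// -EFinD -ge0_muleDl ?lee_fin ?addr_ge0// -EFinD.
by rewrite (_ : kappa / 2 + (kappa / 4 + kappa / 4) = kappa)//; field.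
Qed.

End schur.

(** * The uncertainty inequality *)
Section compact_support.
Variables (R : realType) (alpha : R).
Hypothesis Ha : - 2^-1 < alpha.
Local Notation nu := (mu_a alpha).
Local Notation hk := (hk alpha).
Local Notation nsq := (nsq alpha).
Local Notation nsqr := (nsqr alpha).
Local Notation FB := (FB alpha).
Local Notation heat := (heat alpha).
Local Notation hform := (hform alpha).
Local Notation energy := (energy alpha).
Local Notation integ f := (nu.-integrable [set: R] (EFin \o f)).
Implicit Types (s t x y : R) (f g h : R -> R) (A S : set R).

(** Pointwise, |f| is at most the indicator of [0, b] plus f^2. *)
Lemma compact_integrable f (b : R) : measurable_fun [set: R] f ->
  (forall x, ~ `[0, b]%classic x -> f x = 0) -> (nsq f < +oo)%E -> integ f.
Proof.
move=> mf fb ffin.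
have i2 := integrable_sqr mf ffin.
have i1 : integ (\1_`[0, b] : R -> R).
  apply/integrableP; split; first by apply/measurable_EFinP; exact: measurable_indic.
  rewrite (_ : (\int[nu]_x _)%E = nu `[0, b]%classic); first exact: mu_a_itv_lty.
  rewrite -[RHS]/(nu _) -[in RHS](setIT `[0, b]%classic) -integral_indic//.
  by apply: eq_integral => x _; rewrite /= ger0_norm.
pose G x := \1_`[0, b] x + f x ^+ 2 : R.
apply: (@le_integrable _ _ _ _ _ measurableT _ (EFin \o G)).
- by apply/measurable_EFinP.
- move=> x _; rewrite /= lee_fin /G [leRHS]ger0_norm ?addr_ge0 ?sqr_ge0//.
  rewrite indicE; have [xb|xb] := boolP (x \in `[0, b]%classic).
    rewrite -(real_normK (num_real (f x))); have := sqr_ge0 (`|f x| - 1).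
    by have := normr_ge0 (f x); rewrite sqrrB expr1n mulr1 /=; lra.
  by rewrite fb ?normr0 ?addr_ge0 ?sqr_ge0//; move: xb; rewrite notin_setE.
- rewrite (_ : EFin \o G = (EFin \o (\1_`[0%R, b] : R -> R)) \+ (EFin \o (fun x => f x ^+ 2)%R))%E//.
  exact: integrableD.
Qed.

(** Expanding the square gives f(x)^2 - 2 f(x) T_s f(x) + T_s(f^2)(x), and the last term is
    nonnegative. The inequality is kept pointwise because it is to be multiplied by a Gaussian in
    x. *)
Lemma heat_lower_pointwise s f x : 0 < s -> integ f -> integ (fun y => f y ^+ 2) ->
  ((2^-1 * f x ^+ 2)%:E <= (f x * heat s f x)%:E +
    2^-1%:E * \int[nu]_y (hk s x y * (f x - f y) ^+ 2)%:E)%E.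
Proof.
move=> s0 fi f2i; have mf := integrable_measurable fi.
pose M := (2 `^ (- alpha)) ^+ 2 * bes alpha 0 * gmass alpha pi * s `^ (- (alpha + 1)).
have hkM y : `|hk s x y| <= M.
  by rewrite ger0_norm ?hk_ge0// -hk_abs hk_ubound.
have mh : measurable_fun [set: R] (hk s x) by exact: measurable_hk.
have j1 : integ (fun y => hk s x y * f y).
  rewrite (_ : (fun y => _) = fun y => f y * hk s x y); last by apply/funext => y; rewrite mulrC.
  exact: (integrable_mul_bounded fi mh hkM).
have j2 : integ (fun y => hk s x y * f y ^+ 2).
  rewrite (_ : (fun y => _) = fun y => f y ^+ 2 * hk s x y); last by apply/funext => y; rewrite mulrC.
  exact: (integrable_mul_bounded f2i mh hkM).
have j0 : integ (hk s x) by exact: integrable_hk.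
have E0 : \int[nu]_y (hk s x y) = 1 by rewrite /Rintegral integral_hk.
have k0 : integ (fun y => f x ^+ 2 * hk s x y).
  by rewrite (_ : _ \o _ = (fun y => (f x ^+ 2)%:E * (EFin \o hk s x) y)%E)//; exact: integrableZl.
have k1 : integ (fun y => (2 * f x) * (hk s x y * f y)).
  by rewrite (_ : _ \o _ = (fun y => (2 * f x)%:E * (EFin \o (fun y => hk s x y * f y)%R) y)%E)//; exact: integrableZl.
have k01 : integ (fun y => f x ^+ 2 * hk s x y - (2 * f x) * (hk s x y * f y)).
  by rewrite (_ : _ \o _ = (EFin \o (fun y => f x ^+ 2 * hk s x y)%R) \- (EFin \o (fun y => (2 * f x) * (hk s x y * f y))%R))%E//; exact: integrableB.
have k012 : integ (fun y => f x ^+ 2 * hk s x y - (2 * f x) * (hk s x y * f y) + hk s x y * f y ^+ 2).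
  by rewrite (_ : _ \o _ = (EFin \o (fun y => f x ^+ 2 * hk s x y - (2 * f x) * (hk s x y * f y))%R) \+ (EFin \o (fun y => hk s x y * f y ^+ 2)%R))%E//; exact: integrableD.
have e : (\int[nu]_y (hk s x y * (f x - f y) ^+ 2)%:E =
    (f x ^+ 2 - 2 * f x * heat s f x + \int[nu]_y (hk s x y * f y ^+ 2))%:E)%E.
  rewrite (_ : f x ^+ 2 - _ + _ = \int[nu]_y (f x ^+ 2 * hk s x y - (2 * f x) * (hk s x y * f y) + hk s x y * f y ^+ 2)).
    rewrite (EFin_Rintegral k012); apply: eq_integral => y _; congr EFin; ring.
  by rewrite RintegralD// RintegralB// RintegralZl// RintegralZl// E0 mulr1.
rewrite e -EFinM -EFinD lee_fin.
have : 0 <= \int[nu]_y (hk s x y * f y ^+ 2).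
  by apply: Rintegral_ge0 => y _; apply: mulr_ge0; [exact: hk_ge0|exact: sqr_ge0].
by move: (Rintegral _ _ _) (heat s f x) (f x) => c d a c0; lra.
Qed.

(** On the support the Gaussian lies between 1/2 and 1, which turns the constant 1/2 of the
    pointwise inequality into 1/4. *)
Lemma hform_lower s f (b : R) : 0 < s -> measurable_fun [set: R] f ->
  (forall x, ~ `[0, b]%classic x -> f x = 0) -> (nsq f < +oo)%E -> 2^-1 <= gss s b ->
  (4^-1%:E * nsq f <= (hform s s f)%:E + 2^-1%:E * energy s f)%E.
Proof.
move=> s0 mf fb ffin gb; have fi := compact_integrable mf fb ffin.
have f2i := integrable_sqr mf ffin.
pose E x := (\int[nu]_y (hk s x y * (f x - f y) ^+ 2)%:E)%E.
have mE : measurable_fun [set: R] E.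
  apply: measurable_inner; first exact: measurable2_energy.
  by move=> x y; exact: energy_kernel_ge0.
have E0 x : (0 <= E x)%E by apply: integral_ge0 => y _; rewrite lee_fin energy_kernel_ge0.
have h20 : 0 <= 2^-1 :> R by rewrite invr_ge0.
have [M hM] := heat_bounded Ha s0 fi.
have hi : integ (fun x => gss s x * f x * heat s f x).
  apply: (integrable_mul_bounded _ (measurable_heat Ha s mf) hM).
  exact: integrable_gss_mul (ltW s0) fi.
have mhi := integrable_measurable hi.
have pw x : ((4^-1 * f x ^+ 2)%:E <= (gss s x * f x * heat s f x)%:E + 2^-1%:E * E x)%E.
  have [xb|xb] := boolP (x \in `[0, b]%classic); last first.
    rewrite notin_setE in xb; rewrite fb// mulr0 mul0r expr0n/= mulr0 add0e.
    by rewrite mule_ge0// lee_fin.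
  have := heat_lower_pointwise x s0 fi f2i; rewrite -/(E x); have := E0 x.
  case: (E x) => [e| |]//=; last first.
    by move=> _ _; rewrite gt0_muley ?lte_fin ?invr_gt0// addey// leey.
  rewrite -!EFinM -!EFinD !lee_fin => e0 h.
  have g1 : gss s x <= 1 by rewrite gss_le1// ltW.
  have g2 : 2^-1 <= gss s x.
    apply: (le_trans gb); rewrite ler_expR lerN2 ler_wpM2l ?mulr_ge0 ?pi_ge0 ?(ltW s0)//.
    move: xb; rewrite inE /= in_itv/= => /andP[x0 xb].
    by rewrite lerXn2r ?nnegrE// (le_trans x0).
  have g0 : 0 <= gss s x by exact: le_trans g2.
  have h' := ler_wpM2l g0 h.
  have a0 := sqr_ge0 (f x).
  have p1 : 4^-1 * f x ^+ 2 <= gss s x * (2^-1 * f x ^+ 2).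
    by rewrite [leRHS]mulrA; apply: ler_wpM2r => //; lra.
  have p2 : gss s x * (2^-1 * e) <= 2^-1 * e by rewrite ler_piMl ?mulr_ge0.
  apply: (le_trans p1); apply: (le_trans h'); rewrite mulrDr mulrA.
  by rewrite lerD2l.
have eE : energy s f = (\int[nu]_x E x)%E by [].
have en0 : (0 <= energy s f)%E by exact: energy_ge0.
have [einf|efin] := eqVneq (energy s f) +oo%E.
  by rewrite einf gt0_muley ?lte_fin ?invr_gt0// addey// leey.
have Ei : nu.-integrable [set: R] E.
  apply/integrableP; split => //; under eq_integral do rewrite gee0_abs//.
  by rewrite -eE ltey.
have E2i : nu.-integrable [set: R] (fun x => 2^-1%:E * E x)%E by exact: integrableZl.
apply: (@le_trans _ _ (\int[nu]_x ((gss s x * f x * heat s f x)%:E + 2^-1%:E * E x))%E).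
  rewrite /nsq -ge0_integralZl_EFin ?invr_ge0//; last 2 first.
  - by move=> x _; rewrite lee_fin sqr_ge0.
  - by apply/measurable_EFinP; exact: measurable_funX.
  apply: ge0_le_integral => //.
  - by move=> x _; rewrite -EFinM lee_fin mulr_ge0 ?sqr_ge0// invr_ge0.
  - by apply/measurable_EFinP; apply: measurable_funM => //; exact: measurable_funX.
  - by apply: emeasurable_funD; [apply/measurable_EFinP|exact: emeasurable_funM].
  - by move=> x _; rewrite -EFinM; exact: pw.
rewrite integralD// integralZl// -eE /hform (EFin_Rintegral hi)//.
Qed.

Let cvg_pow (c z : R) : 0 <= z < 1 -> (fun k : nat => c * z ^+ k) @ \oo --> (0 : R).
Proof.
move=> /andP[z0 z1]; rewrite -[X in _ --> X](mulr0 c); apply: cvgMr; apply: cvg_expr.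
by rewrite ger0_norm.
Qed.

Let near_pow (c z e : R) : 0 <= z < 1 -> 0 < e -> \forall k \near \oo, c * z ^+ k <= e.
Proof. by move=> hz e0; exact: (@cvgr_le _ _ _ _ _ _ (cvg_pow c hz) _ e0). Qed.

Lemma hform_scales_bound f (b : R) e : measurable_fun [set: R] f ->
  (forall x, ~ `[0, b]%classic x -> f x = 0) -> (nsq f < +oo)%E -> 0 < e ->
  exists2 s : R, 0 < s & exists N : nat,
   ((4^-1%:E * nsq f <= (hform s s f)%:E + (e / 2)%:E)%E /\
    hform (16 ^+ N * s) (16 ^+ N * s) f <= e / 2).
Proof.
move=> mf fb ffin e0; have fi := compact_integrable mf fb ffin.
have e2 : 0 < e / 2 by rewrite divr_gt0.
have z1 : 0 <= (16^-1 : R) < 1.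
  by apply/andP; split; [rewrite invr_ge0|rewrite invf_lt1// ltr1n].
have z2 : 0 <= (4^-1 : R) < 1.
  by apply/andP; split; [rewrite invr_ge0|rewrite invf_lt1// ltr1n].
pose L := (2 `^ (- alpha)) ^+ 2 * bes alpha 0 * gmass alpha pi * (\int[nu]_x `|f x|) ^+ 2.
have h20 : 0 < 2^-1 :> R by rewrite invr_gt0.
have [k _ /(_ k (leqnn k)) [[k1 k2] k3]] := filterI (filterI (energy_vanishes_compact Ha mf fb ffin e0)
  (near_pow (pi * b ^+ 2) z1 h20)) (near_pow L z2 e2).
exists (16^-1 ^+ k); first by rewrite exprn_gt0.
(* One k serves both ends: the scales run from 16^(-k) through 1 to 16^k. *)
exists (k + k)%N; split.
  apply: (@le_trans _ _ ((hform (16^-1 ^+ k) (16^-1 ^+ k) f)%:E + 2^-1%:E * energy (16^-1 ^+ k) f)%E).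
    apply: (hform_lower (b := b)) => //.
    rewrite /gss; apply: le_trans (expR_ge1Dx _).
    by move: k2; rewrite mulrAC; lra.
  by rewrite leeD2l// mulrC EFinM; apply: lee_wpmul2l.
have -> : 16 ^+ (k + k) * 16^-1 ^+ k = 16 ^+ k :> R.
  by rewrite exprD -mulrA -exprMn divff// expr1n mulr1.
apply: le_trans (ler_norm _) _; apply: le_trans (hform_le_power Ha _ fi) _.
  by rewrite exprn_ege1// ler1n.
rewrite -/L (_ : 16 ^+ k = (4 ^+ k) ^+ 2); last first.
  by rewrite exprAC (_ : 4 ^+ 2 = 16)//; ring.
by rewrite sqrtr_sqr ger0_norm ?exprn_ge0// -exprVn.
Qed.

Lemma compact_inequality : exists2 eps0 : R, 0 < eps0 &
  exists2 C : R, 0 <= C & forall eps S Sigma f (b : R),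
    0 < eps < eps0 -> thin alpha eps S -> thin alpha eps Sigma ->
    measurable_fun [set: R] f -> (forall x, ~ `[0, b]%classic x -> f x = 0) -> (nsq f < +oo)%E ->
    (nsq f <= C%:E * (nsqr (~` S) f + nsqr (~` Sigma) (FB f)))%E.
Proof.
pose K4 : R := (2 `^ (alpha + 1)) ^+ 4.
have K40 : 0 <= K4 by rewrite exprn_ge0// powR_ge0.
have K41 : 0 < K4 + 1 by rewrite ltr_wpDl.
(* The forms in f and in g contribute kappa K4 and kappa, the norm of g being at most that of f.
   Together they cost 1/8 of the squared norm, half of the 1/4 on the left. *)
pose kappa := (8 * (K4 + 1))^-1.
have kap0 : 0 < kappa by rewrite invr_gt0 mulr_gt0.
have [eps0 e0 [C1 C10 HQ]] := sum_Qform_thin Ha kap0.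
exists eps0 => //; exists (8 * C1 * (K4 + 1)); first by rewrite !mulr_ge0// ltW.
move=> eps S Sigma f b ee St Sgt mf fb ffin.
have mS : measurable S by case: St.
have mSg : measurable Sigma by case: Sgt.
have fi := compact_integrable mf fb ffin.
have mg := measurable_FB Ha mf.
have n0 h : (0 <= nsq h)%E by apply: integral_ge0 => x _; rewrite lee_fin sqr_ge0.
have gle := nsq_FB_le Ha fi.
have gfin := le_lt_trans gle ffin.
have a1 := nsqr_le_nsq alpha (measurableC mS) mf.
have a2 := nsqr_le_nsq alpha (measurableC mSg) mg.
have F1 : nsq f \is a fin_num by rewrite ge0_fin_numE.
have F2 : nsq (FB f) \is a fin_num by rewrite ge0_fin_numE.
have F3 : nsqr (~` S) f \is a fin_num by rewrite ge0_fin_numE ?nsqr_ge0// (le_lt_trans a1).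
have F4 : nsqr (~` Sigma) (FB f) \is a fin_num by rewrite ge0_fin_numE ?nsqr_ge0// (le_lt_trans a2).
apply/lee_addgt0Pr => e' e'0; have e0' : 0 < e' / 8 by rewrite divr_gt0.
have [s s0 [N [h1 h2]]] := hform_scales_bound mf fb ffin e0'.
have h3 := hform_telescope Ha N s0 fi.
have q1 := HQ _ _ s f N ee St s0 mf.
have q2 := HQ _ _ s (FB f) N ee Sgt s0 mg.
have h4 := le_trans h3 (leeD2l (hform (16 ^+ N * s) (16 ^+ N * s) f)%:E (leeD (lee_wpmul2l _ q1) q2)).
have {}h4 := h4 K40.
move: h1 h4 gle; rewrite -(fineK F1) -(fineK F2) -(fineK F3) -(fineK F4).
have n30 : 0 <= fine (nsqr (~` S) f) by rewrite fine_ge0// nsqr_ge0.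
have n40 : 0 <= fine (nsqr (~` Sigma) (FB f)) by rewrite fine_ge0// nsqr_ge0.
move=> h1 h4 gle; move: h1 h2 h4 gle n30 n40; rewrite -/K4; clear h3.
move: (hform s s f) (hform (16 ^+ N * s) (16 ^+ N * s) f) (fine (nsqr _ f)) (fine (nsqr _ (FB f))) (fine (nsq f)) (fine (nsq (FB f))).
move=> a c p q n m; rewrite -!EFinM -!EFinD !lee_fin => h1 h2 h4 mn p0 q0.
have kE : kappa * (K4 + 1) = 8^-1 by rewrite /kappa; field; rewrite gt_eqF.
have t1 : kappa * m <= kappa * n by rewrite ler_wpM2l// ltW.
have t2 : 0 <= C1 * K4 * q by rewrite !mulr_ge0.
have t3 : 0 <= C1 * p by rewrite mulr_ge0.
have kn : kappa * (K4 + 1) * n = 8^-1 * n by rewrite kE.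
clearbody kappa K4.
by move: h1 h2 h4 mn p0 q0 t1 t2 t3 kn; clear; lra.
Qed.

End compact_support.

(** * From compact support to all square integrable functions *)

Section square_norms.
Variables (R : realType) (alpha : R).
Hypothesis Ha : - 2^-1 < alpha.
Local Notation nu := (mu_a alpha).
Local Notation leb := (@lebesgue_measure R).
Local Notation Rp := (@Rplus R).
Local Notation w := (wdens alpha).
Implicit Types (x y : R) (f g h : R -> R) (A S : set R).

Let mRp := @measurable_Rplus R.

Let m_w2 A h : measurable_fun Rp h ->
  measurable_fun (T:=measurableTypeR R) (A `&` Rp) (fun x => (w x * h x ^+ 2)%:E).
Proof.
move=> mh; apply/measurable_EFinP; apply: measurable_funM; first exact: measurable_wdens.
apply: measurable_funX; apply: measurable_funS mh; first exact: mRp.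
exact: subIsetr.
Qed.

Let w2_ge0 h x : (0 <= (w x * h x ^+ 2)%:E)%E.
Proof. by rewrite lee_fin mulr_ge0 ?sqr_ge0// wdens_ge0. Qed.

Lemma sqnorm_ge0 A h : (0 <= sqnorm alpha A h)%E.
Proof. by apply: integral_ge0 => x _; exact: w2_ge0. Qed.

Lemma sqnorm_le A g h : measurable A -> measurable_fun Rp g -> measurable_fun Rp h ->
  (forall x, 0 <= x -> g x ^+ 2 <= h x ^+ 2) -> (sqnorm alpha A g <= sqnorm alpha A h)%E.
Proof.
move=> mA mg mh gh; apply: ge0_le_integral => //.
- by apply: measurableI => //; exact: mRp.
- exact: m_w2.
- exact: m_w2.
- move=> x [_]; rewrite /Rplus /= in_itv/= andbT => x0.
  by rewrite lee_fin ler_wpM2l ?wdens_ge0// gh.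
Qed.

Lemma sqnorm_subset A h : measurable A -> measurable_fun Rp h ->
  (sqnorm alpha A h <= sqnorm alpha setT h)%E.
Proof.
move=> mA mh; apply: ge0_subset_integral => //.
- by apply: measurableI => //; exact: mRp.
- by apply: measurableI => //; exact: mRp.
- exact: m_w2.
- exact: setSI.
Qed.

Lemma sqnorm_nsqr A h : measurable A -> measurable_fun [set: R] h ->
  sqnorm alpha A h = nsqr alpha A h.
Proof.
move=> mA mh; rewrite /nsqr ge0_integral_mu_a//; last 2 first.
- by apply/measurable_EFinP; exact: measurable_nsqr.
- by move=> x; rewrite lee_fin mulr_ge0 ?sqr_ge0.
rewrite /sqnorm setIC integral_mkcondr; apply: eq_integral => x _.
rewrite patchE indicE; case: (x \in A) => /=; last by rewrite mul0r mul0e.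
by rewrite mul1r -EFinM mulrC.
Qed.

Lemma sqnormT_nsq h : measurable_fun [set: R] h -> sqnorm alpha setT h = nsq alpha h.
Proof.
move=> mh; rewrite sqnorm_nsqr//; apply: eq_integral => x _.
by rewrite indicE in_setT mul1r.
Qed.

Lemma sqnormD_le A g h : measurable A -> measurable_fun Rp g -> measurable_fun Rp h ->
  (sqnorm alpha A h <= 2%:E * sqnorm alpha A g + (2:R)%:E * sqnorm alpha A (fun x => h x - g x)%R)%E.
Proof.
move=> mA mg mh; have mAR : measurable (A `&` Rp) by apply: measurableI => //; exact: mRp.
have mhg : measurable_fun Rp (fun x => h x - g x) by exact: measurable_funB.
have nn (u : R -> R) x : (0 <= (2:R)%:E * (w x * u x ^+ 2)%:E)%E by apply: mule_ge0 => //; rewrite lee_fin.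
have mm (u : R -> R) : measurable_fun Rp u ->
    measurable_fun (T:=measurableTypeR R) (A `&` Rp) (fun x => (2:R)%:E * (w x * u x ^+ 2)%:E)%E.
  by move=> mu; apply: emeasurable_funM; [exact: measurable_cst|exact: m_w2].
have e (u : R -> R) : measurable_fun Rp u ->
    (\int[leb]_(x in A `&` Rp) ((2:R)%:E * (w x * u x ^+ 2)%:E) = (2:R)%:E * sqnorm alpha A u)%E.
  by move=> mu; rewrite ge0_integralZl_EFin//; exact: m_w2.
rewrite -(e _ mg) -(e _ mhg).
have eD : (\int[leb]_(x in A `&` Rp) ((2:R)%:E * (w x * g x ^+ 2)%:E + (2:R)%:E * (w x * (h x - g x) ^+ 2)%:E) =
    \int[leb]_(x in A `&` Rp) ((2:R)%:E * (w x * g x ^+ 2)%:E) +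
    \int[leb]_(x in A `&` Rp) ((2:R)%:E * (w x * (h x - g x) ^+ 2)%:E))%E.
  by apply: ge0_integralD => //; [exact: mm|move=> x _; exact: (nn (fun x => h x - g x))|exact: (mm _ mhg)].
rewrite -eD.
apply: ge0_le_integral => //.
- exact: m_w2.
- by apply: emeasurable_funD; exact: mm.
- move=> x _; rewrite -!EFinM -EFinD lee_fin ![2 * (w x * _)]mulrCA -mulrDr.
  rewrite ler_wpM2l ?wdens_ge0//.
  have := sqr_ge0 (h x - g x - g x); move: (h x) (g x) => a b.
  by have -> : a ^+ 2 = (a - b + b) ^+ 2 by [rewrite subrK|]; rewrite sqrrB sqrrD; lra.
Qed.

Definition cutoff f (n : nat) : R -> R := f \_ `[0, n%:R]%classic.

Lemma cutoffE f n x : cutoff f n x = if 0 <= x <= n%:R then f x else 0.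
Proof. by rewrite /cutoff patchE mem_setE in_itv. Qed.

Lemma measurable_cutoff f n : measurable_fun Rp f -> measurable_fun [set: R] (cutoff f n).
Proof.
move=> mf; apply/(measurable_restrict f) => //.
rewrite setTI; apply: measurable_funS mf => //.
by move=> x; rewrite /Rplus /= !in_itv/= => /andP[->].
Qed.

Lemma FB1_cutoff f n y : measurable_fun Rp f -> FB1 alpha (trunc f n) y = FB alpha (cutoff f n) y.
Proof.
move=> mf; rewrite /FB /Rintegral integral_mu_a; last first.
  apply: measurable_funM; first exact: measurable_cutoff.
  by under eq_fun do rewrite jbC; exact: measurable_jb.
congr fine; apply: eq_integral => x; rewrite inE /Rplus /= in_itv/= andbT => x0.
by rewrite jbesselE cutoffE x0 /trunc.
Qed.

Lemma cvg_sqnorm_cutoff f : measurable_fun Rp f ->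
  sqnorm alpha setT (cutoff f n) @[n --> \oo] --> sqnorm alpha setT f.
Proof.
move=> mf; pose G n x := (w x * cutoff f n x ^+ 2)%:E.
have mT : measurable (setT `&` Rp) by apply: measurableI => //; exact: mRp.
have E x : (w x * f x ^+ 2)%:E = (w x * f x ^+ 2)%:E by [].
rewrite /sqnorm.
have -> : (\int[leb]_(x in setT `&` Rp) (w x * f x ^+ 2)%:E =
    \int[leb]_(x in setT `&` Rp) limn (G ^~ x))%E.
  apply: eq_integral => x; rewrite inE /Rplus /= in_itv/= andbT => -[_ x0].
  apply/esym/cvg_lim => //; apply: cvg_near_cst.
  near=> n; rewrite /G cutoffE x0 /= ifT//.
  by near: n; exact: nbhs_infty_ger.
apply: cvg_monotone_convergence => //.
- by move=> n; apply: m_w2; apply: measurable_funTS; exact: measurable_cutoff.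
- move=> x [_]; rewrite /Rplus /= in_itv/= andbT => x0 m n mn.
  rewrite lee_fin ler_wpM2l ?wdens_ge0// !cutoffE x0 /=.
  case: (leP x m%:R) => xm; last by rewrite expr0n sqr_ge0.
  by rewrite ifT// (le_trans xm)// ler_nat.
Unshelve. all: by end_near. Qed.

(** The compact case applies to the cutoffs. Their transforms are compared with g by [sqnormD_le],
    which doubles the constant and leaves an error tending to 0. *)
Lemma L2_inequality : exists2 eps0 : R, 0 < eps0 &
  exists2 C : R, 0 <= C & forall eps S Sigma f g,
    0 < eps < eps0 -> thin alpha eps S -> thin alpha eps Sigma ->
    inL2 alpha f -> isFB alpha f g ->
    (sqnorm alpha setT f <= C%:E * (sqnorm alpha (~` S) f + sqnorm alpha (~` Sigma) g))%E.
Proof.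
have [eps0 e0 [C C0 H]] := compact_inequality Ha.
exists eps0 => //; exists (2 * C); first by rewrite mulr_ge0.
move=> eps S Sigma f g ee St Sgt [mf ffin] [[mg gfin] cv].
have mS : measurable (~` S) by case: St => h _; exact: measurableC.
have mSg : measurable (~` Sigma) by case: Sgt => h _; exact: measurableC.
have mc n := measurable_cutoff n mf.
have mc' n : measurable_fun Rp (cutoff f n) by exact: measurable_funTS.
have cle n x : 0 <= x -> cutoff f n x ^+ 2 <= f x ^+ 2.
  by move=> x0; rewrite cutoffE; case: ifP => // _; rewrite expr0n sqr_ge0.
pose G n y := FB alpha (cutoff f n) y.
have mG n : measurable_fun [set: R] (G n) by exact: measurable_FB.
have mG' n : measurable_fun Rp (G n) by exact: measurable_funTS.
have F1 n : (fun y => FB1 alpha (trunc f n) y - g y) = (fun y => G n y - g y).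
  by apply/funext => y; rewrite FB1_cutoff.
pose P := sqnorm alpha (~` S) f; pose Q := sqnorm alpha (~` Sigma) g.
pose err n := sqnorm alpha setT (fun y => G n y - g y).
have step n : (sqnorm alpha setT (cutoff f n) <= C%:E * (P + ((2:R)%:E * Q + (2:R)%:E * err n)))%E.
  rewrite sqnormT_nsq//; apply: le_trans (H eps S Sigma (cutoff f n) n%:R ee St Sgt (mc n) _ _) _.
  - by move=> x xn; rewrite /cutoff patchE memNset.
  - by rewrite -sqnormT_nsq//; apply: le_lt_trans ffin; exact: (sqnorm_le measurableT (mc' n) mf (cle n)).
  apply: lee_wpmul2l; first by rewrite lee_fin.
  rewrite -(sqnorm_nsqr mS (mc n)) -(sqnorm_nsqr mSg (mG n)).
  apply: leeD; first exact: (sqnorm_le mS (mc' n) mf (cle n)).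
  apply: le_trans (sqnormD_le mSg mg (mG' n)) _; rewrite leeD2l//.
  apply: lee_wpmul2l; first by rewrite lee_fin.
  by apply: sqnorm_subset => //; exact: measurable_funB.
have cverr : err n @[n --> \oo] --> (0%R : R)%:E.
  by move: cv; rewrite (_ : (fun n => _) = err)//; apply/funext => n; rewrite F1.
apply/lee_addgt0Pr => e e0'.
(* The summand 1 keeps the divisor positive when [C] is 0. *)
have e1 : 0 < e / (2 * C + 1) by rewrite divr_gt0// ltr_wpDl// mulr_ge0.
have /fine_cvgP[efin ecv] := cverr.

have cs := cvg_sqnorm_cutoff mf.
rewrite -(cvg_lim _ cs)//; apply: lime_le; first by apply/cvg_ex; eexists; exact: cs.
apply: filterS2 efin (@cvgr_le _ _ _ _ _ _ ecv _ e1) => n /= nfin nle; apply: le_trans (step n) _.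
have P0 : (0 <= P)%E by exact: sqnorm_ge0.
have Q0 : (0 <= Q)%E by exact: sqnorm_ge0.
have er0 : (0 <= err n)%E by exact: sqnorm_ge0.
have Pf : P \is a fin_num by rewrite ge0_fin_numE//; apply: le_lt_trans ffin; exact: sqnorm_subset.
have Qf : Q \is a fin_num by rewrite ge0_fin_numE//; apply: le_lt_trans gfin; exact: sqnorm_subset.
rewrite -/P -/Q; move: P0 Q0 er0 nle.
rewrite -(fineK Pf) -(fineK Qf) -(fineK nfin) /=.
move: (fine P) (fine Q) (fine (err n)) => p q r.
rewrite -!(EFinM, EFinD) !lee_fin ler_pdivlMr ?ltr_wpDl ?mulr_ge0// => p0 q0 r0 hr.
by have := mulr_ge0 C0 p0; lra.
Qed.

Lemma cnorm_fin A u v : measurable A -> inL2 alpha u -> inL2 alpha v ->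
  (sqnorm alpha A u + sqnorm alpha A v)%E \is a fin_num.
Proof.
move=> mA [mu hu] [mv hv]; rewrite ge0_fin_numE; last by apply: adde_ge0; exact: sqnorm_ge0.
by apply: lte_add_pinfty; [apply: le_lt_trans hu|apply: le_lt_trans hv]; exact: sqnorm_subset.
Qed.

Lemma sqrtrD_le (a b : R) : 0 <= a -> 0 <= b -> Num.sqrt (a + b) <= Num.sqrt a + Num.sqrt b.
Proof.
move=> a0 b0; rewrite -(@ler_pXn2r _ 2) ?nnegrE ?addr_ge0 ?sqrtr_ge0//.
by rewrite sqr_sqrtr ?addr_ge0// sqrrD !sqr_sqrtr// addrAC lerDl mulrn_wge0.
Qed.

End square_norms.

Theorem theoremB (R : realType) (alpha : R) :
  - 2^-1 < alpha ->
  exists eps0 : R, 0 < eps0 /\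
  forall eps : R, 0 < eps < eps0 ->
  exists C : R,
  forall (S Sigma : set R), thin alpha eps S -> thin alpha eps Sigma ->
  forall (f1 f2 g1 g2 : R -> R),
    inL2 alpha f1 -> inL2 alpha f2 ->
    isFB alpha f1 g1 -> isFB alpha f2 g2 ->
    cnorm alpha setT f1 f2 <=
      C * (cnorm alpha (~` S) f1 f2 + cnorm alpha (~` Sigma) g1 g2).
Proof.
move=> Ha; have [eps0 e0 [C C0 H]] := L2_inequality Ha.
exists eps0; split => // eps ee; exists (Num.sqrt C) => S Sigma St Sgt f1 f2 g1 g2 L1 L2 F1 F2.
have mS : measurable (~` S) by case: St => h _; exact: measurableC.
have mSg : measurable (~` Sigma) by case: Sgt => h _; exact: measurableC.
have Lg1 : inL2 alpha g1 by case: F1.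
have Lg2 : inL2 alpha g2 by case: F2.
have h1 := H _ _ _ _ _ ee St Sgt L1 F1; have h2 := H _ _ _ _ _ ee St Sgt L2 F2.
have n0 A h := sqnorm_ge0 alpha A h.
(* The Bessel kernel is real, so real and imaginary parts are transformed separately and their
   squared inequalities add. *)
have hs : (sqnorm alpha setT f1 + sqnorm alpha setT f2 <=
    C%:E * ((sqnorm alpha (~` S) f1 + sqnorm alpha (~` S) f2) +
            (sqnorm alpha (~` Sigma) g1 + sqnorm alpha (~` Sigma) g2)))%E.
  apply: le_trans (leeD h1 h2) _.
  rewrite -ge0_muleDr; [|exact: adde_ge0 (n0 _ _) (n0 _ _)|exact: adde_ge0 (n0 _ _) (n0 _ _)].
  by move: (sqnorm _ _ f1) (sqnorm _ _ g1) (sqnorm _ _ f2) (sqnorm _ _ g2) => a b c d; rewrite addeACA.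
have a0 : (0 <= sqnorm alpha (~` S) f1 + sqnorm alpha (~` S) f2)%E by exact: adde_ge0 (n0 _ _) (n0 _ _).
have b0 : (0 <= sqnorm alpha (~` Sigma) g1 + sqnorm alpha (~` Sigma) g2)%E by exact: adde_ge0 (n0 _ _) (n0 _ _).
rewrite /cnorm; move: a0 b0 hs.
rewrite -(fineK (cnorm_fin measurableT L1 L2)) -(fineK (cnorm_fin mS L1 L2)) -(fineK (cnorm_fin mSg Lg1 Lg2)).
rewrite -EFinD -EFinM !lee_fin /=.
move: (fine _) (fine _) (fine _) => t b a a0 b0 hs.
apply: (@le_trans _ _ (Num.sqrt (C * (a + b)))); first by rewrite ler_wsqrtr.
by rewrite sqrtrM// ler_wpM2l ?sqrtr_ge0// sqrtrD_le.
Qed.
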